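(* Let $X=\overline{\mathcal{R}[T_\infty]}$ be the Ghys–Kenyon minimal set, endowed with a Borel probability measure $\mu$ that is a weak limit of a subsequence of the measures $\mu_n$ (normalized counting measures on balls of $\mathcal{R}[T_\infty]$), and let $\mathcal{S}_4=\{0,1,2,3\}^{\mathbb{N}}$ be endowed with the equidistributed probability measure $\mu_4$. Then the coding map $\Phi:\mathcal{S}_4\to Y^{\leq2}\subset X$ defines a stable orbit equivalence between the measured equivalence relations $\mathcal{R}_{\mathrm{cof}}$ on $(\mathcal{S}_4,\mu_4)$ and $\mathcal{R}$ on $(X,\mu)$: the $\mathcal{R}$-saturation of $Y^{\leq2}$ has full $\mu$-measure and $\Phi$ is an orbit equivalence between $(\mathcal{R}_{\mathrm{cof}},\mathcal{S}_4,\mu_4)$ and the induced relation $(\mathcal{R}|_{Y^{\leq2}},Y^{\leq2},\mu|_{Y^{\leq2}})$.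
   Context: Ambient space. $\mathcal{Z}^2$ is the Cayley graph of $\mathbb{Z}^2$ for the generators $(\pm1,0),(0,\pm1)$ (vertices $\mathbb{Z}^2\subset\mathbb{C}$, edges of length 1). $\mathcal{T}$ is the set of infinite connected subgraphs of $\mathcal{Z}^2$ containing $0$. For $T\in\mathcal{T}$, $B_T(0,N)$ is the open ball of centre $0$ and radius $N$ for the path metric of $T$. For $T,T'\in\mathcal{T}$ let $R(T,T')=\sup\{N\geq1: B_T(0,N)=B_{T'}(0,N)\}$ ($0$ if this set is empty) and $d(T,T')=e^{-R(T,T')}$; $(\mathcal{T},d)$ is compact. $\mathcal{R}$ identifies $T$ and $T'$ iff $T'=T-v$ for some vertex $v$ of $T$; $\mathcal{R}[T]$ is the class of $T$. $val(T)$ is the number of edges of $T$ issuing from $0$. Kenyon tree. $T_1$ is the tree made of the segments $[-1,1]\times\{0\}$ and $\{0\}\times[-2,2]$. Given $T_n$, take the union of the images of $T_n+(0,2^n)$ under the rotations about $0$ of angles $0,\pi/2,\pi,3\pi/2$, and remove the two terminal edges (with their terminal vertices) contained in the horizontal axis; the result is $T_{n+1}$. The $T_n$ are increasing and $T_\infty=\bigcup_{n\geq1}T_n$. $X=\overline{\mathcal{R}[T_\infty]}$ (closure in $\mathcal{T}$), $Y=X-\mathcal{R}[T_\infty]$, $Y^{\leq2}=\{T\in Y: val(T)\leq2\}$. For $n\geq1$, $\mu_n$ is the uniform probability measure on the finite set $\{T_\infty-p: p \text{ a vertex of } B_{T_\infty}(0,n)\}\subset\mathcal{R}[T_\infty]$.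 Coding. Put $\mathbf{r}(k)=e^{\frac{\pi}{2}ik}$ for $k\in\{0,1,2,3\}=\mathbb{Z}_4$. For $\alpha=\alpha_0\alpha_1\dots\in\mathcal{S}_4$ let $x_0=0$ and $x_{n}=x_{n-1}+2^{n-1}\mathbf{r}(\alpha_{n-1})$. Let $P_0=\{0\}$; given the finite tree $P_n$, there is a unique edge of $\mathcal{Z}^2$ joining $x_{n+1}$ to a vertex of $P_n$; $P_{n+1}$ is the union of $P_n$ together with this edge and of their images under the rotations of centre $x_{n+1}$ and angles $\pi/2,\pi,3\pi/2$. Then $\Phi(\alpha)=\bigcup_{n\geq0}P_n\in Y^{\leq 2}$. Relations. $\mathcal{R}_{\mathrm{cof}}$ is the cofinal relation on $\mathcal{S}_4$: $\alpha\sim\beta$ iff $\alpha_m=\beta_m$ for all large $m$. $\mu_4$ is the product of the uniform measures on $\{0,1,2,3\}$. Measured equivalence relations $(\mathcal{R},X,\mu)$ and $(\mathcal{R}',X',\mu')$ are orbit equivalent if there are saturated Borel sets $Z\subset X$, $Z'\subset X'$ of full measure and a Borel isomorphism $\varphi:Z\to Z'$ with $\varphi(\mathcal{R}[x])=\mathcal{R}'[\varphi(x)]$ for $\mu$-almost every $x\in Z$ and $\varphi_*\mu\sim\mu'$ (same null sets). They are stably orbit equivalent if there are Borel sets $Z\subset X$, $Z'\subset X'$ whose saturations have full measure such that the induced relations $\mathcal{R}|_Z$ and $\mathcal{R}'|_{Z'}$ are orbit equivalent. *)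

(* Defs.v *)
From HB Require Import structures.
From mathcomp Require Import all_boot all_order all_algebra finmap.
From mathcomp Require Import all_classical all_reals all_analysis.
From mathcomp Require Import zify ring lra.
Set Implicit Arguments.
Unset Strict Implicit.
Unset Printing Implicit Defensive.
Import Order.TTheory GRing.Theory Num.Theory.
Import numFieldNormedType.Exports.
Local Open Scope classical_set_scope.
Local Open Scope ring_scope.

Notation Z2 := (int * int)%type.

Definition adj (u v : Z2) : bool :=
  v - u \in [:: (1, 0); (-1, 0); (0, 1); (0, -1)].

(* An undirected edge is the pair [set u; v] of its endpoints. *)
Record graph := Graph { vert : set Z2 ; edge : set (set Z2) }.

Definition subgraph_Z2 (G : graph) : Prop := forall e, edge G e ->
  exists u v, [/\ vert G u, vert G v, adj u v & e = [set u; v]].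

Definition gadj (G : graph) (u v : Z2) : bool := `[< edge G [set u; v] >].

Definition gwalk (G : graph) (u v : Z2) (p : seq Z2) : Prop :=
  path (gadj G) u p /\ last u p = v.

Definition gconnected (G : graph) : Prop :=
  forall u v, vert G u -> vert G v -> exists p, gwalk G u v p.

(* Vertices at path distance < N from 0. *)
Definition ballv (G : graph) (N : nat) : set Z2 :=
  [set v | exists2 p, gwalk G 0 v p & (size p < N)%N].

(* In the metric graph (edges of length 1) the open ball of radius N is made
   of the vertices at distance < N and of the (possibly half-open) edges
   issuing from them, and it is determined by these two sets. *)
Definition gball (G : graph) (N : nat) : graph :=
  Graph (ballv G N) [set e | edge G e /\ e `&` ballv G N !=set0].

Definition in_Tspace (G : graph) : Prop :=
  [/\ subgraph_Z2 G, vert G 0, gconnected G & infinite_set (vert G)].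

(* The parameter R only serves to make the metric R-valued. *)
Record Tspace (R : realType) :=
  MkTspace { tgraph :> graph ; tgraphP : in_Tspace tgraph }.
Arguments MkTspace {R} tgraph tgraphP.

HB.instance Definition _ (R : realType) := gen_eqMixin (Tspace R).
HB.instance Definition _ (R : realType) := gen_choiceMixin (Tspace R).

Section metric.
Variable R : realType.
Implicit Types T : Tspace R.

(* Adding 0 to the set changes the supremum only if the set is empty. *)
Definition agreement T T' : \bar R :=
  ereal_sup ([set 0%E] `|`
    [set N%:R%:E | N in [set N | (1 <= N)%N /\ gball T N = gball T' N]]).

Definition Tdist T T' : R := fine (expeR (- agreement T T')).

End metric.

Definition gunion (G H : graph) : graph :=
  Graph (vert G `|` vert H) (edge G `|` edge H).

Definition gbigcup (I : Type) (F : I -> graph) : graph :=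
  Graph (\bigcup_i vert (F i)) (\bigcup_i edge (F i)).

Definition gmap (f : Z2 -> Z2) (G : graph) : graph :=
  Graph (f @` vert G) [set f @` e | e in edge G].

Definition gshift (w : Z2) : graph -> graph := gmap (fun v => v + w).

Definition rot90 (v : Z2) : Z2 := (- v.2, v.1).

Definition rot_about (c : Z2) (k : nat) (v : Z2) : Z2 :=
  c + iter k rot90 (v - c).

Definition rot_union (c : Z2) (G : graph) : graph :=
  gbigcup (fun k : 'I_4 => gmap (rot_about c k) G).

(* The full subgraph of the lattice on the vertex set S. *)
Definition full_graph (S : set Z2) : graph :=
  Graph S [set e | exists u v, [/\ S u, S v, adj u v & e = [set u; v]]].

Definition axis_terminal (G : graph) (e : set Z2) (v : Z2) : Prop :=
  [/\ edge G e, e v, (forall e', edge G e' -> e' v -> e' = e)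
    & e `<=` [set w | w.2 = 0]].

Definition prune_axis (G : graph) : graph :=
  Graph [set v | vert G v /\ ~ exists e, axis_terminal G e v]
        [set e | edge G e /\ ~ exists v, axis_terminal G e v].

(* [kenyon n] is the tree T_(n+1). *)
Fixpoint kenyon (n : nat) : graph :=
  if n is m.+1 then
    prune_axis (rot_union 0 (gshift (0, 2 ^+ n) (kenyon m)))
  else gunion (full_graph [set v | `|v.1| <= 1 /\ v.2 = 0])
              (full_graph [set v | v.1 = 0 /\ `|v.2| <= 2]).

Definition kenyon_graph : graph := gbigcup kenyon.

HB.instance Definition _ := isPointed.Build 'I_4 ord0.

Definition S4 : Type := prod_topology (fun _ : nat => discrete_topology 'I_4).
HB.instance Definition _ := Pointed.on S4.
HB.instance Definition _ := Topological.on S4.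
HB.instance Definition _ :=
  Measurable.copy S4 (g_sigma_algebraType (@open S4)).

Definition dir (k : 'I_4) : Z2 := iter k rot90 (1, 0).

Fixpoint center (a : S4) (n : nat) : Z2 :=
  if n is m.+1 then center a m + dir (a m) *+ 2 ^ m else 0.

(* Adds the vertex x and every lattice edge between x and a vertex of G; in
   the construction of [patch] below there is exactly one such edge, see
   [patch_link_unique]. *)
Definition attach (x : Z2) (G : graph) : graph :=
  Graph (vert G `|` [set x])
        (edge G `|` [set [set x; v] | v in [set v | vert G v /\ adj x v]]).

Fixpoint patch (a : S4) (n : nat) : graph :=
  if n is m.+1 then
    rot_union (center a n) (attach (center a n) (patch a m))
  else Graph [set 0] set0.

Definition Phi_graph (a : S4) : graph := gbigcup (patch a).

Section reach.
Implicit Types (G H : graph) (u v w c : Z2).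

Definition reach G u v : Prop := exists p, gwalk G u v p.

Lemma reach_refl G u : reach G u u.
Proof. by exists [::]. Qed.

Lemma reach_trans G v u w : reach G u v -> reach G v w -> reach G u w.
Proof.
move=> [p [pp lp]] [q [pq lq]]; exists (p ++ q); split.
  by rewrite cat_path pp lp.
by rewrite last_cat lp.
Qed.

Lemma reach_edge G u v : edge G [set u; v] -> reach G u v.
Proof. by move=> e; exists [:: v]; split => //=; rewrite andbT; apply/asboolP. Qed.

Lemma gadj_sym G u v : gadj G u v = gadj G v u.
Proof. by rewrite /gadj setUC. Qed.

Lemma reach_sym G u v : reach G u v -> reach G v u.
Proof.
move=> [p [pp lp]]; elim: p u pp lp => [|x p IH] u /=.
  by move=> _ ->; exact: reach_refl.
move=> /andP[/asboolP ux pp] lp; apply: reach_trans (IH _ pp lp) _.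
by apply: reach_edge; rewrite setUC.
Qed.

Lemma reach_sub G H u v : edge G `<=` edge H -> reach G u v -> reach H u v.
Proof.
move=> GH [p [pp lp]]; exists p; split => //; apply: sub_path pp => x y.
by move/asboolP => xy; apply/asboolP/GH.
Qed.

Lemma reach_gmap f G u v : reach G u v -> reach (gmap f G) (f u) (f v).
Proof.
move=> [p [pp lp]]; elim: p u pp lp => [|x p IH] u /=.
  by move=> _ ->; exact: reach_refl.
move=> /andP[/asboolP ux pp] lp; apply: reach_trans (IH _ pp lp).
apply: reach_edge; exists [set u; x] => //.
by rewrite image_setU !image_set1.
Qed.

Definition star c G := forall v, vert G v -> reach G c v.

Lemma star_connected c G : star c G -> gconnected G.
Proof.
move=> cG u v uG vG; apply: (reach_trans (v := c)); last exact: cG.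
by apply: reach_sym; exact: cG.
Qed.

Lemma connected_star c G : gconnected G -> vert G c -> star c G.
Proof. by move=> cG cv v vv; exact: cG. Qed.

Lemma star_gmap f c G : star c G -> star (f c) (gmap f G).
Proof. by move=> cG _ [v vG <-]; exact/reach_gmap/cG. Qed.

Lemma star_gbigcup (I : Type) (F : I -> graph) c :
  (forall i, star c (F i)) -> star c (gbigcup F).
Proof.
move=> cF v [i _ vi]; apply: reach_sub (cF i v vi) => e ei; by exists i.
Qed.

Lemma rot_about_fix c k : rot_about c k c = c.
Proof.
rewrite /rot_about subrr; have -> : iter k rot90 0 = 0.
  by elim: k => //= k ->; rewrite /rot90 /= oppr0.
by rewrite addr0.
Qed.

Lemma star_rot_union c G : star c G -> star c (rot_union c G).
Proof.
move=> cG; apply: star_gbigcup => k.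
by rewrite -{1}(rot_about_fix c k); exact: star_gmap.
Qed.

Lemma sub_gmap f G : (forall u v, adj u v -> adj (f u) (f v)) ->
  subgraph_Z2 G -> subgraph_Z2 (gmap f G).
Proof.
move=> fa GG _ [e /GG[u [v [uG vG uv ->]]] <-].
exists (f u), (f v); split; [by exists u|by exists v|exact: fa|].
by rewrite image_setU !image_set1.
Qed.

Lemma adj_rot90 u v : adj u v -> adj (rot90 u) (rot90 v).
Proof.
rewrite /adj => uv; have -> : rot90 v - rot90 u = rot90 (v - u).
  by rewrite /rot90; case: u v {uv} => [a b] [c d] /=; congr pair => /=; ring.
by move: uv; rewrite !inE => /or4P[] /eqP ->.
Qed.

Lemma adj_add u v w : adj (u + w) (v + w) = adj u v.
Proof. by rewrite /adj opprD addrACA subrr addr0. Qed.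

Lemma adj_rot c k u v : adj u v -> adj (rot_about c k u) (rot_about c k v).
Proof.
move=> uv; rewrite /rot_about ![c + _]addrC adj_add.
by elim: k => [|k IH] /=; [rewrite adj_add|exact: adj_rot90].
Qed.

Lemma sub_gbigcup (I : Type) (F : I -> graph) :
  (forall i, subgraph_Z2 (F i)) -> subgraph_Z2 (gbigcup F).
Proof.
move=> FF e [i _ /FF[u [v [uG vG uv ->]]]]; exists u, v.
by split => //; exists i.
Qed.

Lemma sub_rot_union c G : subgraph_Z2 G -> subgraph_Z2 (rot_union c G).
Proof. by move=> GG; apply: sub_gbigcup => k; apply: sub_gmap => // *; exact: adj_rot. Qed.

Lemma sub_gshift w G : subgraph_Z2 G -> subgraph_Z2 (gshift w G).
Proof. by move=> GG; apply: sub_gmap => // u v; rewrite adj_add. Qed.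

Lemma sub_attach x G : subgraph_Z2 G -> subgraph_Z2 (attach x G).
Proof.
move=> GG e [/GG[u [v [uG vG uv ->]]]|[v [vG xv] <-]].
- by exists u, v; split => //; left.
- by exists x, v; split => //; [right|left].
Qed.

Lemma sub_full S : subgraph_Z2 (full_graph S).
Proof. by move=> e [u [v [uS vS uv ->]]]; exists u, v. Qed.

Lemma sub_gunion G H : subgraph_Z2 G -> subgraph_Z2 H -> subgraph_Z2 (gunion G H).
Proof.
move=> GG HH e [/GG|/HH] [u [v [uG vG uv ->]]]; exists u, v; split => //;
  by [left|right].
Qed.

Lemma sub_prune G : subgraph_Z2 G -> subgraph_Z2 (prune_axis G).
Proof.
move=> GG e [eG enr]; have [u [v [uG vG uv eE]]] := GG _ eG.
exists u, v; split => //; split => // -[e' t]; have [e'G e'x ue' _] := t.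
- by apply: enr; exists u; rewrite (ue' e eG) // eE; left.
- by apply: enr; exists v; rewrite (ue' e eG) // eE; right.
Qed.

Lemma set2_mem u v w : [set u; v] w -> w \in [:: u; v].
Proof. by case=> ->; rewrite !inE eqxx ?orbT. Qed.

Lemma path_prune G u (p : seq Z2) :
    path (gadj G) u p -> uniq (u :: p) ->
    ~ (exists e, axis_terminal G e (last u p)) ->
    ~ (exists e, axis_terminal G e u) \/
      (exists2 z, edge G [set z; u] & z \notin u :: p) ->
  path (gadj (prune_axis G)) u p.
Proof.
elim: p u => //= x p IH u /andP[/asboolP ux pp] /andP[unp up] lp pu.
apply/andP; split; last first.
  by apply: IH => //; right; exists u.
apply/asboolP; split => // -[w t]; have [_ tw tu _] := t.
case: tw => wE; rewrite {w}wE in t tu.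
- case: pu => [|[z zu zn]]; first by apply; exists [set u; x].
  have /esym zE := tu _ zu (or_intror erefl).
  have : [set u; x] z by rewrite zE; left.
  by move=> /set2_mem; move: zn; rewrite !inE !negb_or => /and3P[/negPf-> /negPf->].
- case: p pp up lp unp {pu IH} => [|y p] /= pp up lp unp; first by apply: lp; exists [set u; x].
  case/andP: pp => /asboolP xy _.
  have /esym zE := tu _ xy (or_introl erefl).
  have : [set u; x] y by rewrite zE; right.
  move=> /set2_mem; rewrite !inE => /orP[] /eqP yE.
  + by move: unp; rewrite yE !inE eqxx orbT.
  + by move: up; rewrite yE !inE eqxx.
Qed.

Lemma connected_prune G : gconnected G -> gconnected (prune_axis G).
Proof.
move=> GG u v [uG nu] [vG nv].
have [p [pp lp]] := GG u v uG vG.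
case/shortenP: pp lp => p' pp' up' _ lp.
exists p'; split => //; apply: path_prune => //; first by rewrite lp.
by left.
Qed.

End reach.

Lemma finite_Z2_bounded (S : set Z2) : finite_set S ->
  exists b : nat, forall v, S v -> (absz v.1 + absz v.2 <= b)%N.
Proof.
move=> /finite_seqP[s ->]; exists (\max_(v <- s) (absz v.1 + absz v.2)%N).
by move=> v vs; apply: (@leq_bigmax_seq _ s xpredT (fun v : Z2 => absz v.1 + absz v.2)%N).
Qed.

Lemma Z2Mn (x y : int) (m : nat) : (x, y) *+ m = (x *+ m, y *+ m) :> Z2.
Proof.
elim: m => [//|m IH].
by rewrite !mulrS IH.
Qed.

Section Phi_graph_in_Tspace.
Variable a : S4.

Lemma patch0 n : vert (patch a n) 0.
Proof.
elim: n => [|n IH] //=; exists ord0 => //=; exists 0; first by left.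
by rewrite /rot_about /= sub0r subrr.
Qed.

Lemma patch_sub n : subgraph_Z2 (patch a n).
Proof.
elim: n => [|n IH]; first by move=> e [].
exact/sub_rot_union/sub_attach.
Qed.

Lemma rot_aboutD c k v : rot_about c k (c + v) = c + iter k rot90 v.
Proof. by rewrite /rot_about [c + v]addrC addrK. Qed.

Lemma rot90Mn v n : rot90 (v *+ n) = rot90 v *+ n.
Proof.
elim: n => [|n IH]; first by rewrite !mulr0n /rot90 /= oppr0.
by rewrite !mulrS -IH /rot90 /= opprD.
Qed.

Lemma iter_rot90Mn k v n : iter k rot90 (v *+ n) = iter k rot90 v *+ n.
Proof. by elim: k => //= k ->; rewrite rot90Mn. Qed.

Lemma iter_rot90_dir (k l : 'I_4) : exists j : 'I_4,
  iter j rot90 (- dir l) = dir k.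
Proof.
exists (inord ((k + 6 - l) %% 4)); rewrite inordK ?ltn_pmod//.
by case: k => [[|[|[|[|]]]]] //= ?; case: l => [[|[|[|[|]]]]].
Qed.

Lemma patch_tip n (k : 'I_4) :
  vert (patch a n) (center a n + dir k *+ (2 ^ n - 1)).
Proof.
elim: n k => [|n IH] k; first by rewrite /= expn0 subnn mulr0n addr0.
have [j jE] := iter_rot90_dir k (a n).
have [i /= iE] := iter_rot90_dir (a n) ord0.
have [l /= lE] : exists l : 'I_4, dir l = - dir (a n).
  have [l lE] := iter_rot90_dir (a n) (a n).
  exists (inord ((a n + 2) %% 4)); rewrite /dir inordK ?ltn_pmod//.
  by case: (a n) => [[|[|[|[|]]]]].
exists j => //; exists (center a n + dir l *+ (2 ^ n - 1)); first by left.
have -> : center a n + dir l *+ (2 ^ n - 1) =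
    center a n.+1 + (- dir (a n)) *+ (2 ^ n.+1 - 1).
  rewrite lE /= -addrA; congr (_ + _).
  have -> : (2 ^ n.+1 - 1 = 2 ^ n + (2 ^ n - 1))%N.
    by rewrite expnS; have := expn_gt0 2 n; lia.
  by rewrite mulrnDr addrA -mulrnDl subrr mul0rn add0r.
by rewrite rot_aboutD iter_rot90Mn jE.
Qed.

Lemma adj_dir (k : 'I_4) u : adj (u + dir k) u.
Proof.
rewrite /adj opprD addrA subrr add0r.
by case: k => [[|[|[|[|]]]]].
Qed.

Lemma patch_connected n : gconnected (patch a n).
Proof.
elim: n => [|n IH]; first by move=> u v /= -> ->; exact: reach_refl.
apply: (star_connected (c := center a n.+1)).
apply: star_rot_union => v /= [vn|->]; last exact: reach_refl.
set x := center a n + _.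
pose t := center a n + dir (a n) *+ (2 ^ n - 1).
have tn : vert (patch a n) t by exact: patch_tip.
apply: (reach_trans (v := t)).
  apply: reach_edge; right; exists t => //; split => //.
  rewrite /x; have -> : (2 ^ n = 2 ^ n - 1 + 1)%N.
    by have := expn_gt0 2 n; lia.
  by rewrite mulrnDr mulr1n addrA adj_dir.
apply: reach_sub (IH _ _ tn vn) => e en; by left.
Qed.

Lemma Phi_graphP : in_Tspace (Phi_graph a).
Proof.
split.
- exact/sub_gbigcup/patch_sub.
- by exists 0%N => //; exact: patch0.
- apply: (star_connected (c := 0)); apply: star_gbigcup => n.
  by apply: connected_star; [exact: patch_connected|exact: patch0].
- move=> /finite_Z2_bounded[b bP].
  have t0 := bP _ (ex_intro2 _ _ b.+1 I (patch_tip b.+1 (inord 0))).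
  have t2 := bP _ (ex_intro2 _ _ b.+1 I (patch_tip b.+1 (inord 2))).
  move: t0 t2; rewrite /dir !inordK//=.
  have -> : (rot90 (rot90 (1, 0))) = (-1, 0) :> Z2 by [].
  have := ltn_expl b.+1 (isT : (1 < 2)%N).
  rewrite !Z2Mn /= !mul0rn; rewrite !mulNrn !natz.
  move: (2 ^ b.+1)%N (_.1 + _.1) (_.2 + _.2 + 0) => N x y.
  lia.
Qed.

End Phi_graph_in_Tspace.

Section kenyon_in_Tspace.

Lemma kenyon_sub n : subgraph_Z2 (kenyon n).
Proof.
elim: n => [|n IH] /=; first by apply: sub_gunion; exact: sub_full.
exact/sub_prune/sub_rot_union/sub_gshift.
Qed.

Definition axis_edge (y : int) : set Z2 := [set (0, y); (0, y + 1)].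

Lemma kenyon_axis n (y : int) : - 2 ^+ n.+1 <= y < 2 ^+ n.+1 ->
  edge (kenyon n) (axis_edge y).
Proof.
elim: n y => [|n IH] y.
  rewrite expr1 => /andP[y1 y2]; right; exists (0, y), (0, y + 1); split => //=.
  - by split => //; lia.
  - by split => //; lia.
  - by rewrite /adj; have -> : (0, y + 1) - (0, y) = (0, 1) :> Z2
      by congr pair => /=; lia.
move=> yb; rewrite [kenyon _]/=.
have step z : - 2 ^+ n.+2 <= z < 2 ^+ n.+2 ->
    edge (rot_union 0 (gshift (0, 2 ^+ n.+1) (kenyon n))) (axis_edge z).
  rewrite [2 ^+ n.+2]exprS => /andP[z1 z2].
  have sh w : 0 <= w < 2 * 2 ^+ n.+1 ->
      edge (gshift (0, 2 ^+ n.+1) (kenyon n)) (axis_edge w).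
    move=> /andP[w1 w2]; exists (axis_edge (w - 2 ^+ n.+1)).
      by apply: IH; apply/andP; split; lia.
    rewrite /axis_edge image_setU !image_set1.
    by congr ([set _] `|` [set _]); congr pair => /=; lia.
  have [z0|z0] := leP 0 z.
    exists (inord 0) => //; exists (axis_edge z); first by apply: sh; rewrite z0.
    rewrite /axis_edge inordK// image_setU !image_set1.
    by congr ([set _] `|` [set _]); congr pair => /=; lia.
  exists (inord 2) => //; exists (axis_edge (- z - 1)).
    by apply: sh; apply/andP; split; lia.
  rewrite /axis_edge inordK// image_setU !image_set1 setUC.
  by congr ([set _] `|` [set _]); congr pair => /=; lia.
split; first exact: step.
move=> [v [_ vy uv ax]].
have y0 : y = 0 by have := ax (0, y) (or_introl erefl).
have : (0, y + 1).2 = 0 := ax (0, y + 1) (or_intror erefl).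
by rewrite y0.
Qed.

Lemma kenyon_axis_vert n (y : int) : - 2 ^+ n.+1 <= y < 2 ^+ n.+1 ->
  vert (kenyon n) (0, y).
Proof.
move=> /kenyon_axis /[dup] ye /(@kenyon_sub n)[u [v [uG vG _ uv]]].
have : axis_edge y (0, y) by left.
by rewrite uv => -[->|->].
Qed.

Lemma kenyon_connected n : gconnected (kenyon n).
Proof.
elim: n => [|n IH].
  apply: (star_connected (c := 0)).
  have e0 y : -2 <= y < 2 -> reach (kenyon 0) (0, y) (0, y + 1).
    by move=> yb; apply: reach_edge; apply: (@kenyon_axis 0); rewrite expr1.
  have h k : k \in [:: -1; 1] -> reach (kenyon 0) 0 (k, 0).
    move=> kb; apply: reach_edge; left; exists 0, (k, 0); split => //=.
    - by move: kb; rewrite !inE => /orP[]/eqP->.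
    - by rewrite /adj subr0; move: kb; rewrite !inE => /orP[]/eqP->.
  have v1 : reach (kenyon 0) 0 (0, 1) by exact: (e0 0).
  have v2 : reach (kenyon 0) 0 (0, 2) by apply: reach_trans v1 _; exact: (e0 1).
  have w1 : reach (kenyon 0) 0 (0, -1) by apply: reach_sym; exact: (e0 (-1)).
  have w2 : reach (kenyon 0) 0 (0, -2).
    by apply: reach_trans w1 _; apply: reach_sym; exact: (e0 (-2)).
  move=> [x y] [] /= [].
  - move=> x1 ->; have : [|| x == 0, x == 1 | x == -1] by lia.
    by move=> /or3P[] /eqP ->; [exact: reach_refl|exact: h|exact: h].
  - move=> -> y1; have : [|| y == 0, y == 1, y == -1, y == 2 | y == -2] by lia.
    by move=> /orP[/eqP ->|/or4P[] /eqP ->] //; exact: reach_refl.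
apply/connected_prune/(star_connected (c := 0))/star_rot_union.
have {1}-> : 0 = (0, - 2 ^+ n.+1) + (0, 2 ^+ n.+1) :> Z2.
  by congr pair => /=; lia.
apply: star_gmap; apply: connected_star => //; apply: kenyon_axis_vert.
have : 0 < 2 ^+ n.+1 :> int by rewrite exprn_gt0.
by lia.
Qed.

Lemma kenyon_graphP : in_Tspace kenyon_graph.
Proof.
have k0 n : vert (kenyon n) 0.
  apply: kenyon_axis_vert; have : 0 < 2 ^+ n.+1 :> int by rewrite exprn_gt0.
  by lia.
split.
- exact/sub_gbigcup/kenyon_sub.
- by exists 0%N.
- apply: (star_connected (c := 0)); apply: star_gbigcup => n.
  by apply: connected_star => //; exact: kenyon_connected.
- move=> /finite_Z2_bounded[b bP].
  have b2 : b.+1%:Z < 2 ^+ b.+2.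
    have -> : 2 ^+ b.+2 = (2 ^ b.+2)%N%:Z by rewrite -natz natrX.
    by have := ltn_expl b.+2 (isT : (1 < 2)%N); lia.
  have : vert kenyon_graph (0, b.+1%:Z).
    by exists b.+1 => //; apply: kenyon_axis_vert; lia.
  by move=> /bP /=; lia.
Qed.

End kenyon_in_Tspace.

Section unique_link.
Variable a : S4.

Let l1 (v : Z2) : nat := (absz v.1 + absz v.2)%N.

Let l1_rot k v : l1 (iter k rot90 v) = l1 v.
Proof. by elim: k => //= k <-; rewrite /l1 /=; lia. Qed.

Let l1D (u v : Z2) : (l1 (u + v)%R <= l1 u + l1 v)%N.
Proof. by rewrite /l1 /=; lia. Qed.

Let l1_dir (k : 'I_4) m : l1 (dir k *+ m) = m.
Proof. by rewrite /dir -iter_rot90Mn l1_rot Z2Mn /l1 /= mul0rn; lia. Qed.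

Let patch_l1 n v : vert (patch a n) v -> (l1 (v - center a n)%R < 2 ^ n)%N.
Proof.
elim: n v => [|n IH] v; first by move=> ->.
rewrite [patch _ _]/= => -[k _ [w wn <-]].
rewrite /rot_about addrAC subrr add0r l1_rot.
case: wn => [wn|->]; last by rewrite subrr expn_gt0.
have := IH _ wn; have := l1D (w - center a n) (- (dir (a n) *+ 2 ^ n)).
have -> : l1 (- (dir (a n) *+ 2 ^ n)) = (2 ^ n)%N.
  by rewrite -[RHS](l1_dir (a n)) /l1 /=; lia.
rewrite -addrA -opprD expnS.
move=> h1 h2; apply: leq_ltn_trans h1 _; rewrite mul2n -addnn ltn_add2r; exact: h2.
Qed.

Lemma patch_link_unique n :
  exists! v, vert (patch a n) v /\ adj (center a n.+1) v.
Proof.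
exists (center a n + dir (a n) *+ (2 ^ n - 1)); split.
  split; first exact: patch_tip.
  have e : (2 ^ n = 2 ^ n - 1 + 1)%N by have := expn_gt0 2 n; lia.
  by rewrite /= {1}e mulrnDr mulr1n addrA adj_dir.
move=> v [/patch_l1]; rewrite /adj /=.
move: (2 ^ n)%N (expn_gt0 2 n) => N N0.
have dE : dir (a n) \in [:: (1, 0); (0, 1); (-1, 0); (0, -1)].
  by case: (a n) => [[|[|[|[|]]]]].
move: dE (center a n) => + [x y]; move: v => [v w].
rewrite /l1 !inE => /or4P[] /eqP -> /=; rewrite !Z2Mn ?mul0rn ?mulNrn ?natz /=;
  move=> vN /or4P[] /eqP [] h1 h2; congr pair => /=; lia.
Qed.

End unique_link.

Section metric_axioms.
Variable R : realType.
Implicit Types (T : Tspace R) (G H : graph).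

Lemma Tspace_eq T T' : tgraph T = tgraph T' -> T = T'.
Proof.
by case: T T' => [G GP] [H HP] /= GH; subst H; congr MkTspace; exact: Prop_irrelevance.
Qed.

Lemma ballv_sub G H N M : gball G N = gball H N -> (M <= N)%N ->
  ballv G M `<=` ballv H M.
Proof.
move=> GH MN v [p [pp lp] pM]; exists p => //; split => //.
elim/last_ind: p {v lp} pp pM => // p x IH.
rewrite rcons_path size_rcons => /andP[pp px] pM.
rewrite rcons_path IH//=; last exact: ltnW.
have : edge (gball G N) [set last 0 p; x].
  split; first exact/asboolP.
  exists (last 0 p); split; first by left.
  by exists p => //; apply: leq_trans MN; exact: ltnW.
by rewrite GH => -[e _]; apply/asboolP.
Qed.

Lemma gball_le G H N M : gball G N = gball H N -> (M <= N)%N ->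
  gball G M = gball H M.
Proof.
suff sub G' H' : gball G' N = gball H' N -> (M <= N)%N ->
    edge (gball G' M) `<=` edge (gball H' M).
  move=> GH MN; congr Graph; apply/seteqP; split.
  - exact: ballv_sub GH MN.
  - exact: ballv_sub (esym GH) MN.
  - exact: sub GH MN.
  - exact: sub (esym GH) MN.
move=> GH MN e [eG [v [ev [p pv pM]]]].
have : edge (gball G' N) e.
  by split => //; exists v; split => //; exists p => //; exact: leq_trans MN.
rewrite GH => -[eH _]; split => //; exists v; split => //.
by apply: (ballv_sub GH MN); exists p.
Qed.

Lemma ballv_vert T N : ballv T N `<=` vert T.
Proof.
case: T => G [sG G0 _ _] /= v [p [pp lp] _].
case/lastP: p pp lp => [|p x]; first by move=> _ <-.
rewrite rcons_path last_rcons => /andP[_ /asboolP/sG[u [w [uG wG _ e]]]] <-.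
have : [set last 0 p; x] x by right.
by rewrite e => -[->|->].
Qed.

Lemma gball_eq T T' : (forall N, gball T N = gball T' N) -> T = T'.
Proof.
suff sub (S S' : Tspace R) : (forall N, gball S N = gball S' N) ->
    vert S `<=` vert S' /\ edge S `<=` edge S'.
  move=> TT; apply: Tspace_eq.
  have [v1 e1] := sub _ _ TT.
  have [v2 e2] := sub _ _ (fun N => esym (TT N)).
  have ve : vert T = vert T' by apply/seteqP.
  have ee : edge T = edge T' by apply/seteqP.
  by case: (tgraph T) (tgraph T') ve ee => [? ?] [? ?] /= -> ->.
move=> SS; have [sS S0 cS _] := tgraphP S.
have inb v : vert S v -> exists N, ballv S N v.
  by move=> /(cS _ _ S0)[p pv]; exists (size p).+1; exists p.
split=> [v /inb[N vN]|e eS].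
  by apply: (@ballv_vert _ N); rewrite -[ballv _ _]/(vert (gball S' N)) -SS.
have [u [v [uS _ _ eE]]] := sS _ eS.
have [N uN] := inb _ uS.
have : edge (gball S N) e.
  by split => //; exists u; split => //; rewrite eE; left.
by rewrite SS => -[].
Qed.

Lemma agreement_ge0 T T' : (0 <= agreement T T')%E.
Proof. by apply: ereal_sup_ubound; left. Qed.

Lemma agreement_sym T T' : agreement T T' = agreement T' T.
Proof.
rewrite /agreement; congr (ereal_sup (_ `|` _)).
by apply/seteqP; split => _ [N [N1 NT] <-]; exists N.
Qed.

Lemma agreement_gt T T' (r : R) : 0 <= r -> (r%:E < agreement T T')%E ->
  exists N, [/\ (1 <= N)%N, r < N%:R & gball T N = gball T' N].
Proof.
move=> r0 /ereal_sup_gt[x [->|[N [N1 NT] <-]]].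
  by rewrite lte_fin ltNge r0.
by rewrite lte_fin => rN; exists N.
Qed.

Lemma agreement_min T1 T2 T3 :
  (Order.min (agreement T1 T2) (agreement T2 T3) <= agreement T1 T3)%E.
Proof.
rewrite leNgt; apply/negP; have := agreement_ge0 T1 T3.
case E : (agreement T1 T3) => [r| |] // r0; last by rewrite ltNge leey.
rewrite lt_min => /andP[/agreement_gt[//|N [N1 rN NT]] /agreement_gt[//|M [M1 rM MT]]].
have : ((minn N M)%:R%:E <= agreement T1 T3)%E.
  apply: ereal_sup_ubound; right; exists (minn N M) => //; split.
    by rewrite leq_min N1.
  by rewrite (gball_le NT (geq_minl _ _)) (gball_le MT (geq_minr _ _)).
rewrite E lee_fin ; apply/negP; rewrite -ltNge.
by rewrite /minn; case: ifP.
Qed.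

Lemma agreement_eqy T T' : agreement T T' = +oo%E -> T = T'.
Proof.
move=> E; apply: gball_eq => N.
have [//|M [_ NM MT]] := @agreement_gt T T' N%:R (ler0n _ _).
  by rewrite E ltry.
by apply: gball_le MT _; rewrite ltr_nat in NM; exact: ltnW.
Qed.

Lemma agreement_refl T : agreement T T = +oo%E.
Proof.
apply/eqyP => r r0; apply: (@le_trans _ _ (Num.truncn r).+1%:R%:E).
  by rewrite lee_fin ltW// truncnS_gt.
by apply: ereal_sup_ubound; right; exists (Num.truncn r).+1.
Qed.

Lemma Tdistxx T : Tdist T T = 0.
Proof. by rewrite /Tdist agreement_refl. Qed.

Lemma Tdist_positivity T T' : Tdist T T' = 0 -> T = T'.
Proof.
move=> d0; apply: agreement_eqy; move: d0; rewrite /Tdist.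
have := agreement_ge0 T T'; case: (agreement T T') => [r| |] //= _ /eqP.
by rewrite expR_eq0.
Qed.

Lemma Tdist_sym T T' : Tdist T T' = Tdist T' T.
Proof. by rewrite /Tdist agreement_sym. Qed.

Lemma Tdist_triangle T2 T1 T3 : Tdist T1 T3 <= Tdist T1 T2 + Tdist T2 T3.
Proof.
have := agreement_min T1 T2 T3; rewrite /Tdist.
have := agreement_ge0 T1 T2; have := agreement_ge0 T2 T3.
have := agreement_ge0 T1 T3.
have e0 := @expR_ge0 R.
case: (agreement T1 T3) => [r13| |] //= _; last first.
  by move=> _ _ _; apply: addr_ge0; apply: fine_ge0; exact: expeR_ge0.
case: (agreement T2 T3) => [r23| |] //= _; case: (agreement T1 T2) => [r12| |] //= _;
  rewrite ?addr0 ?add0r ge_min ?leye_eq ?orbF ?lee_fin //=.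
- case/orP => h.
  + by apply: (@le_trans _ _ (expR (- r12))); rewrite ?lerDl// ler_expR lerN2.
  + by apply: (@le_trans _ _ (expR (- r23))); rewrite ?lerDr// ler_expR lerN2.
- by move=> h; rewrite ler_expR lerN2.
- by move=> h; rewrite ler_expR lerN2.
Qed.

End metric_axioms.

HB.instance Definition _ (R : realType) :=
  isPointed.Build (Tspace R) (MkTspace kenyon_graph kenyon_graphP).
HB.instance Definition _ (R : realType) :=
  isMetric.Build R (Tspace R) (@Tdistxx R) (@Tdist_positivity R)
    (@Tdist_sym R) (@Tdist_triangle R).
HB.instance Definition _ (R : realType) :=
  Measurable.copy (Tspace R) (g_sigma_algebraType (@open (Tspace R))).

Section ghys_kenyon.
Variable R : realType.
Implicit Types T : Tspace R.

Definition T_infty : Tspace R := MkTspace kenyon_graph kenyon_graphP.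

Definition Phi (a : S4) : Tspace R := MkTspace (Phi_graph a) (Phi_graphP a).

Definition Trel T T' : Prop :=
  exists2 v, vert T v & tgraph T' = gshift (- v) T.

Definition Xset : set (Tspace R) := closure [set T | Trel T_infty T].

Definition Yset : set (Tspace R) := Xset `\` [set T | Trel T_infty T].

(* At most four edges issue from 0, so this set is finite. *)
Definition valence T : nat := #|` fset_set [set e | edge T e /\ e 0]|.

Definition Y2set : set (Tspace R) := [set T | Yset T /\ (valence T <= 2)%N].

Definition ball_orbit (n : nat) : set (Tspace R) :=
  [set T | exists2 p, ballv T_infty n p & tgraph T = gshift (- p) T_infty].

(* Uniform probability measure on a finite nonempty set. *)
Definition uniform_on (S : set (Tspace R)) : set (Tspace R) -> \bar R :=
  let s : seq (Tspace R) := fset_set S in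
  mscale ((size s)%:R^-1)%:nng (msum (fun i => \d_(nth point s i)) (size s)).

HB.instance Definition _ (S : set (Tspace R)) := Measure.on (uniform_on S).

Definition mu_ball (n : nat) : {measure set (Tspace R) -> \bar R} :=
  uniform_on (ball_orbit n).

(* X is compact, so the test functions are all continuous functions on X. *)
Definition weak_limit (nu : nat -> {measure set (Tspace R) -> \bar R})
    (mu : {measure set (Tspace R) -> \bar R}) : Prop :=
  forall f : Tspace R -> R, {within Xset, continuous f} ->
    (\int[nu k]_(x in Xset) f x) @[k --> \oo] --> \int[mu]_(x in Xset) f x.

End ghys_kenyon.
Arguments T_infty R : clear implicits.
Arguments Phi R a : clear implicits.
Arguments Trel R T T' : clear implicits.
Arguments Xset R : clear implicits.
Arguments Yset R : clear implicits.
Arguments Y2set R : clear implicits.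
Arguments mu_ball R n : clear implicits.

Definition cofinal (a b : S4) : Prop :=
  exists N, forall m, (N <= m)%N -> a m = b m.

Definition uniform_product (R : realType) (mu4 : probability S4 R) : Prop :=
  forall (n : nat) (A : nat -> {set 'I_4}),
    mu4 [set a : S4 | forall i, (i < n)%N -> a i \in A i] =
    (\prod_(i < n) (#|A i|%:R / 4))%:E.

(* A measured equivalence relation on a subset A of the ambient measurable
   space T is given by E : T -> T -> Prop, of which only the restriction to A
   matters, and by a measure of which only the restriction to A matters. *)
Section orbit_equivalence.
Context {d d' : measure_display} {T : measurableType d}
  {T' : measurableType d'} {R : realType}.

Definition eqclass {U : Type} (A : set U) (E : U -> U -> Prop) (x : U) :
  set U := [set y | A y /\ E x y].

Definition saturation {U : Type} (A : set U) (E : U -> U -> Prop) (Z : set U) :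
  set U := [set y | A y /\ exists2 x, Z x & E x y].

Definition saturated {U : Type} (A : set U) (E : U -> U -> Prop) (Z : set U) :
  Prop := Z `<=` A /\ saturation A E Z `<=` Z.

Definition full_measure {d0} {U : measurableType d0}
    (mu : {measure set U -> \bar R}) (A Z : set U) : Prop :=
  mu.-negligible (A `\` Z).

Definition borel_iso (Z : set T) (Z' : set T') (phi : T -> T') : Prop :=
  [/\ set_bij Z Z' phi, measurable_fun Z phi &
      forall C, measurable C -> C `<=` Z -> measurable (phi @` C)].

Definition orbit_equivalence
    (A : set T) (E : T -> T -> Prop) (mu : {measure set T -> \bar R})
    (A' : set T') (E' : T' -> T' -> Prop) (mu' : {measure set T' -> \bar R})
    (phi : T -> T') : Prop :=
  exists (Z : set T) (Z' : set T'),
    [/\ [/\ measurable Z, saturated A E Z & full_measure mu A Z],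
        [/\ measurable Z', saturated A' E' Z' & full_measure mu' A' Z'],
        borel_iso Z Z' phi,
        {ae mu, forall x, Z x ->
          phi @` eqclass A E x = eqclass A' E' (phi x)} &
        forall C, measurable C -> C `<=` Z' ->
          (mu (Z `&` phi @^-1` C) = 0%E <-> mu' C = 0%E)].

Definition stable_orbit_equivalence
    (A : set T) (E : T -> T -> Prop) (mu : {measure set T -> \bar R})
    (A' : set T') (E' : T' -> T' -> Prop) (mu' : {measure set T' -> \bar R})
    (B : set T) (B' : set T') (phi : T -> T') : Prop :=
  [/\ [/\ measurable B, B `<=` A & full_measure mu A (saturation A E B)],
      [/\ measurable B', B' `<=` A' & full_measure mu' A' (saturation A' E' B')]
    & orbit_equivalence B E mu B' E' mu' phi].

End orbit_equivalence.

(* Main.v *)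
(* T_infty is the full subgraph of the lattice on 0 and the points whose
   coordinates have different 2-adic valuations, and the vertices within l1
   distance < 2^n of a vertex divisible by 2^n form a translate of the patch of
   order n. Whether a vertex is divisible by 2^n can therefore be read off a
   ball, so that the digits of a can be recovered from the balls of Phi a: for a
   tree of X whose root is a point of odd coordinate sum there is exactly one
   sequence of centers of exact divisibility 1, 2, 4, ... This defines a
   continuous left inverse of Phi on Y2; it is also a right inverse, and Phi is
   continuous, at the sequences that are not eventually constant.

   For 2^n <= N < 2^(n+1) the ball of radius N of T_infty contains the vertices
   of l1 norm < 2^n and only vertices of l1 norm < 2^(n+1). Hence the frequency
   in this ball of a given word of length m lies between two constant multiples
   of 4^-m, and so do the mu-measures of the corresponding clopen sets. These
   bounds make points and the orbit of T_infty null, and show that mu and the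
   image of mu4 have the same null sets (the exact equality of frequencies,
   which would need a Folner argument, is not required). *)

Require Import Defs.
From HB Require Import structures.
From mathcomp Require Import all_boot all_order all_algebra finmap.
From mathcomp Require Import all_classical all_reals all_analysis.
From mathcomp Require Import zify lra.
Set Implicit Arguments.
Unset Strict Implicit.
Unset Printing Implicit Defensive.
Import Order.TTheory GRing.Theory Num.Theory.
Import numFieldNormedType.Exports.
Local Open Scope classical_set_scope.
Local Open Scope ring_scope.

Local Notation patch := Defs.patch.
Local Notation center := Defs.center.

(** * Arithmetic of the vertices *)

(** A tree of X carries no coordinates of its own. Every claim about it is therefore checked on a
    translate [kenyon_at p] sharing a large ball with it, where it becomes a congruence on [p + v];
    the point [p] changes with the radius and has no limit in the lattice. The obstacle is that a
    code controls only the union of its patches. When the digits are eventually constant, an edge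
    may leave this union at the end of a spoke, as happens in translates of T_infty. Each change of
    digit closes the patches off. The eventually constant sequences are countable and their fibres
    are null, so they are discarded on both sides. The measures are compared on [S4] rather than on
    trees: [mu] restricted to Y2 is pushed forward by the decoding map, and the frequency bounds
    become two linear inequalities on cylinders. They extend by additivity to sets depending on
    finitely many digits. Approximating a Borel set by such a set, for the sum of both measures at
    once, then carries null sets to null sets. *)

Definition norm1 (v : Z2) : nat := (absz v.1 + absz v.2)%N.

Definition oddsum (v : Z2) : bool := ((v.1 + v.2) %% 2)%Z == 1.

(* These are the vertices of T_infty: 0 and the points whose coordinates have
   different 2-adic valuations. *)
Inductive kvert : Z2 -> Prop :=
| kvert0 : kvert 0
| kvert_oddsum v : oddsum v -> kvert v
| kvert_double v : kvert v -> kvert (v *+ 2).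

Section arithmetic.
Implicit Types (u v w c : Z2) (k l : 'I_4) (n : nat).

Lemma Z2mulrn v n : v *+ n = (v.1 * n%:Z, v.2 * n%:Z).
Proof. by case: v => x y; rewrite Z2Mn /=; congr pair; rewrite -mulr_natr natz. Qed.

Lemma dir_cases k :
  [\/ dir k = (1, 0), dir k = (0, 1), dir k = (-1, 0) | dir k = (0, -1)].
Proof.
by case: k => [[|[|[|[|]]]]] // i; [constructor 1|constructor 2|constructor 3|constructor 4].
Qed.

Lemma dir_exists v : norm1 v = 1%N -> exists k, v = dir k.
Proof.
case: v => x y; rewrite /norm1 /= => xy.
have : [|| (x == 1) && (y == 0), (x == 0) && (y == 1), (x == -1) && (y == 0)
  | (x == 0) && (y == -1)] by lia.
by move=> /or4P[] /andP[/eqP -> /eqP ->];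
  [exists (inord 0)|exists (inord 1)|exists (inord 2)|exists (inord 3)]; rewrite /dir inordK.
Qed.

Lemma dir_inj : injective dir.
Proof.
by move=> [[|[|[|[|]]]] // i] [[|[|[|[|]]]] // j] => // _; apply/val_inj.
Qed.

Lemma norm1_eq0 v : norm1 v = 0%N -> v = 0.
Proof. by case: v => x y; rewrite /norm1 /= => h; congr pair; lia. Qed.

Lemma norm1D u v : (norm1 (u + v)%R <= norm1 u + norm1 v)%N.
Proof. by rewrite /norm1 /=; lia. Qed.

Lemma norm1_dir k n : norm1 (dir k *+ n) = n.
Proof. by rewrite Z2mulrn /norm1; case: (dir_cases k) => -> /=; lia. Qed.

Lemma adjE u v : adj u v = (norm1 (v - u) == 1%N).
Proof.
case: u v => [a b] [c d]; rewrite /adj /norm1 !inE.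
rewrite -[(c, d) - (a, b)]/(c - a, d - b) !xpair_eqE /=; lia.
Qed.

Lemma kvert_inv v : kvert v ->
  [\/ v = 0, oddsum v | exists2 w, v = w *+ 2 & kvert w].
Proof.
case=> [|w wo|w ww]; [by constructor 1|by constructor 2|by constructor 3; exists w].
Qed.

Lemma mulr2_inj u v : u *+ 2 = v *+ 2 -> u = v.
Proof.
case: u v => [a b] [c d]; rewrite !Z2mulrn /= => -[ac bd]; congr pair; lia.
Qed.

Lemma kvert_doubleE v : kvert (v *+ 2) <-> kvert v.
Proof.
split=> [/kvert_inv[v0|vo|[w /mulr2_inj -> //]]|]; last exact: kvert_double.
- have -> : v = 0 by apply: mulr2_inj; rewrite mul0rn.
  exact: kvert0.
- by move: vo; rewrite Z2mulrn /oddsum /=; lia.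
Qed.

Lemma kvert_pow v n : kvert (v *+ 2 ^ n) <-> kvert v.
Proof.
elim: n v => [|n IH] v; first by rewrite expn0 mulr1n.
by rewrite expnS mulrnA IH kvert_doubleE.
Qed.

Lemma kvert_odd_odd v : (v.1 %% 2)%Z = 1 -> (v.2 %% 2)%Z = 1 -> ~ kvert v.
Proof.
move=> v1 v2 /kvert_inv[v0|vo|[w vE _]].
- by rewrite v0 in v1.
- by move: vo; rewrite /oddsum; lia.
- by move: v1; rewrite vE Z2mulrn /=; lia.
Qed.

Lemma kvert_even v : kvert v -> ~~ oddsum v -> exists2 w, v = w *+ 2 & kvert w.
Proof.
move=> /kvert_inv[->|-> //|//] _; exists 0; [by rewrite mul0rn|exact: kvert0].
Qed.

(** Coordinates of equal absolute value have the same 2-adic valuation. The empty diagonals are what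
    separates the four branches at 0. *)
Lemma kvert_diag v : kvert v -> v <> 0 -> absz v.1 <> absz v.2.
Proof.
elim=> [//|[x y] /=|{}v _ IH v0]; rewrite ?/oddsum /=.
  by move=> xy _; lia.
have /IH : v <> 0 by move=> v0'; apply: v0; rewrite v0' mul0rn.
by rewrite Z2mulrn /=; lia.
Qed.

Lemma kvert_rot90 v : kvert v -> kvert (rot90 v).
Proof.
elim=> [|w wo|w _ IH].
- by rewrite /rot90 /= oppr0; exact: kvert0.
- by apply: kvert_oddsum; move: wo; rewrite /oddsum /=; lia.
- by rewrite rot90Mn; exact: kvert_double.
Qed.

Lemma kvert_rot n v : kvert v -> kvert (iter n rot90 v).
Proof. by move=> vv; elim: n => //= j; exact: kvert_rot90. Qed.

Lemma kvert_opp v : kvert v -> kvert (- v).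
Proof. by case: v => x y /kvert_rot90/kvert_rot90. Qed.

Lemma kvert_dir k : kvert (dir k).
Proof. by apply: kvert_oddsum; rewrite /oddsum; case: (dir_cases k) => ->. Qed.

(** Self-similarity. If [u] has odd sum, both points are vertices; otherwise both are halved. After
    [n] halvings the norm bound forces [u = 0], where the claim is that [c] is a vertex. *)
Lemma kvert_near n c u : kvert c -> (norm1 u < 2 ^ n)%N ->
  kvert (c *+ 2 ^ n + u) <-> kvert u.
Proof.
move=> cV; elim: n u => [|n IH] u un.
  have -> : u = 0 by apply: norm1_eq0; move: un; rewrite expn0; lia.
  by rewrite addr0 mulr1n; split=> // _; exact: kvert0.
rewrite expnSr mulrnA; set d := c *+ 2 ^ n in IH *.
have dE : oddsum (d *+ 2 + u) = oddsum u by rewrite Z2mulrn /oddsum /=; lia.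
have [uo|ue] := boolP (oddsum u).
  by split=> _; apply: kvert_oddsum; rewrite ?dE.
have half w : u = w *+ 2 -> kvert (d *+ 2 + u) <-> kvert u.
  move=> uE; rewrite uE -mulrnDl !kvert_doubleE; apply: IH.
  by move: un; rewrite uE Z2mulrn expnS /norm1 /=; lia.
split=> uV.
  have [w wE wV] := kvert_even uV (eq_ind_r (fun b => ~~ b) ue dE).
  apply/(half (w - d)) => //; rewrite mulrnBl -wE addrAC subrr add0r //.
by have [w wE wV] := kvert_even uV ue; apply/(half w).
Qed.

(** The even radius makes the coordinate sum even, so the point halves until the radius is 1. A ball
    about a multiple of 2^n can thus be left at no more than four points. *)
Lemma kvert_sphere n c u : kvert (c *+ 2 ^ n + u) -> norm1 u = (2 ^ n)%N ->
  exists k, u = dir k *+ 2 ^ n.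
Proof.
elim: n u => [|n IH] u; first by rewrite expn0 mulr1n => _ /dir_exists[k ->]; exists k.
rewrite expnSr mulrnA; set d := c *+ 2 ^ n in IH * => uV un.
have eu : ~~ oddsum (d *+ 2 + u) by move: un; rewrite Z2mulrn /oddsum /norm1 /=; lia.
have [w wE wV] := kvert_even uV eu.
have uE : u = (w - d) *+ 2 by rewrite mulrnBl -wE addrAC subrr add0r.
have [||k kE] := IH (w - d); first by rewrite addrC subrK.
  by move: un; rewrite uE Z2mulrn /norm1 /=; lia.
by exists k; rewrite uE kE mulrnA.
Qed.

(** Norms of adjacent points differ by at most one, so an edge leaving the ball ends on the sphere;
    it prolongs a spoke. *)
Lemma kvert_tip n c u u' : kvert (c *+ 2 ^ n + u') -> adj u u' ->
    (norm1 u < 2 ^ n)%N -> (2 ^ n <= norm1 u')%N ->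
  exists k, u = dir k *+ (2 ^ n - 1) /\ u' = dir k *+ 2 ^ n.
Proof.
rewrite adjE => uV /eqP uu un nu'.
have u'n : norm1 u' = (2 ^ n)%N by move: uu un nu'; rewrite /norm1 /=; lia.
have [k kE] := kvert_sphere uV u'n; exists k; split => //.
have := expn_gt0 2 n; move: u uu un {u'n uV nu'}; rewrite {u'}kE.
case=> x y; rewrite !Z2mulrn /norm1 /=.
case: (dir_cases k) => -> /=; move: (2 ^ n)%N => N; rewrite ?mul0r;
  move=> uu un N0; congr pair; lia.
Qed.

(** Moving the odd coordinate by 1 or -1 makes both coordinates even, and exactly one of the two
    signs gives a sum congruent to 2 modulo 4. This is the rule producing the next digit of a
    code. *)
Lemma next_dir w : oddsum w ->
  exists k w', w + dir k = w' *+ 2 /\ oddsum w'.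
Proof.
move=> wo; suff [d [w' [d1 e o]]] : exists d w', [/\ norm1 d = 1%N, w + d = w' *+ 2 & oddsum w'].
  by have [k dk] := dir_exists d1; exists k, w'; rewrite -dk.
case: w wo => x y; rewrite /oddsum /= => xy.
have : [\/ [/\ (x %% 2)%Z = 1, (y %% 2)%Z = 0 & ((x + 1 + y) %% 4)%Z = 2],
   [/\ (x %% 2)%Z = 1, (y %% 2)%Z = 0 & ((x - 1 + y) %% 4)%Z = 2],
   [/\ (x %% 2)%Z = 0, (y %% 2)%Z = 1 & ((x + 1 + y) %% 4)%Z = 2]
 | [/\ (x %% 2)%Z = 0, (y %% 2)%Z = 1 & ((x - 1 + y) %% 4)%Z = 2]].
  have : [|| [&& (x %% 2)%Z == 1, (y %% 2)%Z == 0 & ((x + 1 + y) %% 4)%Z == 2],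
   [&& (x %% 2)%Z == 1, (y %% 2)%Z == 0 & ((x - 1 + y) %% 4)%Z == 2],
   [&& (x %% 2)%Z == 0, (y %% 2)%Z == 1 & ((x + 1 + y) %% 4)%Z == 2]
 | [&& (x %% 2)%Z == 0, (y %% 2)%Z == 1 & ((x - 1 + y) %% 4)%Z == 2]] by lia.
  by move=> /or4P[] /and3P[/eqP ? /eqP ? /eqP ?];
    [constructor 1|constructor 2|constructor 3|constructor 4].
case=> -[x2 y2 xy4].
- exists (1, 0), ((x + 1) %/ 2, y %/ 2)%Z; split; rewrite // ?Z2mulrn; first by congr pair => /=; lia.
  by rewrite /=; lia.
- exists (-1, 0), ((x - 1) %/ 2, y %/ 2)%Z; split; rewrite // ?Z2mulrn; first by congr pair => /=; lia.
  by rewrite /=; lia.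
- exists (0, 1), (x %/ 2, (y + 1) %/ 2)%Z; split; rewrite // ?Z2mulrn; first by congr pair => /=; lia.
  by rewrite /=; lia.
- exists (0, -1), (x %/ 2, (y - 1) %/ 2)%Z; split; rewrite // ?Z2mulrn; first by congr pair => /=; lia.
  by rewrite /=; lia.
Qed.

Lemma next_dir_unique w k k' w1 w2 : w + dir k = w1 *+ 2 -> w + dir k' = w2 *+ 2 ->
  oddsum w1 -> oddsum w2 -> k = k'.
Proof.
move=> e1 e2 o1 o2; apply: dir_inj; move: w w1 w2 e1 e2 o1 o2.
move=> [x y] [a b] [c d]; rewrite !Z2mulrn /oddsum /=.
case: (dir_cases k) => ->; case: (dir_cases k') => -> [? ?] [? ?] //=; lia.
Qed.

(** The coordinate of larger absolute value, with its sign, selects the branch; off the diagonals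
    there is no tie. *)
Lemma branch_exists n v : kvert v -> v <> 0 -> (norm1 v < 2 ^ n.+1)%N ->
  exists k, (norm1 (v - dir k *+ 2 ^ n)%R < 2 ^ n)%N.
Proof.
move=> vV v0 vn; have vd := kvert_diag vV v0.
suff [d d1 dn] : exists2 d, norm1 d = 1%N & (norm1 (v - d *+ 2 ^ n)%R < 2 ^ n)%N.
  by have [k kd] := dir_exists d1; exists k; rewrite -kd.
move: vn vd {vV v0}; rewrite expnS; move: (2 ^ n)%N => N; case: v => x y.
rewrite /norm1 /= => xyN xy.
have [|xy'|//] := ltgtP `|x|%N `|y|%N.
- by have [y0|y0] := leP 0 y => xy'; [exists (0, 1)|exists (0, -1)]; rewrite // Z2mulrn /=; lia.
- by have [x0|x0] := leP 0 x; [exists (1, 0)|exists (-1, 0)]; rewrite // Z2mulrn /=; lia.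
Qed.

(** Passing to another branch would require a vertex on a diagonal, and 0 is the only one. *)
Lemma branch_adj n u v k : kvert v -> v <> 0 ->
    (norm1 v < 2 ^ n.+1)%N -> adj u v ->
  kvert u -> (norm1 (u - dir k *+ 2 ^ n)%R < 2 ^ n)%N -> (norm1 (v - dir k *+ 2 ^ n)%R < 2 ^ n)%N.
Proof.
move=> vV v0 vn; rewrite adjE => /eqP uv uV un.
have u0 : u <> 0 by move=> u0; move: un; rewrite u0 sub0r Z2mulrn /norm1; case: (dir_cases k) => -> /=; lia.
have vd := kvert_diag vV v0; have ud := kvert_diag uV u0.
move: vn vd ud uv un {vV uV v0 u0}; rewrite expnS; move: (2 ^ n)%N => N.
case: u v => [x y] [z t]; rewrite Z2mulrn /norm1 /=.
case: (dir_cases k) => -> /=; lia.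
Qed.

End arithmetic.

(** * Blocks *)

(** A model copy placed at [c], defined without reference to any tree containing it; [blockin] below
    says when a graph contains it. *)
Definition block (c : Z2) (n : nat) : graph :=
  full_graph [set v | kvert (v - c) /\ (norm1 (v - c)%R < 2 ^ n)%N].

Section pairs.
Implicit Types (u v w c : Z2) (k : 'I_4) (n : nat) (S : set Z2).

Lemma set2_inj u v u' v' : [set u; v] = [set u'; v'] ->
  (u = u' /\ v = v') \/ (u = v' /\ v = u').
Proof.
move=> e.
have := set2_mem (eq_ind _ (fun S => S u) (or_introl erefl) _ e).
have := set2_mem (eq_ind _ (fun S => S v) (or_intror erefl) _ e).
have := set2_mem (eq_ind_r (fun S => S u') (or_introl erefl) e).
have := set2_mem (eq_ind_r (fun S => S v') (or_intror erefl) e).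
rewrite !inE; do 4! move=> /orP[] /eqP ?; subst; by [left|right].
Qed.

Lemma adj_sym u v : adj u v = adj v u.
Proof. by rewrite !adjE; congr (_ == _); rewrite /norm1 /=; lia. Qed.

Lemma full_edgeE S u v : edge (full_graph S) [set u; v] <-> [/\ S u, S v & adj u v].
Proof.
split=> [[u' [v' [u'S v'S uv /set2_inj[[-> ->]|[-> ->]]]]]|[uS vS uv]] //.
  by split; rewrite // adj_sym.
by exists u, v.
Qed.

Lemma full_graphS S S' : S `<=` S' -> edge (full_graph S) `<=` edge (full_graph S').
Proof. by move=> SS' _ [u [v [uS vS uv ->]]]; exists u, v; split => //; exact: SS'. Qed.

Lemma gwalk_map (f : Z2 -> Z2) G H u v p :
  (forall e, edge G e -> edge H (f @` e)) -> gwalk G u v p -> gwalk H (f u) (f v) (map f p).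
Proof.
move=> fGH [pp lp]; split; last by rewrite last_map lp.
rewrite path_map; apply: sub_path pp => x y /asboolP/fGH.
by rewrite image_setU !image_set1 => ?; exact/asboolP.
Qed.

Lemma gwalk_cat G u v w p q : gwalk G u v p -> gwalk G v w q -> gwalk G u w (p ++ q).
Proof. by move=> [pp lp] [pq lq]; split; rewrite ?cat_path ?last_cat lp ?pp. Qed.

Lemma gwalk_sub G H u v p : edge G `<=` edge H -> gwalk G u v p -> gwalk H u v p.
Proof.
move=> GH [pp lp]; split=> //; apply: sub_path pp => x y /asboolP xy.
by apply/asboolP; exact: GH.
Qed.

Lemma rot90D u v : rot90 (u + v) = rot90 u + rot90 v.
Proof. by rewrite /rot90 /= opprD. Qed.

Lemma iter_rot90D j u v : iter j rot90 (u + v) = iter j rot90 u + iter j rot90 v.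
Proof. by elim: j => //= j ->; exact: rot90D. Qed.

Lemma iter_rot90_mul4 j v : iter (j * 4) rot90 v = v.
Proof.
elim: j => [//|j IH]; rewrite mulSn iterD IH.
by case: v {IH} => x y; rewrite /rot90 /= !opprK.
Qed.

Lemma iter_rot90K j v : iter j rot90 (iter (j * 3) rot90 v) = v.
Proof. by rewrite -iterD -mulnS iter_rot90_mul4. Qed.

Lemma iter_rot90VK j v : iter (j * 3) rot90 (iter j rot90 v) = v.
Proof. by rewrite -iterD -mulnSr iter_rot90_mul4. Qed.

Lemma norm1_rot90 j v : norm1 (iter j rot90 v) = norm1 v.
Proof. by elim: j => //= j <-; rewrite /norm1 /=; lia. Qed.

Lemma rot_aboutE c j v : rot_about c j v - c = iter j rot90 (v - c).
Proof. by rewrite /rot_about addrAC subrr add0r. Qed.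

Lemma norm1N v : norm1 (- v) = norm1 v.
Proof. by rewrite /norm1 /=; lia. Qed.

Lemma kvert_branch n k w : kvert (w + dir k *+ 2 ^ n) -> (norm1 (w + dir k *+ 2 ^ n)%R < 2 ^ n)%N ->
  kvert w /\ (norm1 w < 2 ^ n.+1)%N.
Proof.
move=> wV wn; have wE : w = (- dir k) *+ 2 ^ n + (w + dir k *+ 2 ^ n).
  by rewrite mulNrn addrC addrK.
split; first by rewrite wE; apply/kvert_near => //; exact/kvert_opp/kvert_dir.
rewrite wE; apply: leq_ltn_trans (norm1D _ _) _.
by rewrite mulNrn norm1N norm1_dir expnS mul2n -addnn ltn_add2l.
Qed.

Lemma kvert_branchV n k w : kvert w -> (norm1 (w - dir k *+ 2 ^ n)%R < 2 ^ n)%N ->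
  kvert (w - dir k *+ 2 ^ n).
Proof.
move=> wV wn; apply/(kvert_near (kvert_dir k) wn).
by rewrite addrC subrK.
Qed.

(** Blocks obey the recursion of [patch]. The branches at [c] are rotations of a single one, and
    since the diagonals are empty each edge of the large block lies in one branch or issues from
    [c]. *)
Lemma block_rot_union c k n :
  rot_union c (attach c (block (c - dir k *+ 2 ^ n) n)) = block c n.+1.
Proof.
have vE (v : Z2) : v - (c - dir k *+ 2 ^ n) = v - c + dir k *+ 2 ^ n.
  by rewrite opprB addrCA addrC.
have sub_vert : vert (rot_union c (attach c (block (c - dir k *+ 2 ^ n) n))) `<=` vert (block c n.+1).
  move=> _ [j _ [v vj <-]] /=; rewrite rot_aboutE norm1_rot90.
  case: vj => [|->]; last by rewrite subrr /norm1 expn_gt0; split => //; exact/kvert_rot/kvert0.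
  by rewrite /= vE => -[vV vn]; have [? ?] := kvert_branch vV vn; split => //; exact: kvert_rot.
(* Rotation by [j] takes the given branch to branch [k']; its inverse is written as [j * 3] quarter
   turns. *)
have back v k' : kvert (v - c) -> (norm1 (v - c - dir k' *+ 2 ^ n)%R < 2 ^ n)%N ->
    forall j : 'I_4, iter j rot90 (- dir k) = dir k' ->
    vert (block (c - dir k *+ 2 ^ n) n) (rot_about c (j * 3) v).
  move=> vV vn j jE /=; rewrite vE rot_aboutE.
  have -> : iter (j * 3) rot90 (v - c) + dir k *+ 2 ^ n =
      iter (j * 3) rot90 (v - c - dir k' *+ 2 ^ n).
    rewrite [RHS]iter_rot90D -(mulNrn (dir k')) iter_rot90Mn -jE; congr (_ + _ *+ _).
    have -> : - iter j rot90 (- dir k) = iter j rot90 (dir k).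
      have N u : - rot90 u = rot90 (- u) by [].
      by elim: (j : nat) => [|i /= <-]; rewrite ?opprK.
    by rewrite iter_rot90VK.
  by rewrite norm1_rot90; split => //; exact/kvert_rot/kvert_branchV.
have rotK (j : 'I_4) v : rot_about c j (rot_about c (j * 3) v) = v.
  by rewrite {1}/rot_about rot_aboutE iter_rot90K addrC subrK.
congr Graph; apply/seteqP; split => //.
- move=> v [vV vn]; have [->|/eqP vc] := eqVneq v c.
    by exists ord0 => //; exists c; [right|rewrite rot_about_fix].
  have [|k' k'n] := branch_exists vV _ vn; first by move/subr0_eq.
  have [j jE] := iter_rot90_dir k' k.
  by exists j => //; exists (rot_about c (j * 3) v) => //; left; exact: back k'n j jE.
- move=> e eP; have : subgraph_Z2 (rot_union c (attach c (block (c - dir k *+ 2 ^ n) n))).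
    exact/sub_rot_union/sub_attach/sub_full.
  move=> /(_ e eP)[u [v [uG vG uv ->]]]; exists u, v; split => //; exact: sub_vert.
- have toc v : kvert (v - c) -> (norm1 (v - c)%R < 2 ^ n.+1)%N -> adj c v ->
      edge (rot_union c (attach c (block (c - dir k *+ 2 ^ n) n))) [set c; v].
    move=> vV vn cv; have vc : v - c <> 0.
      by move=> vc; move: cv; rewrite adjE vc.
    have [k' k'n] := branch_exists vV vc vn.
    have [j jE] := iter_rot90_dir k' k.
    exists j => //; exists [set c; rot_about c (j * 3) v]; last first.
      by rewrite image_setU !image_set1 rotK rot_about_fix.
    right; exists (rot_about c (j * 3) v) => //; split; first exact: back k'n j jE.
    by rewrite -[X in adj X](rot_about_fix c (j * 3)); exact: adj_rot.
  move=> _ [u [v [[uV un] [vV vn] uv ->]]].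
  have [uc|/eqP uc] := eqVneq u c; first by rewrite uc; apply: toc; rewrite // -uc.
  have [vc|/eqP vc] := eqVneq v c.
    by rewrite vc setUC; apply: toc; rewrite // -vc adj_sym.
  have [|k' k'n] := branch_exists uV _ un; first by move/subr0_eq.
  have k'n' : (norm1 (v - c - dir k' *+ 2 ^ n)%R < 2 ^ n)%N.
    by apply: (branch_adj vV _ vn _ uV k'n); rewrite ?adj_add // => /subr0_eq.
  have [j jE] := iter_rot90_dir k' k.
  exists j => //; exists [set rot_about c (j * 3) u; rot_about c (j * 3) v]; last first.
    by rewrite image_setU !image_set1 !rotK.
  left; apply/full_edgeE; split; [exact: back k'n j jE|exact: back k'n' j jE|exact: adj_rot].
Qed.

Lemma block0 c : block c 0 = Graph [set c] set0.
Proof.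
have vE v : vert (block c 0) v -> v = c.
  by move=> /= [_]; rewrite expn0 ltnS leqn0 => /eqP/norm1_eq0/subr0_eq.
congr Graph; apply/seteqP; split => //.
- by move=> v -> /=; rewrite subrr; split; [exact: kvert0|].
- by move=> e [u [v [uc vc]]]; rewrite (vE u uc) (vE v vc) adjE subrr.
Qed.

Lemma patch_block a n : patch a n = block (center a n) n.
Proof.
elim: n => [|n IH]; first by rewrite block0.
rewrite -(block_rot_union _ (a n)) [patch _ _]/= IH.
by congr (rot_union _ (attach _ (block _ _))); rewrite /= addrK.
Qed.

Lemma kvert_axis k n : kvert (dir k *+ n).
Proof.
elim/ltn_ind: n => n IH; have [odd_n|even_n] := boolP (odd n).
  apply: kvert_oddsum; rewrite /oddsum Z2mulrn.
  by case: (dir_cases k) => -> /=; lia.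
have [->|n0] := posnP n; first by rewrite mulr0n; exact: kvert0.
have -> : n = (n./2 * 2)%N by rewrite muln2 even_halfK.
by rewrite mulrnA; apply/kvert_double/IH; rewrite -divn2 ltn_Pdiv.
Qed.

Lemma adj_dirS c k n : adj (c + dir k *+ n) (c + dir k *+ n.+1).
Proof.
rewrite ![c + _]addrC adj_add adjE mulrS addrK.
by rewrite -[dir k]mulr1n norm1_dir.
Qed.

(** Follow the axis for 2^n steps to the center of the branch of [v], then use fewer than 2^n steps
    inside the branch. *)
Lemma block_walk0 n v : kvert v -> (norm1 v < 2 ^ n)%N ->
  exists2 p, gwalk (block 0 n) 0 v p & (size p < 2 ^ n)%N.
Proof.
elim: n v => [|n IH] v vV vn.
  exists [::] => //; split => //=; symmetry; apply: norm1_eq0.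
  by move: vn; rewrite expn0; lia.
have [->|/eqP v0] := eqVneq v 0.
  by exists [::] => //; rewrite expn_gt0.
have [k kn] := branch_exists vV v0 vn.
have [p pw pn] := IH _ (kvert_branchV vV kn) kn.
have [q qw qn] : exists2 q, gwalk (block 0 n.+1) 0 (dir k *+ 2 ^ n) q & size q = (2 ^ n)%N.
  have : (2 ^ n < 2 ^ n.+1)%N by rewrite ltn_exp2l.
  elim: (2 ^ n)%N => [|m IHm] mn; first by exists [::].
  have [q [qp ql] qm] := IHm (ltnW mn).
  exists (rcons q (dir k *+ m.+1)); last by rewrite size_rcons qm.
  split; last by rewrite last_rcons.
  rewrite rcons_path qp ql /=; apply/asboolP/full_edgeE; split => /=.
  - by rewrite subr0 norm1_dir; split; [exact: kvert_axis|exact: ltnW].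
  - by rewrite subr0 norm1_dir; split; [exact: kvert_axis|].
  - by rewrite -[_ *+ m]add0r -[_ *+ m.+1]add0r adj_dirS.
exists (q ++ map (fun u => u + dir k *+ 2 ^ n) p); last first.
  by rewrite size_cat size_map qn expnS mul2n -addnn ltn_add2l.
apply: gwalk_cat qw _.
have := @gwalk_map (fun u => u + dir k *+ 2 ^ n) (block 0 n) (block 0 n.+1) _ _ _ _ pw.
rewrite add0r subrK; apply=> _ [x [y [[xV xn] [yV yn] xy ->]]].
rewrite image_setU !image_set1; apply/full_edgeE.
rewrite !subr0 in xV xn yV yn.
have br z : kvert z -> (norm1 z < 2 ^ n)%N ->
    kvert (z + dir k *+ 2 ^ n) /\ (norm1 (z + dir k *+ 2 ^ n)%R < 2 ^ n.+1)%N.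
  move=> zV zn; split; first by rewrite addrC; apply/(kvert_near (kvert_dir k) zn).
  apply: leq_ltn_trans (norm1D _ _) _.
  by rewrite norm1_dir expnS mul2n -addnn ltn_add2r.
by split; rewrite ?adj_add //= subr0; exact: br.
Qed.

Lemma block_gshift c n : block c n = gshift c (block 0 n).
Proof.
have tv v : vert (block 0 n) v -> vert (block c n) (v + c).
  by rewrite /= subr0 addrK.
have tv' v : vert (block c n) v -> vert (block 0 n) (v - c).
  by rewrite /= subr0.
congr Graph; apply/seteqP; split.
- by move=> v vc; exists (v - c); [exact: tv'|rewrite subrK].
- by move=> _ [v /tv ? <-].
- move=> _ [u [v [uG vG uv ->]]]; exists [set u - c; v - c].
    by apply/full_edgeE; split; [exact: tv'|exact: tv'|rewrite adj_add].
  by rewrite image_setU !image_set1 !subrK.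
- move=> _ [_ [u [v [uG vG uv ->]]] <-]; rewrite image_setU !image_set1.
  by apply/full_edgeE; split; [exact: tv|exact: tv|rewrite adj_add].
Qed.

Lemma block_walk c n v : vert (block c n) v ->
  exists2 p, gwalk (block c n) c v p & (size p < 2 ^ n)%N.
Proof.
move=> [vV vn]; have [p pw pn] := block_walk0 vV vn.
exists (map (fun u => u + c) p); last by rewrite size_map.
rewrite -{2}[c]add0r -[v](subrK c).
apply: gwalk_map pw => e eE; rewrite block_gshift; by exists e.
Qed.

End pairs.

(** * The limit tree *)

Section kenyon_tree.
Implicit Types (u v w c : Z2) (k : 'I_4) (n : nat).

Let north n : Z2 := (0, (2 ^ n)%N%:Z).

Let northE n : (0, 2 ^+ n) = north n :> Z2.
Proof. by rewrite /north; congr pair; rewrite -[in RHS]natz natrX. Qed.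

Let unpruned n : graph := rot_union 0 (gshift (north n.+1) (kenyon n)).

Let kenyonS n : kenyon n.+1 = prune_axis (unpruned n).
Proof. by rewrite /= northE. Qed.

Let rot_about0 k v : rot_about 0 k v = iter k rot90 v.
Proof. by rewrite /rot_about subr0 add0r. Qed.

Let unpruned_axis n k (y : nat) : (y < 2 ^ n.+2)%N ->
  edge (unpruned n) [set iter k rot90 (0, y%:Z); iter k rot90 (0, y.+1%:Z)].
Proof.
move=> yn; exists k => //; exists [set (0, y%:Z); (0, y.+1%:Z)]; last first.
  by rewrite image_setU !image_set1 !rot_about0.
exists (axis_edge (y%:Z - (2 ^ n.+1)%N%:Z)).
  apply: kenyon_axis; have -> : 2 ^+ n.+1 = (2 ^ n.+1)%N%:Z by rewrite -[in RHS]natz natrX.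
  by move: yn; rewrite [(2 ^ n.+2)%N]expnS; lia.
rewrite /axis_edge image_setU !image_set1 /north.
by congr ([set _] `|` [set _]); congr pair => /=; lia.
Qed.

Let unpruned_horizontal n (x : int) : (absz x < 2 ^ n.+2)%N ->
  edge (unpruned n) [set (x, 0); (x + 1, 0)] /\ edge (unpruned n) [set (x - 1, 0); (x, 0)].
Proof.
have east (y : nat) : (y < 2 ^ n.+2)%N -> edge (unpruned n) [set (y%:Z, 0); (y.+1%:Z, 0)].
  move=> /(@unpruned_axis n (inord 3)); rewrite inordK //= /rot90 /= !opprK.
  by rewrite oppr0.
have west (y : nat) : (y < 2 ^ n.+2)%N -> edge (unpruned n) [set (- y%:Z, 0); (- y.+1%:Z, 0)].
  by move=> /(@unpruned_axis n (inord 1)); rewrite inordK //= /rot90 /=.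
case: x => [[|y]|y] xn.
- split; first exact: (east 0%N).
  by rewrite setUC sub0r; exact: (west 0%N).
- have -> : Posz y.+1 + 1 = y.+2%:Z by lia.
  have -> : Posz y.+1 - 1 = y%:Z by lia.
  by split; apply: east => //; exact: ltnW.
- rewrite NegzE in xn *; have -> : - y.+1%:Z + 1 = - y%:Z by lia.
  have -> : - y.+1%:Z - 1 = - y.+2%:Z by lia.
  by split; rewrite setUC; apply: west => //; lia.
Qed.

(** The shift by [north] sends the lower tip to 0 and the upper tip to the next extreme point, whose
    four rotations are the only points outside the open ball; pruning leaves the two vertical
    ones. *)
Let kenyon_vert n v : vert (kenyon n) v ->
  kvert v /\ ((norm1 v < 2 ^ n.+1)%N \/ v = north n.+1 \/ v = - north n.+1).
Proof.
have dirN k m : kvert (dir k *+ 2 ^ m) by exact/kvert_pow/kvert_dir.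
have northN m : north m = dir (inord 1) *+ 2 ^ m.
  by rewrite /dir inordK // Z2mulrn /=; congr pair => /=; lia.
elim: n v => [|n IH] v.
  case: v => x y [] /= [].
    move=> x1 ->; split; last by left; rewrite /norm1 /=; lia.
    have [x0|x0] : x = 0 \/ absz x = 1%N by lia.
      by rewrite x0; exact: kvert0.
    by apply: kvert_oddsum; rewrite /oddsum /=; lia.
  move=> -> y1; split.
    have [->|->|->|y2] : [\/ y = 0, y = 2, y = -2 | absz y = 1%N].
    - have : [|| y == 0, y == 2, y == -2 | absz y == 1%N] by lia.
      by move=> /or4P[]/eqP ->; [constructor 1|constructor 2|constructor 3|constructor 4].
    - exact: kvert0.
    - by rewrite -[X in kvert X]/((0, 1) *+ 2); exact/kvert_double/kvert_oddsum.
    - by rewrite -[X in kvert X]/((0, -1) *+ 2); exact/kvert_double/kvert_oddsum.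
    - by apply: kvert_oddsum; rewrite /oddsum /=; lia.
  have [->|->|y2] : [\/ y = 2, y = -2 | (absz y < 2)%N].
  - have : [|| y == 2, y == -2 | (absz y < 2)%N] by lia.
    by move=> /or3P[/eqP ->|/eqP ->|?]; [constructor 1|constructor 2|constructor 3].
  - by right; left.
  - by right; right.
  - by left; rewrite /norm1 /= expn1.
rewrite kenyonS.
have uv w : vert (unpruned n) w -> kvert w /\
    ((norm1 w < 2 ^ n.+2)%N \/ exists k, w = iter k rot90 (north n.+2)).
  move=> [k _ [_ [w' /IH[w'V w'n] <-] <-]]; rewrite rot_about0.
  case: w'n => [w'n|[w'E|w'E]].
  - split; last first.
      left; rewrite norm1_rot90; apply: leq_ltn_trans (norm1D _ _) _.
      by rewrite northN norm1_dir (expnS 2 n.+1) mul2n -addnn ltn_add2r.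
    by apply: kvert_rot; rewrite northN addrC; apply/(kvert_near (kvert_dir _) w'n).
  - have -> : w' + north n.+1 = north n.+2.
      by rewrite w'E /north (expnS 2 n.+1); congr pair => /=; lia.
    split; last by right; exists k.
    by rewrite northN; exact/kvert_rot.
  - rewrite w'E addNr; split; first exact/kvert_rot/kvert0.
    by left; rewrite norm1_rot90 /norm1 expn_gt0.
move=> [/uv[vV [vn|[k kE]]] nt]; split => //; first by left.
(* The tips [k1] (west) and [k3] (east) have a single edge, lying on the horizontal axis, so they
   are removed by the pruning. *)
have [k0|k1|k2|k3] : [\/ k = inord 0, k = inord 1, k = inord 2 | k = inord 3].
  by case: (k) => [[|[|[|[|]]]]] // i; [constructor 1|constructor 2|constructor 3|constructor 4];
    apply/val_inj; rewrite /= inordK.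
- by right; left; rewrite kE k0 inordK.
- case: nt; rewrite kE k1 inordK //=; set N := (2 ^ n.+2)%N.
  exists [set (- N%:Z, 0); (- N%:Z + 1, 0)].
  have NE : N = (2 * 2 ^ n.+1)%N by rewrite -expnS.
  have N0 : (0 < 2 ^ n.+1)%N by rewrite expn_gt0.
  have eE : edge (unpruned n) [set (- N%:Z, 0); (- N%:Z + 1, 0)].
    have /unpruned_horizontal[_] : (absz (- N%:Z + 1)%R < 2 ^ n.+2)%N by rewrite -/N; lia.
    by rewrite addrK.
  split => //.
  + by left; rewrite /rot90 /=; congr pair.
  + move=> e' e'E; have /sub_rot_union : subgraph_Z2 (gshift (north n.+1) (kenyon n)).
      exact/sub_gshift/kenyon_sub.
    move=> /(_ 0 _ e'E)[x [y [xG yG xy ->]]].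
    have key z : vert (unpruned n) z -> adj (rot90 (north n.+2)) z -> z = (- N%:Z + 1, 0).
      rewrite adjE => /uv[zV [zn|[k' ->]]] /eqP.
        move: zn; case: z zV => z t _; rewrite /norm1 /= -/N => zn za; congr pair; lia.
      have : k' \in [:: inord 0; inord 1; inord 2; inord 3].
        by rewrite !inE -!val_eqE /= !inordK //; case: k' => -[|[|[|[|]]]].
      by rewrite !inE => /or4P[]/eqP ->; rewrite inordK //= /norm1 /= -/N; lia.
    move=> /set2_mem; rewrite !inE => /orP[]/eqP xyE.
    * have -> : x = (- N%:Z, 0) by rewrite -xyE /rot90 /=.
      by congr (_ `|` [set _]); apply: key => //; rewrite xyE.
    * have -> : y = (- N%:Z, 0) by rewrite -xyE /rot90 /=.
      by rewrite setUC; congr (_ `|` [set _]); apply: key => //; rewrite xyE adj_sym.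
  + by move=> w [] ->.
- by right; right; rewrite kE k2 inordK // /= /rot90 /= oppr0.
- case: nt; rewrite kE k3 inordK //=; set N := (2 ^ n.+2)%N.
  exists [set (N%:Z, 0); (N%:Z - 1, 0)].
  have NE : N = (2 * 2 ^ n.+1)%N by rewrite -expnS.
  have N0 : (0 < 2 ^ n.+1)%N by rewrite expn_gt0.
  have vE : rot90 (rot90 (rot90 (north n.+2))) = (N%:Z, 0).
    by rewrite /rot90 /= -/N !opprK oppr0.
  have eE : edge (unpruned n) [set (N%:Z, 0); (N%:Z - 1, 0)].
    have /unpruned_horizontal[+ _] : (absz (N%:Z - 1)%R < 2 ^ n.+2)%N by rewrite -/N; lia.
    by rewrite subrK setUC.
  rewrite vE; split => //.
  + by left.
  + move=> e' e'E; have /sub_rot_union : subgraph_Z2 (gshift (north n.+1) (kenyon n)).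
      exact/sub_gshift/kenyon_sub.
    move=> /(_ 0 _ e'E)[x [y [xG yG xy ->]]].
    have key z : vert (unpruned n) z -> adj (N%:Z, 0) z -> z = (N%:Z - 1, 0).
      rewrite adjE => /uv[zV [zn|[k' ->]]] /eqP.
        move: zn; case: z zV => z t _; rewrite /norm1 /= -/N => zn za; congr pair; lia.
      have : k' \in [:: inord 0; inord 1; inord 2; inord 3].
        by rewrite !inE -!val_eqE /= !inordK //; case: k' => -[|[|[|[|]]]].
      by rewrite !inE => /or4P[]/eqP ->; rewrite inordK //= /norm1 /= -/N; lia.
    move=> /set2_mem; rewrite !inE => /orP[]/eqP xyE.
    * by rewrite -xyE; congr (_ `|` [set _]); apply: key => //; rewrite xyE.
    * by rewrite -xyE setUC; congr (_ `|` [set _]); apply: key => //; rewrite xyE adj_sym.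
  + by move=> w [] ->.
Qed.

(** An edge at 0 lies on an axis; any other edge lies in one branch, which is a rotated and shifted
    copy of the block of the previous stage. *)
Let kenyon_block n : edge (block 0 n.+1) `<=` edge (kenyon n).
Proof.
elim: n => [|n IH].
  move=> _ [[a b] [[c d] [[+ +] [+ +] ab ->]]]; rewrite !subr0 => _ abn _ cdn.
  move: (ab); rewrite adjE => /eqP; move: abn cdn; rewrite /norm1 /= expn1 => abn cdn abcd.
  have : ((b == 0) && (d == 0)) || ((a == 0) && (c == 0)) by lia.
  move=> /orP[] /andP[/eqP ? /eqP ?]; subst.
  - left; apply/full_edgeE; split; rewrite /= ?adjE /norm1 /=; lia.
  - right; apply/full_edgeE; split; rewrite /= ?adjE /norm1 /=; lia.
rewrite kenyonS => _ [u [v [[+ +] [+ +] uv ->]]]; rewrite !subr0 => uV un vV vn.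
have rotj k : exists j : 'I_4, forall m : nat, dir k *+ m = iter j rot90 (0, m%:Z).
  exists (inord ((k + 3) %% 4)) => m; rewrite inordK ?ltn_pmod //.
  have -> : (0, m%:Z) = iter 1 rot90 ((1, 0) *+ m) :> Z2.
    by rewrite /= Z2mulrn /rot90 /=; congr pair; lia.
  by case: k => [[|[|[|[|]]]]] // i; rewrite -?iterD /dir iter_rot90Mn.
(* Pruning spares this edge: a point of the horizontal axis inside the open ball has two horizontal
   edges, hence is not terminal. *)
split; last first.
  move=> [w [eE we un1 ax]].
  have wn : (norm1 w < 2 ^ n.+2)%N by case: we => ->.
  have := ax _ we; case: w we wn un1 => x y we + un1 /= y0; rewrite y0 in we un1 *.
  rewrite /norm1 /= addn0 => xn; have [h1 h2] := unpruned_horizontal xn.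
  have := un1 _ h2 (or_intror erefl); rewrite -(un1 _ h1 (or_introl erefl)).
  by move=> /set2_inj[] [] /(congr1 fst) /= ? /(congr1 fst) /= ?; lia.
have to0 v' : adj 0 v' -> edge (unpruned n) [set 0; v'].
  rewrite adjE subr0 => /eqP/dir_exists[k ->]; have [j jE] := rotj k.
  have -> : dir k = iter j rot90 (0, 1) by rewrite -(jE 1%N).
  have {1}-> : 0 = iter j rot90 (0, 0) by rewrite -(jE 0%N).
  by apply: (@unpruned_axis n j 0); rewrite expn_gt0.
have [u0|/eqP u0] := eqVneq u 0; first by rewrite u0 in uv *; exact: to0.
have [v0|/eqP v0] := eqVneq v 0; first by rewrite v0 adj_sym in uv *; rewrite setUC; exact: to0.
have [k ukn] := branch_exists uV u0 un.
have vkn := branch_adj vV v0 vn uv uV ukn.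
have [j jE] := rotj k.
pose f w : Z2 := iter (j * 3) rot90 (w - dir k *+ 2 ^ n.+1).
have fK w : iter j rot90 (f w + north n.+1) = w.
  by rewrite iter_rot90D iter_rot90K -jE subrK.
exists j => //; exists [set f u + north n.+1; f v + north n.+1]; last first.
  by rewrite image_setU !image_set1 !rot_about0 !fK.
exists [set f u; f v]; last by rewrite image_setU !image_set1.
apply: IH; apply/full_edgeE; rewrite /= !subr0 !norm1_rot90; split.
- by split => //; exact/kvert_rot/kvert_branchV.
- by split => //; exact/kvert_rot/kvert_branchV.
- have := @adj_rot 0 (j * 3) (u - dir k *+ 2 ^ n.+1) (v - dir k *+ 2 ^ n.+1).
  by rewrite !/(rot_about _ _ _) !subr0 !add0r; apply; rewrite adj_add.
Qed.

Lemma kvert_neighbour v : kvert v -> exists2 u, kvert u & adj v u.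
Proof.
move=> vV; have ad k : adj v (v + dir k).
  by rewrite adjE addrAC subrr add0r -[dir k]mulr1n norm1_dir.
have [/next_dir[k [w [wE wo]]]|ve] := boolP (oddsum v).
  by exists (v + dir k) => //; rewrite wE; exact/kvert_double/kvert_oddsum.
exists (v + dir ord0) => //; apply: kvert_oddsum.
by move: ve; rewrite /oddsum /=; lia.
Qed.

Lemma edge_vert G u v : subgraph_Z2 G -> edge G [set u; v] -> vert G u /\ vert G v.
Proof.
by move=> GG /GG[u' [v' [u'G v'G _ /set2_inj[[-> ->]|[-> ->]]]]].
Qed.

Lemma kenyon_graphE : kenyon_graph = full_graph kvert.
Proof.
have eE : edge (full_graph kvert) `<=` edge kenyon_graph.
  move=> _ [u [v [uV vV uv ->]]]; exists (norm1 u + norm1 v)%N => //.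
  apply: kenyon_block; apply/full_edgeE; rewrite /= !subr0.
  have : (norm1 u + norm1 v < 2 ^ (norm1 u + norm1 v).+1)%N.
    by apply: ltn_trans (ltn_expl _ (isT : (1 < 2)%N)) _; rewrite ltn_exp2l.
  by split=> //; split=> //; lia.
congr Graph; apply/seteqP; split => //.
- by move=> v [n _ /kenyon_vert[]].
- move=> v vV; have [u uV uv] := kvert_neighbour vV.
  have /edge_vert : edge kenyon_graph [set v; u] by apply: eE; exact/full_edgeE.
  by move=> /(_ (sub_gbigcup kenyon_sub))[].
- move=> e eK; have [u [v [[n _ /kenyon_vert[uV _]] [m _ /kenyon_vert[vV _]] uv ->]]] := sub_gbigcup kenyon_sub eK.
  exact/full_edgeE.
Qed.

End kenyon_tree.

(** * Levels and codes *)

(** Only edges are compared, so the condition is void for [n = 0]. *)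
Definition blockin (c : Z2) (n : nat) (G : graph) : Prop :=
  edge (block c n) `<=` edge G.

Definition kenyon_at (p : Z2) : graph := full_graph [set v | kvert (p + v)].

(** For a translate of T_infty this says that 2^j divides the [j]-th center exactly (see [codedP]).
    Only the digits of index less than [n] enter. *)
Definition coded (a : S4) (n : nat) (G : graph) : Prop :=
  forall j, (j <= n)%N -> blockin (center a j) j G /\ ~ blockin (center a j) j.+1 G.

Section levels.
Implicit Types (u v w c p : Z2) (k : 'I_4) (n : nat) (a b : S4).

Lemma mulrn_inj2 n u v : u *+ 2 ^ n = v *+ 2 ^ n -> u = v.
Proof.
elim: n => [//|n IH]; rewrite expnSr !mulrnA => /mulr2_inj; exact: IH.
Qed.

Lemma gshift_kenyon p : gshift (- p) kenyon_graph = kenyon_at p.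
Proof.
have tv v : kvert v -> kvert (p + (v - p)) by rewrite addrC subrK.
rewrite kenyon_graphE; congr Graph; apply/seteqP; split.
- by move=> _ [v /= vV <-] /=; exact: tv.
- by move=> v /= vV; exists (p + v); rewrite // addrAC subrr add0r.
- move=> _ [_ [u [v [uV vV uv ->]]] <-]; rewrite image_setU !image_set1.
  by apply/full_edgeE; split; [exact: tv|exact: tv|rewrite adj_add].
- move=> _ [u [v [uV vV uv ->]]]; exists [set p + u; p + v]; last first.
    by rewrite image_setU !image_set1 ![p + _ - p]addrAC subrr !add0r.
  by apply/full_edgeE; split => //; rewrite ![p + _]addrC adj_add.
Qed.

Lemma kvert_level n v : kvert v -> (exists2 w, kvert w & v = w *+ 2 ^ n) \/
  (exists i w, [/\ (i < n)%N, oddsum w & v = w *+ 2 ^ i]).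
Proof.
elim: n => [|n IH] vV; first by left; exists v.
have [[w wV wE]|[k [w [kn wo wE]]]] := IH vV; last first.
  by right; exists k, w; split => //; exact: ltnW.
have [wo|we] := boolP (oddsum w); first by right; exists n, w.
have [w' w'E w'V] := kvert_even wV we.
by left; exists w' => //; rewrite wE w'E -mulrnA expnS.
Qed.

(** A step along the even coordinate makes both coordinates odd. *)
Lemma oddsum_diagonal w : oddsum w -> exists k, ~ kvert (w + dir k).
Proof.
move=> wo; have [w1|w1] := eqVneq (w.1 %% 2)%Z 1.
- exists (inord 1); apply: kvert_odd_odd; rewrite /dir inordK //=;
  by move: wo w1; rewrite /oddsum; lia.
- exists (inord 0); apply: kvert_odd_odd; rewrite /dir inordK //=;
  by move: wo w1; rewrite /oddsum; lia.
Qed.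

Lemma block_spoke c n k i : (i.+1 < 2 ^ n)%N ->
  edge (block c n) [set c + dir k *+ i; c + dir k *+ i.+1].
Proof.
move=> iN; have H m : (m < 2 ^ n)%N -> vert (block c n) (c + dir k *+ m).
  by move=> mn; rewrite /= addrAC subrr add0r norm1_dir; split => //; exact: kvert_axis.
by apply/full_edgeE; split; [exact/H/ltnW|exact: H|exact: adj_dirS].
Qed.

(** The spokes detect divisibility: if [p + c] is [w *+ 2 ^ m] with [w] of odd sum and [m < n], one
    of its spokes lacks the point at distance 2^m, whereas a block of order [n] reaches that far in
    all four directions. *)
Lemma blockinP p c n : kvert (p + c) ->
  blockin c n (kenyon_at p) <-> exists2 w, kvert w & p + c = w *+ 2 ^ n.
Proof.
move=> pcV; split=> [cG|[w wV wE]]; last first.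
  apply: full_graphS => v [vV vn] /=.
  have -> : p + v = w *+ 2 ^ n + (v - c) by rewrite -wE addrACA subrr addr0.
  exact/kvert_near.
have [//|[m [w [mn wo wE]]]] := kvert_level n pcV.
have [k kV] := oddsum_diagonal wo.
have m0 : (2 ^ m = (2 ^ m - 1).+1)%N by have := expn_gt0 2 m; lia.
have : edge (block c n) [set c + dir k *+ (2 ^ m - 1); c + dir k *+ 2 ^ m].
  by rewrite {2}m0; apply: block_spoke; rewrite -m0 ltn_exp2l.
move=> /cG/full_edgeE[_ /= + _]; rewrite addrA wE -mulrnDl kvert_pow => h.
by case: kV.
Qed.

Lemma blockin_center p c n : blockin c n.+1 (kenyon_at p) -> kvert (p + c).
Proof.
move=> cG; have : edge (block c n.+1) [set c + dir ord0 *+ 0; c + dir ord0 *+ 1].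
  by apply: block_spoke; rewrite -{1}(expn0 2) ltn_exp2l.
by move=> /cG/full_edgeE[+ _ _]; rewrite mulr0n addr0.
Qed.

Lemma oddsum_center a n : oddsum (center a n.+1).
Proof.
elim: n => [|n IH].
  by rewrite /oddsum /=; case: (dir_cases (a 0%N)) => ->.
rewrite -[center a n.+2]/(center a n.+1 + dir (a n.+1) *+ 2 ^ n.+1).
rewrite expnSr mulrnA; move: (center a n.+1) (dir _ *+ 2 ^ n) IH => [x y] [z t].
by rewrite Z2mulrn /oddsum /=; lia.
Qed.

Lemma kvert_center a n : kvert (center a n).
Proof.
by case: n => [|n]; [exact: kvert0|exact/kvert_oddsum/oddsum_center].
Qed.

Lemma norm1_center a n : (norm1 (center a n) < 2 ^ n)%N.
Proof.
elim: n => [//|n IH] /=; apply: leq_ltn_trans (norm1D _ _) _.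
by rewrite norm1_dir expnS mul2n -addnn ltn_add2r.
Qed.

Lemma center_eq a b n : (forall i, (i < n)%N -> a i = b i) -> center a n = center b n.
Proof.
elim: n => [//|n IH] ab /=; rewrite IH ?ab // => i i_n; apply: ab; exact: ltnW.
Qed.

Lemma centerD a n m :
  center a (n + m) = center a n + center (fun i => a (n + i)%N : 'I_4) m *+ 2 ^ n.
Proof.
elim: m => [|m IH]; first by rewrite addn0 mul0rn addr0.
by rewrite addnS /= IH mulrnDl addrA expnD mulnC mulrnA.
Qed.

Lemma centerB a n m : (n <= m)%N -> exists2 w, kvert w & center a n - center a m = w *+ 2 ^ n.
Proof.
move=> nm; rewrite -(subnKC nm) centerD opprD addrA subrr add0r -mulNrn.
by eexists; last reflexivity; exact/kvert_opp/kvert_center.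
Qed.

Lemma centerB_odd a n m : (n < m)%N -> exists2 w, oddsum w & center a n - center a m = w *+ 2 ^ n.
Proof.
move=> nm; rewrite -(subnKC (ltnW nm)) centerD opprD addrA subrr add0r -mulNrn.
eexists; last reflexivity; have : (0 < m - n)%N by rewrite subn_gt0.
case: (m - n)%N => // k _; set b := fun i => _.
by have := oddsum_center b k; rewrite /oddsum /=; lia.
Qed.

Lemma patch_subS a n : edge (patch a n) `<=` edge (patch a n.+1).
Proof.
rewrite !patch_block; apply: full_graphS => v [vV vn].
have vE : v - center a n = v - center a n.+1 + dir (a n) *+ 2 ^ n.
  by rewrite /= opprD addrA subrK.
by rewrite vE in vV vn; exact: (kvert_branch vV vn).
Qed.

Lemma patch_vertS a n : vert (patch a n) `<=` vert (patch a n.+1).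
Proof.
rewrite !patch_block => v [vV vn].
have vE : v - center a n = v - center a n.+1 + dir (a n) *+ 2 ^ n.
  by rewrite /= opprD addrA subrK.
by rewrite vE in vV vn; exact: (kvert_branch vV vn).
Qed.

Lemma patch_mono a n m : (n <= m)%N -> edge (patch a n) `<=` edge (patch a m).
Proof.
move=> /subnKC <-; elim: (m - n)%N => [|k IH] e eE; first by rewrite addn0.
by rewrite addnS; apply/patch_subS/IH.
Qed.

Lemma patch_vert_mono a n m : (n <= m)%N -> vert (patch a n) `<=` vert (patch a m).
Proof.
move=> /subnKC <-; elim: (m - n)%N => [|k IH] e eE; first by rewrite addn0.
by rewrite addnS; apply/patch_vertS/IH.
Qed.

Lemma patch_eq a b n : (forall i, (i < n)%N -> a i = b i) -> patch a n = patch b n.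
Proof. by move=> ab; rewrite !patch_block (center_eq ab). Qed.

Lemma patch_full a n u v : vert (patch a n) u -> vert (patch a n) v -> adj u v ->
  edge (patch a n) [set u; v].
Proof. by rewrite patch_block => uG vG uv; exact/full_edgeE. Qed.

Lemma patch_kenyon_at a n p : (exists2 w, kvert w & p + center a n = w *+ 2 ^ n) ->
  edge (patch a n) `<=` edge (kenyon_at p).
Proof.
move=> [w wV wE]; rewrite patch_block; apply/blockinP; last by exists w.
by rewrite wE kvert_pow.
Qed.

Lemma patch_center a n m : (n <= m)%N -> edge (patch a n) `<=` edge (kenyon_at (- center a m)).
Proof. by move=> nm; apply: patch_kenyon_at; rewrite addrC; exact: centerB. Qed.

Lemma codedP p a n : kvert p -> coded a n (kenyon_at p) <->
  forall j, (j <= n)%N -> exists2 w, oddsum w & p + center a j = w *+ 2 ^ j.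
Proof.
move=> pV; split=> pa j jn.
- have [h1 h2] := pa j jn.
  (* At [j = 0] the block condition is void, but the center is then the root itself. *)
  have cV : kvert (p + center a j).
    by case: j jn h1 {h2} => [|j] _ h1; [rewrite /= addr0|exact: blockin_center h1].
  have [w wV wE] := (blockinP j cV).1 h1.
  exists w => //; apply: contra_notT h2 => /(kvert_even wV)[w' w'E w'V].
  by apply/(blockinP _ cV); exists w' => //; rewrite wE w'E -mulrnA expnS.
- have [w wo wE] := pa j jn.
  have cV : kvert (p + center a j) by rewrite wE kvert_pow; exact: kvert_oddsum.
  split; first by apply/(blockinP _ cV); exists w => //; exact: kvert_oddsum.
  move=> /(blockinP _ cV)[w' _]; rewrite wE expnS mulrnA => /mulrn_inj2 ww'.
  by move: wo; rewrite ww' /oddsum Z2mulrn /=; lia.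
Qed.

Lemma coded_le a n m G : (n <= m)%N -> coded a m G -> coded a n G.
Proof. by move=> nm h j jn; apply: h; exact: leq_trans nm. Qed.

Lemma coded_eq a b n G : (forall i, (i < n)%N -> a i = b i) -> coded a n G -> coded b n G.
Proof.
move=> ab h j jn; rewrite -(@center_eq a b); first exact: h.
by move=> i ij; apply: ab; exact: leq_trans jn.
Qed.

Lemma coded_oddsum p a n : kvert p -> coded a n (kenyon_at p) -> oddsum p.
Proof. by move=> pV /(codedP _ _ pV)/(_ 0%N isT)[w wo]; rewrite /= addr0 mulr1n => ->. Qed.

Lemma coded_unique p a b n i : kvert p -> coded a n (kenyon_at p) -> coded b n (kenyon_at p) ->
  (i < n)%N -> a i = b i.
Proof.
move=> pV /(codedP _ _ pV) ha /(codedP _ _ pV) hb.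
elim/ltn_ind: i => i IH i_n.
have cab : center a i = center b i.
  by apply: center_eq => l li; apply: IH => //; exact: ltn_trans i_n.
have [w wo wE] := ha i (ltnW i_n).
have [wa wao waE] := ha i.+1 i_n; have [wb wbo wbE] := hb i.+1 i_n.
move: waE wbE; rewrite /= -cab !addrA wE expnS !mulrnA -!mulrnDl.
by move=> /mulrn_inj2 ea /mulrn_inj2 eb; exact: next_dir_unique ea eb wao wbo.
Qed.

Lemma coded_exists p : oddsum p -> exists a, forall n, coded a n (kenyon_at p).
Proof.
move=> po; pose P w := [set kw : 'I_4 * Z2 | w + dir kw.1 = kw.2 *+ 2 /\ oddsum kw.2].
pose step w := xget (ord0, 0) (P w).
have stepP w : oddsum w -> P w (step w).
  move=> /next_dir[k [w' [wE wo]]].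
  by apply: (@xgetPex _ (ord0, 0) (P w)); exists (k, w').
(* [W n] is the quotient of [p + center a n] by 2^n; its odd sum lets [next_dir] continue. *)
pose W := fix W n := if n is m.+1 then (step (W m)).2 else p.
pose a : S4 := fun n => (step (W n)).1.
have aP n : oddsum (W n) /\ p + center a n = W n *+ 2 ^ n.
  elim: n => [|n [Wo WE]]; first by rewrite /= addr0.
  have [e o] := stepP _ Wo; split=> //=.
  by rewrite addrA WE expnS mulrnA -mulrnDl -e.
exists a => n; apply/codedP; first exact: kvert_oddsum.
by move=> j _; exists (W j); case: (aP j).
Qed.

(* This is why Phi is continuous at the sequences that are not eventually
   constant, and why a tree of X with such an itinerary is in the image. *)
Lemma patch_confined b j p u u' :
    (exists w, p + center b j.+2 = w *+ 2 ^ j.+2) ->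
    vert (patch b j) u -> adj u u' -> kvert (p + u') ->
  [\/ vert (patch b j.+1) u', b j.+1 = b j |
      u' = center b j.+2 /\ dir (b j.+1) = - dir (b j)].
Proof.
move=> [w wE] uG uu' u'V; set x := center b j.+1.
have pxE : p + x = (w *+ 2 - dir (b j.+1)) *+ 2 ^ j.+1.
  rewrite mulrnBl -mulrnA -expnS -wE.
  have -> : center b j.+2 = x + dir (b j.+1) *+ 2 ^ j.+1 by [].
  by rewrite (addrA p x) addrK.
have pu v : p + v = (w *+ 2 - dir (b j.+1)) *+ 2 ^ j.+1 + (v - x).
  by rewrite -pxE addrACA subrr addr0.
have uu'x : adj (u - x) (u' - x) by rewrite adj_add.
have u1 : vert (patch b j.+1) u by exact: patch_vertS.
move: (u1) uG; rewrite !patch_block => -[_ u1n] [_ u0n].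
have [u'n|u'n] := ltnP (norm1 (u' - x)) (2 ^ j.+1).
  constructor 1; split => //; move: u'V; rewrite pu; apply: (kvert_near _ u'n).1.
  by apply: kvert_oddsum; rewrite /oddsum Z2mulrn; case: (dir_cases (b j.+1)) => -> /=; lia.
rewrite pu in u'V; have [k [kE k'E]] := kvert_tip u'V uu'x u1n u'n.
(* The edge leaves the ball about [x] at the end of a spoke. As [u] is close to [center b j], which
   lies behind [x], this is the spoke opposite to the last move. *)
have kb : dir k = - dir (b j).
  move: u0n; have -> : u - center b j = dir k *+ (2 ^ j.+1 - 1) + dir (b j) *+ 2 ^ j.
    by rewrite -kE /x /= opprD addrA subrK.
  have : (0 < 2 ^ j)%N by rewrite expn_gt0.
  rewrite expnS !Z2mulrn /norm1; move: (2 ^ j)%N => N /=.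
  by case: (dir_cases k) => ->; case: (dir_cases (b j)) => -> //=; rewrite ?mul0r; lia.
move: u'V; rewrite k'E -mulrnDl kvert_pow kb => h.
have [->|/eqP db] := eqVneq (b j.+1) (b j); first by constructor 2.
constructor 3.
(* If the two moves were perpendicular, both coordinates of the quotient in [h] would be odd. *)
have dd : dir (b j.+1) = - dir (b j).
  have ne1 : dir (b j.+1) <> dir (b j) by move=> /dir_inj.
  have [//|/eqP ne2] := eqVneq (dir (b j.+1)) (- dir (b j)); case: (kvert_odd_odd _ _ h);
    rewrite Z2mulrn; move: ne1 ne2;
    by case: (dir_cases (b j)) => ->; case: (dir_cases (b j.+1)) => -> //= _ _; lia.
by split => //; rewrite -[u'](subrK x) k'E kb -dd addrC.
Qed.

End levels.

(** * Limits of translates of T_infty *)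

Definition limit_graph (G : graph) : Prop :=
  forall N, exists2 p, kvert p & gball G N = gball (kenyon_at p) N.

Definition nonconst (a : S4) : Prop := forall n, exists2 j, (n <= j)%N & a j.+1 <> a j.

Section local_structure.
Implicit Types (u v w c : Z2) (p : seq Z2) (k : 'I_4) (n N : nat) (a b : S4) (G H : graph).

(** Agreement is asked only at the vertices of the ball of [G]: by induction on its length, a short
    walk of [H] from 0 never leaves this ball. *)
Lemma gball_ext G H N : subgraph_Z2 G -> subgraph_Z2 H ->
  (forall u v, ballv G N u -> edge G [set u; v] <-> edge H [set u; v]) ->
  gball G N = gball H N.
Proof.
move=> sG sH GH.
have GHv u : ballv G N u -> ballv H N u.
  move=> [p [pp lp] pN]; exists p => //; split => //.
  elim/last_ind: p {lp} pp pN => // p x IH.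
  rewrite rcons_path size_rcons => /andP[pp /asboolP px] pN.
  rewrite rcons_path IH //=; last exact: ltnW.
  by apply/asboolP/GH => //; exists p => //; exact: ltnW.
have HGv u : ballv H N u -> ballv G N u.
  move=> [p [pp lp] pN]; exists p => //; split => //.
  elim/last_ind: p {lp} pp pN => // p x IH.
  rewrite rcons_path size_rcons => /andP[pp /asboolP px] pN.
  have pG := IH pp (ltnW pN); rewrite rcons_path pG /=.
  by apply/asboolP/GH => //; exists p => //; exact: ltnW.
congr Graph; first by apply/seteqP.
apply/seteqP; split=> e [].
- move=> /[dup] eG /sG[u [v [_ _ _ eE]]] [w [we wG]].
  split; last by exists w; split => //; exact: GHv.
  have [z ez] : exists z, e = [set w; z].
    by move: we; rewrite eE => -[] ->; [exists v|exists u; rewrite setUC].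
  by rewrite ez; apply/GH => //; rewrite -ez.
- move=> /[dup] eH /sH[u [v [_ _ _ eE]]] [w [we wH]].
  split; last by exists w; split => //; exact: HGv.
  have [z ez] : exists z, e = [set w; z].
    by move: we; rewrite eE => -[] ->; [exists v|exists u; rewrite setUC].
  by rewrite ez; apply/GH; [exact: HGv|rewrite -ez].
Qed.

Lemma gball_edge G H N u v : gball G N = gball H N -> ballv G N u ->
  edge G [set u; v] -> edge H [set u; v].
Proof.
move=> GH uG uv; have : edge (gball G N) [set u; v].
  by split => //; exists u; split => //; left.
by rewrite GH => -[].
Qed.

Lemma gwalk_rev G u v p : gwalk G u v p -> exists2 q, gwalk G v u q & size q = size p.
Proof.
move=> [pp lp]; exists (rev (belast u p)); last by rewrite size_rev size_belast.
split; last by rewrite -lp; case: p {pp lp} => //= x p; rewrite rev_cons last_rcons.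
rewrite -lp rev_path; apply: sub_path pp => x y; by rewrite gadj_sym.
Qed.

Lemma block_ballv c n u v : vert (block c n) u -> vert (block c n) v ->
  exists2 p, gwalk (block c n) u v p & (size p < 2 ^ n.+1)%N.
Proof.
move=> /block_walk[p /gwalk_rev[p' p'w p'p] pn] /block_walk[q qw qn].
exists (p' ++ q); first exact: gwalk_cat p'w qw.
by rewrite size_cat p'p expnS; lia.
Qed.

(** Two vertices of a block are joined through its center by fewer than 2^(n+1) edges, so a block
    containing the root is visible in the ball of that radius. *)
Lemma blockin_local c n N G H : vert (block c n) 0 -> (2 ^ n.+1 <= N)%N ->
  gball G N = gball H N -> blockin c n G -> blockin c n H.
Proof.
move=> c0 nN GH cG _ [u [v [uc vc uv ->]]].
apply: (gball_edge GH); last by apply: cG; exact/full_edgeE.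
have [p pw pn] := block_ballv c0 uc.
by exists p; [exact: gwalk_sub pw|exact: leq_trans nN].
Qed.

Lemma center_block a n m : (n <= m)%N -> vert (block (center a n) m) 0.
Proof.
rewrite /= sub0r norm1N => nm; split; first exact/kvert_opp/kvert_center.
by apply: leq_trans (norm1_center _ _) _; rewrite leq_exp2l.
Qed.

(** The exponent is [n.+2] because exactness at level [n] tests a block of order [n.+1]. *)
Lemma coded_local a n N G H : (2 ^ n.+2 <= N)%N ->
  gball G N = gball H N -> coded a n G -> coded a n H.
Proof.
move=> nN GH aG j jn; have [h1 h2] := aG j jn.
have jN i : (i <= j.+1)%N -> (2 ^ i.+1 <= N)%N.
  move=> ij; apply: leq_trans nN; rewrite leq_exp2l // ltnS.
  exact: leq_trans ij _.
split; first by apply: (blockin_local (center_block _ _) _ GH h1); rewrite ?jN.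
move=> h3; apply: h2; apply: (blockin_local (center_block _ _) _ (esym GH) h3);
  by rewrite ?jN.
Qed.

Lemma gwalk_vert G u v p : subgraph_Z2 G -> vert G u -> gwalk G u v p -> vert G v.
Proof.
move=> sG uG [pp lp]; case/lastP: p pp lp => [|p x]; first by move=> _ <-.
by rewrite rcons_path last_rcons => /andP[_ /asboolP/(edge_vert sG)[]] + + <-.
Qed.

Lemma gwalk_norm1 G u v p : subgraph_Z2 G -> gwalk G u v p -> (norm1 (v - u)%R <= size p)%N.
Proof.
move=> sG; elim: p u => [|x p IH] u [/=]; first by move=> _ <-; rewrite subrr.
move=> /andP[/asboolP/sG[u' [x' [_ _ + /set2_inj ux]]] pp] lp.
have := IH x (conj pp lp) => h ux'; have : (norm1 (x - u)%R <= 1)%N.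
  by move: ux'; rewrite adjE; case: ux => -[-> ->] /eqP; rewrite /norm1 /=; lia.
have -> : v - u = (v - x) + (x - u) by rewrite addrA subrK.
by have := norm1D (v - x) (x - u); lia.
Qed.

Lemma ballv_norm1 G N u : subgraph_Z2 G -> ballv G N u -> (norm1 u < N)%N.
Proof.
move=> sG [p pw pN]; apply: leq_ltn_trans pN.
by have := gwalk_norm1 sG pw; rewrite subr0.
Qed.

Definition box (m : nat) : seq Z2 :=
  [seq (i%:Z - m%:Z, j%:Z - m%:Z) | i <- iota 0 (2 * m), j <- iota 0 (2 * m)].

Lemma mem_box m u : (norm1 u < m)%N -> u \in box m.
Proof.
case: u => x y; rewrite /norm1 /= => xy; apply/allpairsP.
exists (absz (x + m%:Z), absz (y + m%:Z)); rewrite !mem_iota /=.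
by split; [lia|lia|congr pair; lia].
Qed.

Lemma size_box m : size (box m) = (4 * m ^ 2)%N.
Proof. by rewrite size_allpairs !size_iota; lia. Qed.

Lemma monotone_seq (S : seq Z2) (P : nat -> Z2 -> Prop) :
  (forall n m u, (n <= m)%N -> P n u -> P m u) -> (forall u, exists n, P n u) ->
  exists n, forall u, u \in S -> P n u.
Proof.
move=> mP eP; elim: S => [|u S [n IH]]; first by exists 0%N.
have [m um] := eP u; exists (maxn n m) => v.
rewrite inE => /orP[/eqP ->|vS]; first exact: mP (leq_maxr _ _) um.
exact: mP (leq_maxl _ _) (IH v vS).
Qed.

Lemma sub_Phi a : subgraph_Z2 (Phi_graph a).
Proof. exact/sub_gbigcup/patch_sub. Qed.

(** The ball and its neighbours lie in a finite box, so one patch has them all as vertices; a patch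
    is a full subgraph and then has the edges too. *)
Lemma Phi_ball_patch a N : exists n0, forall n, (n0 <= n)%N -> forall u, ballv (Phi_graph a) N u ->
  vert (patch a n) u /\ forall v, edge (Phi_graph a) [set u; v] -> edge (patch a n) [set u; v].
Proof.
have [||n0 n0P] := @monotone_seq (box N.+1) (fun n u => vert (Phi_graph a) u -> vert (patch a n) u).
- by move=> n m u nm h /h; exact: patch_vert_mono.
- move=> u; have [[n _ un]|nu] := pselect (vert (Phi_graph a) u); first by exists n.
  by exists 0%N.
exists n0 => n n0n u uN.
have un : (norm1 u < N)%N := ballv_norm1 (@sub_Phi a) uN.
have uP : vert (Phi_graph a) u.
  have [p pw _] := uN; apply: gwalk_vert pw; first exact: sub_Phi.
  by exists 0%N.
have um : vert (patch a n) u.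
  by apply: patch_vert_mono n0n _ _; apply: n0P => //; apply: mem_box; exact: ltnW.
split=> // v /[dup] uve /sub_Phi[u' [v' [u'G v'G + /set2_inj uvE]]] => u'v'.
have uv : adj u v by case: uvE => -[-> ->]; rewrite // adj_sym.
have vP : vert (Phi_graph a) v by case: uvE => -[_ ->].
apply: patch_full => //; apply: patch_vert_mono n0n _ _; apply: n0P => //; apply: mem_box.
have -> : v = u + (v - u) by rewrite addrC subrK.
by move: uv; rewrite adjE => /eqP uv; have := norm1D u (v - u); lia.
Qed.

Lemma kenyon_at_sub (p : Z2) : subgraph_Z2 (kenyon_at p).
Proof. exact: sub_full. Qed.

(** The tree is realized near the root by a translate whose code follows [a] for long and then turns
    by a right angle, which seals the patch of order [n]. *)
Lemma Phi_limit a N m : exists p : Z2, [/\ kvert p, coded a m (kenyon_at p) &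
  gball (Phi_graph a) N = gball (kenyon_at p) N].
Proof.
have [n0 n0P] := Phi_ball_patch a N.
pose n := maxn n0 m; have n0n : (n0 <= n)%N by rewrite leq_maxl.
(* The digit after [n] is a quarter turn, neither equal nor opposite to [a n]. Only the first
   outcome of [patch_confined] remains: no edge leads out of the next patch. *)
pose b : S4 := fun i => if (i <= n)%N then a i else inord ((a n + 1) %% 4).
have ab i : (i <= n)%N -> a i = b i by move=> i_n; rewrite /b i_n.
exists (- center b n.+2).
have pV : kvert (- center b n.+2) by exact/kvert_opp/kvert_center.
split => //.
  apply/codedP => // j jm; have jn : (j <= n)%N by apply: leq_trans jm (leq_maxr _ _).
  rewrite addrC (center_eq (b := b)); last by move=> i ij; apply: ab; lia.
  by apply: centerB_odd; lia.
apply: gball_ext; [exact: sub_Phi|exact: kenyon_at_sub|move=> u v uN].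
have [un uP] := n0P n n0n u uN; split=> [/uP|].
  rewrite (patch_eq (b := b)); last by move=> i i_n; exact/ab/ltnW.
  by apply: patch_center; lia.
move=> /full_edgeE[_ /= vV uv].
have un' : vert (patch b n) u by rewrite -(patch_eq (a := a)) // => i i_n; exact/ab/ltnW.
have perp : b n = a n /\ b n.+1 = inord ((a n + 1) %% 4) by rewrite -ab // /b ltnn.
have [|vn|bb|[_]] := patch_confined _ un' uv vV.
- by exists 0; rewrite addNr mul0rn.
- exists n.+1 => //; have E : patch b n.+1 = patch a n.+1.
    by apply: patch_eq => i i_n; rewrite ab.
  by rewrite E in vn; apply: patch_full => //; exact: patch_vertS.
- exfalso; move: bb; rewrite perp.1 perp.2 => /(congr1 val); rewrite /= inordK ?ltn_pmod //.
  by case: (a n) => -[|[|[|[|]]]].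
- rewrite perp.1 perp.2 /dir inordK ?ltn_pmod //.
  by case: (a n) => -[|[|[|[|]]]].
Qed.

Lemma Phi_is_limit a : limit_graph (Phi_graph a).
Proof. by move=> N; have [p [pV _ pN]] := Phi_limit a N 0; exists p. Qed.

Lemma Phi_coded a n : coded a n (Phi_graph a).
Proof.
have [p [pV pa pN]] := Phi_limit a (2 ^ n.+2) n.
exact: (coded_local (leqnn _) (esym pN)).
Qed.

(** The vertex [- p] would lie in some patch, at distance less than 2^n from [center a n]. By exact
    divisibility their difference is a nonzero multiple of 2^n. *)
Lemma Phi_not_shift a (p : Z2) : kvert p -> Phi_graph a <> kenyon_at p.
Proof.
move=> pV e; have : vert (Phi_graph a) (- p) by rewrite e /= subrr; exact: kvert0.
move=> [n _]; rewrite patch_block => -[_ pn].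
have ca := @Phi_coded a n; rewrite e in ca.
have [w wo wE] := (codedP a n pV).1 ca n (leqnn n).
move: pn; rewrite -opprD norm1N wE Z2mulrn.
have : norm1 w <> 0%N by move=> /norm1_eq0 w0; move: wo; rewrite w0.
by rewrite /norm1 /=; move: (2 ^ n)%N; nia.
Qed.

(** The code puts every patch in [G]. Conversely, an edge of [G] at a vertex of a patch is trapped
    at a later change of digit: its other end is in the next patch or is the next center. *)
Lemma limit_coded_Phi a G : in_Tspace G -> limit_graph G -> (forall n, coded a n G) ->
  nonconst a -> G = Phi_graph a.
Proof.
move=> [sG G0 cG _] lG aG ac.
have eG : edge (Phi_graph a) `<=` edge G.
  by move=> e [n _]; rewrite patch_block; apply: (aG n n (leqnn n)).1.
have out t t' : vert (Phi_graph a) t -> edge G [set t; t'] -> edge (Phi_graph a) [set t; t'].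
  move=> tP tt'; have [p pw] : reach G 0 t by apply: cG => //; exact: (edge_vert sG tt').1.
  have [n _ tn] := tP; have [j nj aj] := ac n.
  (* Large enough to see [t] and to read the code up to level [j.+2]. *)
  pose N := maxn (size p).+1 (2 ^ j.+4).
  have [q qV qN] := lG N.
  have tN : ballv G N t by exists p => //; rewrite leq_max ltnSn.
  have /full_edgeE[_ /= t'V tt] := gball_edge qN tN tt'.
  have ca : coded a j.+2 (kenyon_at q).
    by apply: coded_local qN (aG _); rewrite leq_max leqnn orbT.
  have [w wo wE] := (codedP _ _ qV).1 ca _ (leqnn _).
  have tj : vert (patch a j) t by exact: patch_vert_mono nj _ tn.
  exists j.+2 => //; apply: patch_full => //; first by do 2! apply: patch_vertS.
  have [|t'j| |[-> _]] := patch_confined _ tj tt t'V; [by exists w|exact: patch_vertS|by []|].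
  by rewrite patch_block /= subrr; split; [exact: kvert0|rewrite /norm1 expn_gt0].
have vG v : vert G v -> vert (Phi_graph a) v.
  move=> /(cG _ _ G0)[p [pp <-]]; have P0 : vert (Phi_graph a) 0 by exists 0%N.
  elim: p 0 P0 pp => //= x p IH u uP /andP[/asboolP ux pp].
  by apply: IH pp; exact: (edge_vert (@sub_Phi a) (out _ _ uP ux)).2.
have PG v : vert (Phi_graph a) v -> vert G v.
  move=> vP; have [_ _ cP _] := Phi_graphP a.
  have [p pw] : reach (Phi_graph a) 0 v by apply: cP => //; exists 0%N.
  exact: gwalk_vert sG G0 (gwalk_sub eG pw).
have E : vert G = vert (Phi_graph a) by apply/seteqP; split.
have E' : edge G = edge (Phi_graph a).
  apply/seteqP; split=> // e /[dup] eE /sG[u [v [uG vG' uv eE']]].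
  by rewrite eE'; apply: out; [exact: vG|rewrite -eE'].
by case: (G) (Phi_graph a) E E' => [? ?] [? ?] /= -> ->.
Qed.

(** A change of digit at [j] confines the ball to the patch of order [j.+2], for [a] and for every
    [b] sharing the first [j.+2] digits. *)
Lemma Phi_continuous a N : nonconst a -> exists M, forall b, (forall i, (i < M)%N -> a i = b i) ->
  gball (Phi_graph a) N = gball (Phi_graph b) N.
Proof.
move=> ac; have [n nP] := Phi_ball_patch a N.
have [j nj aj] := ac n; exists j.+2 => b ab.
apply: gball_ext; [exact: sub_Phi|exact: sub_Phi|move=> u v uN].
have [un uP] := nP n (leqnn n) u uN.
have E i : (i <= j.+2)%N -> patch a i = patch b i.
  by move=> ij; apply: patch_eq => l li; apply: ab; lia.
split=> [/uP uv|[L _ uv]]; first by exists n => //; rewrite -E //; lia.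
have jL : (j.+2 <= maxn L j.+2)%N by rewrite leq_maxr.
(* An edge of [Phi_graph b] lies in a patch, hence in a translate of T_infty, where [patch_confined]
   applies. *)
have := patch_center (leqnn (maxn L j.+2)) (patch_mono (leq_maxl _ _) uv).
move=> /full_edgeE[_ /= vV uv'].
have uj : vert (patch b j) u by rewrite -E; [exact: patch_vert_mono nj _ un|lia].
suff vj : vert (patch b j.+2) v.
  by exists j.+2 => //; rewrite E //; apply: patch_full => //; do 2! apply: patch_vertS.
have [|vj|ab'|[-> _]] := patch_confined _ uj uv' vV.
- by have [w _ wE] := centerB b jL; exists w; rewrite addrC.
- exact: patch_vertS.
- by case: aj; rewrite !ab.
- by rewrite patch_block /= subrr; split; [exact: kvert0|rewrite /norm1 expn_gt0].
Qed.

End local_structure.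

(** * Codes of limit trees, and valence against the parity of the root *)

Section coding_of_limits.
Implicit Types (u v w c p : Z2) (k : 'I_4) (n N : nat) (a b : S4) (G H : graph).

Lemma limit_coded_unique G a b n m i : limit_graph G -> coded a n G -> coded b m G ->
  (i < n)%N -> (i < m)%N -> a i = b i.
Proof.
move=> /(_ (maxn (2 ^ n.+2) (2 ^ m.+2)))[p pV pN] aG bG i_n im.
have ap := coded_local (leq_maxl _ _) pN aG.
have bp := coded_local (leq_maxr _ _) pN bG.
have mn : (i < minn n m)%N by rewrite leq_min i_n im.
by apply: coded_unique pV (coded_le _ ap) (coded_le _ bp) mn; rewrite (geq_minl, geq_minr).
Qed.

(** Codes valid to order [n] come from approximating translates and agree with each other by
    uniqueness, so they glue diagonally. *)
Lemma limit_coded_exists G :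
  (forall N, exists2 p, oddsum p & gball G N = gball (kenyon_at p) N) ->
  exists a, forall n, coded a n G.
Proof.
move=> lG; have lG' : limit_graph G.
  by move=> N; have [p po pN] := lG N; exists p => //; exact: kvert_oddsum.
have [A AP] : {A : nat -> S4 & forall n, coded (A n) n G}.
  apply: (@boolp.choice _ _ (fun n a => coded a n G)) => n; have [p po pN] := lG (2 ^ n.+2)%N.
  have [a ap] := coded_exists po; exists a.
  exact: coded_local (leqnn _) (esym pN) (ap n).
(* A code of order [n] determines only the digits below [n], so digit [i] is read from [A i.+1]. *)
exists (fun i => A i.+1 i) => n; apply: (coded_eq _ (AP n)) => i i_n.
exact: limit_coded_unique lG' (AP n) (AP i.+1) i_n (ltnSn i).
Qed.

Definition root_edges G : set (set Z2) := [set e | edge G e /\ e 0].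

Lemma root_edges_local G H N : (0 < N)%N -> gball G N = gball H N ->
  root_edges G = root_edges H.
Proof.
suff sub (G' H' : graph) : (0 < N)%N -> gball G' N = gball H' N -> root_edges G' `<=` root_edges H'.
  by move=> N0 GH; apply/seteqP; split; apply: sub.
move=> N0 GH e [eG e0]; have : edge (gball G' N) e.
  by split => //; exists 0; split => //; exists [::].
by rewrite GH => -[].
Qed.

Lemma root_edges_kenyon p : kvert p ->
  root_edges (kenyon_at p) = (fun k => [set 0; dir k]) @` [set k | kvert (p + dir k)].
Proof.
move=> pV; have adj0 v : adj 0 v -> exists k, v = dir k.
  by rewrite adjE subr0 => /eqP; exact: dir_exists.
apply/seteqP; split=> [_ [[u [v [/= uV vV uv ->]] e0]]|_ [k kV <-]].
- have [u0|v0] : 0 = u \/ 0 = v by case: e0 => ->; [left|right].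
  + rewrite -u0 in uv *; have [k kE] := adj0 _ uv; rewrite kE in vV *.
    by exists k.
  + rewrite -v0 adj_sym in uv *; have [k kE] := adj0 _ uv; rewrite kE in uV *.
    by exists k => //; rewrite setUC.
- split; last by left.
  apply/full_edgeE; rewrite /= addr0; split => //.
  by rewrite adjE subr0 -[dir k]mulr1n norm1_dir.
Qed.

(** The neighbours that change the even coordinate have two odd coordinates and are not vertices. *)
Lemma card_root_edges_odd p : oddsum p -> (#|` fset_set (root_edges (kenyon_at p)) | <= 2)%N.
Proof.
move=> po; rewrite root_edges_kenyon; last exact: kvert_oddsum.
set E := _ @` _; have fE : finite_set E by exact/finite_image/finite_finset.
have [k kP] : exists k, forall l, kvert (p + dir l) -> dir l = dir k \/ dir l = - dir k.
  have [p1|p1] := eqVneq (p.1 %% 2)%Z 1.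
  - exists (inord 0) => l lV; rewrite {2 4}/dir inordK //=.
    case: (dir_cases l) lV => -> lV; [by left| |by right|];
      by case: (kvert_odd_odd _ _ lV); move: po p1; rewrite /oddsum /=; lia.
  - exists (inord 1) => l lV; rewrite {2 4}/dir inordK //=.
    case: (dir_cases l) lV => -> lV; [|by left| |by right];
      by case: (kvert_odd_odd _ _ lV); move: po p1; rewrite /oddsum /=; lia.
apply: (@uniq_leq_size _ _ [:: [set 0; dir k]; [set 0; - dir k]]); first exact: fset_uniq.
move=> e; rewrite in_fset_set // inE => -[l /kP lk <-]; rewrite !inE.
by case: lk => ->; rewrite eqxx ?orbT.
Qed.

(** All four neighbours have odd sum, hence are vertices. *)
Lemma card_root_edges_even p : kvert p -> ~~ oddsum p ->
  (2 < #|` fset_set (root_edges (kenyon_at p)) |)%N.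
Proof.
move=> pV pe; rewrite root_edges_kenyon //.
have -> : [set k | kvert (p + dir k)] = [set: 'I_4].
  apply/seteqP; split=> // k _ /=; apply: kvert_oddsum.
  by move: pe; rewrite /oddsum; case: (dir_cases k) => -> /=; lia.
set f := fun k : 'I_4 => _; have f_inj : injective f.
  move=> k l /set2_inj[[_ /dir_inj]//|[_ e]].
  by move: (norm1_dir k 1); rewrite mulr1n e.
apply: (@leq_trans (size (map f (enum 'I_4)))); first by rewrite size_map size_enum_ord.
apply: uniq_leq_size; first by rewrite map_inj_uniq // enum_uniq.
move=> _ /mapP[k _ ->]; rewrite in_fset_set; last exact/finite_image/finite_finset.
by rewrite inE; exists k.
Qed.

End coding_of_limits.

(** * Topology of the space of trees and membership in X in terms of balls *)

Section limit_space.
Variable R : realType.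
Implicit Types (T : Tspace R) (S U : set (Tspace R)) (p : Z2) (n N : nat) (a b : S4).

Lemma Tdist_gball T T' N : Tdist T T' < expR (- N%:R) -> gball T N = gball T' N.
Proof.
rewrite /Tdist; case E : (agreement T T') => [r| |] /=.
- rewrite ltr_expR ltrN2 => Nr.
  have [//||M [_ NM MT]] := @agreement_gt _ T T' N%:R; first by rewrite E lte_fin.
  by apply: gball_le MT _; rewrite ltr_nat in NM; exact: ltnW.
- by move=> _; rewrite (agreement_eqy E).
- by have := agreement_ge0 T T'; rewrite E.
Qed.

Lemma gball_Tdist T T' N : (0 < N)%N -> gball T N = gball T' N -> Tdist T T' <= expR (- N%:R).
Proof.
move=> N0 NT; have : (N%:R%:E <= agreement T T')%E.
  by apply: ereal_sup_ubound; right; exists N.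
rewrite /Tdist; case: (agreement T T') => [r| |] //=.
by rewrite lee_fin ler_expR lerN2.
Qed.

Lemma nbhs_TspaceP T U : nbhs T U <-> exists N, forall T', gball T N = gball T' N -> U T'.
Proof.
split=> [/nbhs_ballP[e e0 eU]|[N NU]].
- pose N := (Num.truncn `|ln e|).+1; exists N => T' NT; apply: eU.
  rewrite /ball /= /ball_ /=; apply: le_lt_trans (gball_Tdist _ NT) _ => //.
  rewrite -[ltRHS]lnK // ltr_expR ltrNl.
  apply: le_lt_trans (_ : `|ln e| < _); first by rewrite ler_normr lexx orbT.
  exact: truncnS_gt.
- apply/nbhs_ballP; exists (expR (- N%:R)); first exact: expR_gt0.
  by move=> T' /Tdist_gball; exact: NU.
Qed.

(** Such sets are clopen, which makes their indicators test functions for the weak limit. *)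
Definition gball_local S : Prop :=
  exists N, forall T T', gball T N = gball T' N -> S T -> S T'.

Lemma gball_local_open S : gball_local S -> open S.
Proof. by move=> [N SN]; rewrite openE => T TS; apply/nbhs_TspaceP; exists N => T' NT; exact: SN TS. Qed.

Lemma gball_local_measurable S : gball_local S -> measurable S.
Proof. by move=> /gball_local_open oS; exact: sub_sigma_algebra. Qed.

Lemma open_measurable_Tspace S : open S -> measurable S.
Proof. by move=> oS; exact: sub_sigma_algebra. Qed.

Lemma closed_measurable_Tspace S : closed S -> measurable S.
Proof.
move=> cS; rewrite -[S]setCK; apply: measurableC; apply: open_measurable_Tspace. by rewrite openC.
Qed.

Lemma in_Tspace_shift G v : in_Tspace G -> vert G v -> in_Tspace (gshift (- v) G).
Proof.
move=> [sG G0 cG iG] vG; split.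
- exact: sub_gshift.
- by exists v; rewrite // subrr.
- apply: (star_connected (c := v - v)).
  by apply: (@star_gmap (fun u => u - v)); exact: connected_star.
- apply: contra_not iG => /(@finite_image _ _ _ (fun u => u + v)).
  apply: sub_finite_set => u uG; exists (u - v); last exact: subrK.
  by exists u.
Qed.

Lemma kvert_graph p : kvert p <-> vert kenyon_graph p.
Proof. by rewrite kenyon_graphE. Qed.

Definition kenyon_T p (pV : kvert p) : Tspace R :=
  MkTspace _ (in_Tspace_shift kenyon_graphP ((kvert_graph p).1 pV)).

Lemma kenyon_TE p (pV : kvert p) : tgraph (kenyon_T pV) = kenyon_at p.
Proof. exact: gshift_kenyon. Qed.

Lemma orbitP T : Trel R (T_infty R) T <-> exists2 p, kvert p & tgraph T = kenyon_at p.
Proof.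
split=> [[p pV ->]|[p pV TE]].
  by exists p; [exact/kvert_graph|exact: gshift_kenyon].
by exists p; [exact/kvert_graph|rewrite TE /= gshift_kenyon].
Qed.

Lemma XsetP T : Xset R T <-> limit_graph T.
Proof.
split=> [TX N|lT U /nbhs_TspaceP[N NU]].
- have [|T' [/orbitP[p pV TE] NT]] := TX [set T' | gball T N = gball T' N].
    by apply/nbhs_TspaceP; exists N.
  by exists p; rewrite // -TE.
- have [p pV pN] := lT N; exists (kenyon_T pV); split.
    by apply/orbitP; exists p; rewrite // kenyon_TE.
  by apply: NU; rewrite kenyon_TE.
Qed.

(** Valence at most 2 means that the approximating translates have a root of odd sum, and this is
    exactly what starts a code. *)
Lemma valenceP T : Xset R T -> (valence T <= 2)%N <-> exists a, forall n, coded a n T.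
Proof.
move=> /XsetP lT; have val p N : (0 < N)%N -> gball T N = gball (kenyon_at p) N ->
    valence T = #|` fset_set (root_edges (kenyon_at p)) |.
  by move=> N0 NT; rewrite -(root_edges_local N0 NT).
split=> [T2|[a aT]].
- apply: limit_coded_exists => N; have [p pV pN] := lT N.+1.
  exists p; last exact: gball_le pN (leqnSn N).
  apply: contraTT T2 => pe.
  by rewrite -ltnNge (val p N.+1) // card_root_edges_even.
- have [p pV pN] := lT (2 ^ 2)%N; rewrite (val p _ _ pN) //; apply: card_root_edges_odd.
  by apply: (@coded_oddsum p a 0) => //; exact: coded_local (leqnn _) pN (aT 0%N).
Qed.

Lemma Phi_in_X a : Xset R (Phi R a).
Proof. exact/XsetP/Phi_is_limit. Qed.

Lemma Phi_in_Y2 a : Y2set R (Phi R a).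
Proof.
split; last by apply: (valenceP (@Phi_in_X a)).2; exists a => n; exact: Phi_coded.
by split; [exact: Phi_in_X|move=> /orbitP[p /Phi_not_shift]; apply].
Qed.

Lemma Y2set_coded T : Y2set R T -> exists a, forall n, coded a n T.
Proof. by move=> [[TX _] T2]; exact: (valenceP TX).1 T2. Qed.

Lemma coded_in_Y2 T a : Xset R T -> ~ Trel R (T_infty R) T -> (forall n, coded a n T) -> Y2set R T.
Proof. by move=> TX nT aT; split => //; apply: (valenceP TX).2; exists a. Qed.

Lemma coded_gball_local a n : gball_local [set T | coded a n T].
Proof. by exists (2 ^ n.+2)%N => T T' NT /= h; exact: coded_local (leqnn _) NT h. Qed.

Lemma blockin_gball_local c n : vert (block c n) 0 -> gball_local [set T | blockin c n T].
Proof. by move=> c0; exists (2 ^ n.+1)%N => T T' NT /= h; exact: blockin_local c0 (leqnn _) NT h. Qed.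

Lemma Xset_closed : closed (Xset R).
Proof. exact: closed_closure. Qed.

End limit_space.

(** * Frequencies *)

Section counting.
Variable R : realType.
Implicit Types (T : Tspace R) (S : set (Tspace R)) (u v w c p q : Z2) (n m N : nat) (a b : S4).

(** Equality makes [q - p] divisible by a power of 2 exceeding its norm. Hence counting trees in the
    orbit amounts to counting base points. *)
Lemma kenyon_at_inj p q : kvert p -> kvert q -> kenyon_at p = kenyon_at q -> p = q.
Proof.
move=> pV qV pq; have qpV : kvert (q + - p).
  by have : vert (kenyon_at p) (- p) by [rewrite /= subrr; exact: kvert0]; rewrite pq.
have : blockin (- p) (norm1 (q - p)) (kenyon_at q).
  rewrite -pq; apply/blockinP; rewrite subrr; first exact: kvert0.
  by exists 0; [exact: kvert0|rewrite mul0rn].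
move=> /(blockinP _ qpV)[w _ wE].
have : (norm1 (q - p)%R < 2 ^ norm1 (q - p)%R)%N by exact: ltn_expl.
rewrite {1}wE Z2mulrn => h; apply/esym/subr0_eq; rewrite wE.
have -> : w = 0; last by rewrite mul0rn.
by apply: norm1_eq0; move: h; rewrite /norm1 /=; move: (2 ^ _)%N => k; nia.
Qed.

(** Made total, with a default tree off the vertices, so as to be mapped over lists of points. *)
Definition treeat p : Tspace R :=
  if pselect (kvert p) is left pV then kenyon_T R pV else point.

Lemma norm1Mn v n : norm1 (v *+ n) = (norm1 v * n)%N.
Proof. by rewrite Z2mulrn /norm1 /= !abszM absz_nat mulnDl. Qed.

Lemma treeatE p : kvert p -> tgraph (treeat p) = kenyon_at p.
Proof. by rewrite /treeat; case: pselect => // pV _; rewrite kenyon_TE. Qed.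

Lemma treeat_X p : kvert p -> Xset R (treeat p).
Proof. by move=> pV; apply/XsetP => N; exists p; rewrite ?treeatE. Qed.

Lemma ball_orbitE N : @ball_orbit R N = treeat @` ballv kenyon_graph N.
Proof.
have bV p : ballv kenyon_graph N p -> kvert p.
  by move=> /(@ballv_vert _ (T_infty R)) pV; exact/kvert_graph.
apply/seteqP; split=> [T [p pN TE]|_ [p pN <-]].
- exists p => //; apply: Tspace_eq; rewrite TE treeatE ?gshift_kenyon //; exact: bV pN.
- by exists p; rewrite // treeatE ?gshift_kenyon //; exact: bV pN.
Qed.

Lemma ballv_kenyon_norm1 N p : ballv kenyon_graph N p -> kvert p /\ (norm1 p < N)%N.
Proof.
move=> pN; split; last by apply: ballv_norm1 pN; rewrite kenyon_graphE; exact: sub_full.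
by apply/kvert_graph; exact: (@ballv_vert _ (T_infty R)) pN.
Qed.

Lemma ballv_kenyon n N p : kvert p -> (norm1 p < 2 ^ n)%N -> (2 ^ n <= N)%N -> ballv kenyon_graph N p.
Proof.
move=> pV pn nN; have [s sw sn] := block_walk0 pV pn.
exists s; last exact: leq_trans nN.
by rewrite kenyon_graphE; apply: gwalk_sub sw; apply: full_graphS => v /=; rewrite subr0 => -[].
Qed.

Lemma finite_ball_orbit N : finite_set (@ball_orbit R N).
Proof.
rewrite ball_orbitE; apply: finite_image; apply: (@sub_finite_set _ _ [set` box N]); last exact: finite_seq.
by move=> p /ballv_kenyon_norm1[_ pN]; exact: mem_box.
Qed.

Definition ball_seq N : seq (Tspace R) := fset_set (@ball_orbit R N).

Lemma mem_ball_seq N T : (T \in ball_seq N) = (T \in @ball_orbit R N).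
Proof. by rewrite -(in_fset_set (finite_ball_orbit N)). Qed.

Lemma mu_ballE N S : mu_ball R N S =
  ((count (fun T => T \in S) (ball_seq N))%:R / (size (ball_seq N))%:R)%:E.
Proof.
rewrite /mu_ball /= /uniform_on /mscale /= /msum -/(ball_seq N).
rewrite (eq_bigr (fun i : 'I_ _ => ((nth point (ball_seq N) i \in S)%:R)%:E)); last first.
  by move=> i _; exact: diracE.
rewrite sumEFin -EFinM mulrC; congr (_ * _)%:E.
rewrite -(big_mkord xpredT (fun i => (nth point (ball_seq N) i \in S)%:R)) -(big_nth point xpredT (fun T => (T \in S)%:R)).
by rewrite -natr_sum -sum1_count [in RHS]big_mkcond; congr _%:R; apply: eq_bigr => T _; case: (_ \in _).
Qed.

(* [x + y] and [x - y] range independently over the odd numbers of absolute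
   value less than [2 ^ n]; for [n = 0] this is the junk list [[:: 0]]. *)
Definition odd_diamond n : seq Z2 :=
  [seq (i%:Z + j%:Z + 1 - (2 ^ n)%N%:Z, i%:Z - j%:Z) | i <- iota 0 (2 ^ n), j <- iota 0 (2 ^ n)].

Lemma odd_diamondP n w : (0 < n)%N -> w \in odd_diamond n -> oddsum w /\ (norm1 w < 2 ^ n)%N.
Proof.
move=> n0 /allpairsP[[i j]]; rewrite !mem_iota /= !add0n => -[i_n jn ->].
have : (2 ^ n = 2 * 2 ^ n.-1)%N by rewrite -expnS prednK.
by rewrite /oddsum /norm1 /=; move: (2 ^ n)%N (2 ^ n.-1)%N i_n jn => M M'; split; lia.
Qed.

Lemma uniq_odd_diamond n : uniq (odd_diamond n).
Proof.
apply: allpairs_uniq; rewrite ?iota_uniq // => -[i j] [i' j'] _ _ /= [].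
by move=> e1 e2; congr pair; lia.
Qed.

Lemma size_odd_diamond n : size (odd_diamond n) = (4 ^ n)%N.
Proof. by rewrite size_allpairs !size_iota -expnMn. Qed.

(* The ball of radius [N] contains the [4 ^ n] points of [odd_diamond n] and is
   contained in [box (2 ^ n.+1)], hence the constants 16 and 64 below. *)
Section bounds.
Variables (n N : nat) (nN : (2 ^ n <= N < 2 ^ n.+1)%N).

Let nN1 : (2 ^ n <= N)%N. Proof. by case/andP: nN. Qed.

Lemma ball_seqP p : kvert p -> (norm1 p < 2 ^ n)%N -> treeat p \in ball_seq N.
Proof.
move=> pV pn; rewrite mem_ball_seq inE ball_orbitE; exists p => //.
exact: ballv_kenyon nN1.
Qed.

Lemma ball_seq_treeat T : T \in ball_seq N ->
  exists p, [/\ kvert p, (norm1 p < 2 ^ n.+1)%N & T = treeat p].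
Proof.
rewrite mem_ball_seq inE ball_orbitE => -[p /ballv_kenyon_norm1[pV pN] <-].
by exists p; split => //; apply: ltn_trans pN _; case/andP: nN.
Qed.

Lemma uniq_map_treeat (s : seq Z2) : uniq s -> (forall p, p \in s -> kvert p) -> uniq (map treeat s).
Proof.
move=> us sV; rewrite map_inj_in_uniq // => p q /sV pV /sV qV pq.
by apply: kenyon_at_inj => //; rewrite -!treeatE // pq.
Qed.

Lemma size_ball_seq : (0 < n)%N -> (4 ^ n <= size (ball_seq N) <= 16 * 4 ^ n)%N.
Proof.
move=> n0; apply/andP; split.
  rewrite -size_odd_diamond -(size_map treeat); apply: uniq_leq_size.
    apply: uniq_map_treeat; first exact: uniq_odd_diamond.
    by move=> p /(odd_diamondP n0)[po _]; exact: kvert_oddsum.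
  move=> _ /mapP[p /(odd_diamondP n0)[po pn] ->].
  by apply: ball_seqP => //; exact: kvert_oddsum.
apply: (@leq_trans (size (map treeat (box (2 ^ n.+1))))).
  apply: uniq_leq_size; first exact: fset_uniq.
  by move=> T /ball_seq_treeat[p [_ pn ->]]; apply: map_f; exact: mem_box.
by rewrite size_map size_box expnAC (expnS (2 ^ 2)) mulnA.
Qed.

(** For positive [m], [p + c] is [q *+ 2 ^ m] with [norm1 q] below 2^(n+2-m), which leaves at most 4
    * 4^(n+2-m) values of [q]. For [m = 0] the total count is bound enough. *)
Lemma count_blockin c m : (norm1 c < 2 ^ m)%N -> (m <= n)%N ->
  (count (fun T => T \in [set T : Tspace R | blockin c m T] `&` Xset R) (ball_seq N) * 4 ^ m <= 64 * size (ball_seq N))%N.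
Proof.
move=> cm mn; case: m mn cm => [|m] mn cm.
  by rewrite expn0 muln1 (leq_trans (count_size _ _)) // leq_pmull.
apply: (@leq_trans (64 * 4 ^ n)); last by rewrite leq_pmul2l //; case/andP: (size_ball_seq (leq_trans (ltn0Sn m) mn)).
pose L := [seq treeat (q *+ 2 ^ m.+1 - c) | q <- box (2 ^ (n.+2 - m.+1))].
have LE : (size L * 4 ^ m.+1 = 64 * 4 ^ n)%N.
  rewrite size_map size_box expnAC -mulnA -expnD subnK; last by rewrite !leqW.
  by rewrite !expnS !mulnA.
rewrite -LE leq_pmul2r ?expn_gt0 // -size_filter; apply: uniq_leq_size.
  by apply: filter_uniq; exact: fset_uniq.
move=> T; rewrite mem_filter => /andP[+ /ball_seq_treeat[p [pV pn TE]]].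
rewrite inE => -[/= + _]; rewrite TE treeatE // => cb.
have [q _ qE] := (blockinP m.+1 (blockin_center cb)).1 cb.
apply/mapP; exists q; last by rewrite -qE addrK.
apply: mem_box; have : (norm1 (p + c)%R < 2 ^ n.+2)%N.
  have : (2 ^ m.+1 <= 2 ^ n.+1)%N by rewrite leq_exp2l //; exact: leqW.
  by have := norm1D p c; rewrite (expnS 2 n.+1); lia.
rewrite qE norm1Mn.
have -> : (2 ^ n.+2 = 2 ^ (n.+2 - m.+1) * 2 ^ m.+1)%N by rewrite -expnD subnK // !leqW.
by rewrite ltn_pmul2r // expn_gt0.
Qed.

(** The points [w *+ 2 ^ m - center a m], with [w] in the odd diamond of order [n - m], all carry
    this code: earlier centers differ from [center a m] by exact multiples of smaller powers. Their
    norm is less than (norm1 w + 1) * 2^m, hence less than 2^n. *)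
Lemma count_coded a m : (m < n)%N ->
  (size (ball_seq N) <= 16 * 4 ^ m * count (fun T => T \in [set T : Tspace R | coded a m T] `&` Xset R) (ball_seq N))%N.
Proof.
move=> m_n; have mn := ltnW m_n; have nm0 : (0 < n - m)%N by rewrite subn_gt0.
apply: (@leq_trans (16 * 4 ^ n)); first by case/andP: (size_ball_seq (leq_trans (ltn0Sn m) m_n)).
pose f w := w *+ 2 ^ m - center a m.
pose L := map treeat (map f (odd_diamond (n - m))).
have -> : (16 * 4 ^ n = 16 * 4 ^ m * size L)%N.
  by rewrite !size_map size_odd_diamond -mulnA -expnD subnKC.
rewrite leq_pmul2l ?muln_gt0 ?expn_gt0 // -size_filter.
have fV w : oddsum w -> kvert (f w).
  move=> wo; apply/kvert_near; [exact: kvert_oddsum|by rewrite norm1N norm1_center|].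
  exact/kvert_opp/kvert_center.
apply: uniq_leq_size.
  apply: uniq_map_treeat; last by move=> _ /mapP[w /(odd_diamondP nm0)[wo _] ->]; exact: fV.
  by rewrite map_inj_uniq ?uniq_odd_diamond // => w w' /addIr/mulrn_inj2.
move=> _ /mapP[_ /mapP[w /(odd_diamondP nm0)[wo wn] ->] ->].
have fwV := fV w wo; rewrite mem_filter ball_seqP // ?andbT; last first.
  have h1 := norm1_center a m; have := norm1D (w *+ 2 ^ m) (- center a m).
  rewrite -/(f w) norm1N norm1Mn => h2.
  have -> : (2 ^ n = 2 ^ (n - m) * 2 ^ m)%N by rewrite -expnD subnK.
  apply: leq_ltn_trans h2 _; apply: (@leq_trans (norm1 w * 2 ^ m + 2 ^ m)%N).
    by rewrite ltn_add2l.
  by rewrite -mulSnr leq_mul2r wn orbT.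
rewrite inE; split; last exact: treeat_X.
rewrite /= treeatE //; apply/codedP => // j jm.
have -> : f w + center a j = w *+ 2 ^ m + (center a j - center a m).
  by rewrite /f addrAC addrA.
have [jm'|mj] := ltnP j m; last first.
  have -> : j = m by apply/eqP; rewrite eqn_leq jm.
  by exists w; rewrite // subrr addr0.
have [w' w'o ->] := centerB_odd a jm'.
exists (w *+ 2 ^ (m - j) + w'); last by rewrite mulrnDl -mulrnA -expnD subnK.
have -> : (m - j = (m - j).-1.+1)%N by rewrite prednK // subn_gt0.
by move: w'o; rewrite expnSr mulrnA Z2mulrn /oddsum /=; lia.
Qed.

End bounds.

End counting.

(** * Two criteria for null sets *)

Section null_sets.
Variable R : realType.

Lemma geometric_bound0 (x : R) (m0 : nat) : 0 <= x ->
  (forall m, (m0 <= m)%N -> x <= 64 / 4 ^+ m) -> x = 0.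
Proof.
move=> x0 xm; apply/eqP; rewrite eq_le x0 andbT leNgt; apply/negP => xpos.
pose m := maxn m0 (Num.truncn (64 / x)).+1.
have := xm m (leq_maxl _ _); apply/negP; rewrite -ltNge.
rewrite ltr_pdivrMr ?exprn_gt0 // mulrC -ltr_pdivrMr //.
apply: (@lt_le_trans _ _ (Num.truncn (64 / x)).+1%:R); first exact: truncnS_gt.
rewrite -natrX ler_nat; apply: (@leq_trans m); first exact: leq_maxr.
by apply: ltnW; exact: ltn_expl.
Qed.

Lemma countable_negligible d (T : measurableType d) (mu : {measure set T -> \bar R})
  (I : countType) (F : I -> set T) : (forall i, mu.-negligible (F i)) ->
  mu.-negligible (\bigcup_i F i).
Proof.
move=> F0; pose G n := if choice.unpickle n is Some i then F i else set0.
apply: (@negligibleS _ _ _ _ (\bigcup_n G n)).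
  by move=> x [i _ Fx]; exists (choice.pickle i) => //; rewrite /G choice.pickleK.
apply: negligible_bigcup => n; rewrite /G; case: choice.unpickle => [i|] //.
exact: negligible_set0.
Qed.

End null_sets.

(** * Bounds that pass to the weak limit, and their null sets *)

Section weak_limits.
Variables (R : realType) (mu : probability (Tspace R) R) (s : nat -> nat).
Hypotheses (s_subseq : {homo s : m n / (m < n)%N})
  (mu_lim : weak_limit (fun k => mu_ball R (s k)) mu).
Implicit Types (S : set (Tspace R)) (c p : Z2) (n m N : nat) (a b : S4).

Let s_ge k : (k <= s k)%N.
Proof.
elim: k => // k IH; apply: leq_ltn_trans IH _; exact: s_subseq.
Qed.

Lemma measurable_Xset : measurable (Xset R).
Proof. by apply: closed_measurable_Tspace; exact: Xset_closed. Qed.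

Lemma continuous_indic_local S : gball_local S -> continuous (\1_S : Tspace R -> R).
Proof.
move=> [N SN] T U /nbhs_singleton UT.
suff : nbhs T ((\1_S : _ -> R) @^-1` U) by [].
apply/nbhs_TspaceP; exists N => T' NT /=; suff -> : \1_S T' = \1_S T :> R by [].
rewrite !indicE; suff -> : (T' \in S) = (T \in S) by [].
by apply/idP/idP; rewrite !inE; [exact: SN (esym NT)|exact: SN NT].
Qed.

(** The indicator of a set read off a ball is continuous, so weak convergence applies to it. *)
Lemma local_cvg S : gball_local S ->
  fine (mu_ball R (s k) (S `&` Xset R)) @[k --> \oo] --> fine (mu (S `&` Xset R)).
Proof.
move=> lS; have E (nu : {measure set (Tspace R) -> \bar R}) :
    Rintegral nu (Xset R) (\1_S : _ -> R) = fine (nu (S `&` Xset R)).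
  rewrite /Rintegral integral_indic //; first exact: measurable_Xset.
  exact: gball_local_measurable.
have := mu_lim (continuous_subspaceT (continuous_indic_local lS)).
by rewrite E; under eq_fun do rewrite E.
Qed.

Let scale k m : (2 ^ m.+1 <= k)%N ->
  exists n, (m < n)%N /\ (2 ^ n <= s k < 2 ^ n.+1)%N.
Proof.
move=> mk; have ks := leq_trans mk (s_ge k).
have s0 : (0 < s k)%N by apply: leq_trans ks; rewrite expn_gt0.
have /andP[h1 h2] := trunc_log_bounds (isT : (1 < 2)%N) s0.
exists (trunc_log 2 (s k)); rewrite h1 h2; split => //.
have : (2 ^ m.+1 < 2 ^ (trunc_log 2 (s k)).+1)%N by exact: leq_ltn_trans h2.
by rewrite ltn_exp2l.
Qed.

Let fineE S : measurable S -> mu S = (fine (mu S))%:E.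
Proof. by move=> mS; rewrite fineK // fin_num_measure. Qed.

Lemma mu_blockin c m : vert (block c m) 0 ->
  (mu ([set T : Tspace R | blockin c m T] `&` Xset R) <= (64 / 4 ^+ m)%:E)%E.
Proof.
move=> c0; set S := [set T : Tspace R | _].
have cm : (norm1 c < 2 ^ m)%N by have [_] := c0; rewrite sub0r norm1N.
have lS : gball_local S by exact: blockin_gball_local.
rewrite fineE ?lee_fin; last first.
  by apply: measurableI; [exact: gball_local_measurable|exact: measurable_Xset].
apply: (closed_cvg (fun x : R => x <= 64 / 4 ^+ m) _ _ _ (local_cvg lS)).
  exact: closed_le.
exists (2 ^ m.+1)%N => // k /= mk; have [n [mn nk]] := scale mk.
rewrite mu_ballE /=; have := count_blockin R nk cm (ltnW mn).
set C := count _ _; set L := size _ => CL.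
have L0 : (0 < L)%N.
  have /andP[h _] := size_ball_seq R nk (leq_ltn_trans (leq0n m) mn).
  by apply: leq_trans h; rewrite expn_gt0.
rewrite ler_pdivrMr ?ltr0n // mulrAC ler_pdivlMr ?exprn_gt0 //.
by rewrite -natrX -!natrM ler_nat.
Qed.

Lemma mu_coded a m :
  ((1 / (16 * 4 ^+ m))%:E <= mu ([set T : Tspace R | coded a m T] `&` Xset R))%E.
Proof.
set S := [set T : Tspace R | _].
have lS : gball_local S by exact: coded_gball_local.
rewrite fineE ?lee_fin; last first.
  by apply: measurableI; [exact: gball_local_measurable|exact: measurable_Xset].
apply: (closed_cvg (fun x : R => 1 / (16 * 4 ^+ m) <= x) _ _ _ (local_cvg lS)).
  exact: closed_ge.
exists (2 ^ m.+1)%N => // k /= mk; have [n [mn nk]] := scale mk.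
rewrite mu_ballE /=; have := count_coded R nk a mn.
set C := count _ _; set L := size _ => CL.
have L0 : (0 < L)%N.
  have /andP[h _] := size_ball_seq R nk (leq_ltn_trans (leq0n m) mn).
  by apply: leq_trans h; rewrite expn_gt0.
rewrite ler_pdivlMr ?ltr0n // mulrAC mul1r ler_pdivrMr ?mulr_gt0 ?exprn_gt0 //.
by rewrite -natrX -!natrM ler_nat mulnC.
Qed.

(** A set whose trees all contain a common block of each large order has measure at most 64 / 4^m
    for all large [m]. *)
Lemma mu_null S (c : nat -> Z2) : (exists m0, forall m, (m0 <= m)%N ->
    vert (block (c m) m) 0 /\ S `<=` [set T : Tspace R | blockin (c m) m T] `&` Xset R) ->
  mu.-negligible S.
Proof.
move=> [m0 m0P]; exists (\bigcap_(m in [set m | (m0 <= m)%N])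
  ([set T : Tspace R | blockin (c m) m T] `&` Xset R)).
have mB m : (m0 <= m)%N -> measurable ([set T : Tspace R | blockin (c m) m T] `&` Xset R).
  move=> /m0P[c0 _]; apply: measurableI; last exact: measurable_Xset.
  by apply: gball_local_measurable; exact: blockin_gball_local.
have mI : measurable (\bigcap_(m in [set m | (m0 <= m)%N])
    ([set T : Tspace R | blockin (c m) m T] `&` Xset R)).
  apply: bigcap_measurable; first by exists m0; rewrite /= leqnn.
  by move=> m /mB.
split=> //; last by move=> T ST m mm; exact: (m0P m mm).2.
rewrite fineE //; congr _%:E; apply: (@geometric_bound0 _ _ m0).
  exact: fine_ge0.
move=> m mm; rewrite -lee_fin -fineE //; apply: le_trans (mu_blockin (m0P m mm).1).
by apply: le_measure; rewrite ?inE //; [exact: mB|exact: bigcap_inf].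
Qed.

(** The orbit is countable, and [kenyon_at p] contains the blocks of all orders about [- p], the
    former origin. *)
Lemma orbit_negligible : mu.-negligible [set T | Trel R (T_infty R) T].
Proof.
apply: (@negligibleS _ _ _ _ (\bigcup_p [set T : Tspace R | kvert p /\ tgraph T = kenyon_at p])).
  by move=> T /orbitP[p pV TE]; exists p.
apply: countable_negligible => p; have [pV|nV] := pselect (kvert p); last first.
  by apply: (@negligibleS _ _ _ _ set0); [move=> T []|exact: negligible_set0].
apply: (@mu_null _ (fun _ => - p)).
exists (norm1 p) => m pm; split.
  rewrite /= sub0r opprK; split => //.
  by apply: leq_ltn_trans pm _; exact: ltn_expl.
move=> T [_ TE]; split; last by apply/XsetP => N; exists p; rewrite // TE.
rewrite /= TE; apply/blockinP; rewrite subrr; first exact: kvert0.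
by exists 0; [exact: kvert0|rewrite mul0rn].
Qed.

Lemma coded_negligible a : mu.-negligible [set T | Xset R T /\ forall n, coded a n T].
Proof.
apply: (@mu_null _ (center a)); exists 0%N => m _; split; first exact: center_block.
by move=> T [TX aT]; split => //; exact: (aT m m (leqnn m)).1.
Qed.

End weak_limits.

(** * Measures on sequences *)

Definition cyl (a : S4) (n : nat) : set S4 := [set b | forall i, (i < n)%N -> b i = a i].

Definition determined (A : set S4) : Prop :=
  exists n, forall a b, (forall i, (i < n)%N -> b i = a i) -> A a -> A b.

Section sequences.
Implicit Types (a b : S4) (n : nat) (A B U : set S4).

Lemma cyl_refl a n : cyl a n a. Proof. by []. Qed.

Lemma cyl_le a n m : (n <= m)%N -> cyl a m `<=` cyl a n.
Proof. by move=> nm b ab i i_n; apply: ab; exact: leq_trans nm. Qed.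

Let coord_open (k : 'I_4) i : open [set b : S4 | b i = k].
Proof.
rewrite openE => b <-.
apply: (@proj_continuous nat (fun=> discrete_topology 'I_4) i b [set b i]).
exact: discrete_set1.
Qed.

Lemma cyl_open a n : open (cyl a n).
Proof.
elim: n => [|n IH].
  by rewrite (_ : cyl a 0 = setT); [exact: openT|apply/seteqP].
rewrite (_ : cyl a n.+1 = cyl a n `&` [set b | b n = a n]).
  by apply: openI; [exact: IH|exact: coord_open].
apply/seteqP; split=> [b ab|b [ab abn] i].
  by split; [exact: cyl_le ab|exact: ab].
by rewrite ltnS leq_eqVlt => /predU1P[->//|]; exact: ab.
Qed.

Lemma open_cyl U a : open U -> U a -> exists n, cyl a n `<=` U.
Proof.
move=> oU Ua; pose F : set_system S4 := filter_from setT (cyl a).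
have FF : Filter F.
  apply: filter_from_filter; first by exists 0%N.
  move=> i j _ _; exists (maxn i j) => // b ab.
  by split; [apply: cyl_le ab; exact: leq_maxl|apply: cyl_le ab; exact: leq_maxr].
have Fa : F --> a.
  apply/cvg_sup => i V [W [[C oC <-] Ca] WV].
  by exists i.+1 => // b ab; apply: WV; rewrite /= ab.
by have [|n _ nU] := Fa U; [exact: open_nbhs_nbhs|exists n].
Qed.

Lemma determined_open A : determined A -> open A.
Proof.
move=> [n nA]; rewrite openE => a Aa; apply: (@filterS _ _ _ (cyl a n)).
  by move=> b ab; apply: nA Aa.
by apply: open_nbhs_nbhs; split; [exact: cyl_open|exact: cyl_refl].
Qed.

Lemma open_measurable_S4 U : open U -> measurable U.
Proof. by move=> oU; exact: sub_sigma_algebra. Qed.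

Lemma determined_measurable A : determined A -> measurable A.
Proof. by move=> /determined_open/open_measurable_S4. Qed.

Lemma cyl_measurable a n : measurable (cyl a n).
Proof. by apply: open_measurable_S4; exact: cyl_open. Qed.

Lemma determinedC A : determined A -> determined (~` A).
Proof.
move=> [n nA]; exists n => a b ab nAa Ab; apply: nAa; apply: nA Ab => i i_n.
by rewrite ab.
Qed.

Lemma determinedU A B : determined A -> determined B -> determined (A `|` B).
Proof.
move=> [n nA] [m mB]; exists (maxn n m) => a b ab [Aa|Ba]; [left|right].
- by apply: nA Aa => i i_n; apply: ab; rewrite leq_max i_n.
- by apply: mB Ba => i im; apply: ab; rewrite leq_max im orbT.
Qed.

(** The [n]-th set is the union of the cylinders of length [n] contained in [U]. *)
Lemma open_bigcup_determined U : open U ->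
  exists2 F : nat -> set S4, (forall n, determined (F n)) & U = \bigcup_n F n.
Proof.
move=> oU; exists (fun n => [set a | cyl a n `<=` U]).
  move=> n; exists n => a b ab aU c bc; apply: aU => i i_n.
  by rewrite bc // ab.
apply/seteqP; split=> [a Ua|a [n _]]; last by apply; exact: cyl_refl.
by have [n nU] := open_cyl oU Ua; exists n.
Qed.

Lemma uniform_cyl (R : realType) (mu4 : probability S4 R) a n :
  uniform_product mu4 -> mu4 (cyl a n) = (4 ^- n)%:E.
Proof.
move=> /(_ n (fun i => [set a i]%SET)); under eq_bigr do rewrite cards1.
rewrite prodr_const card_ord div1r exprVn => <-; congr (mu4 _).
by apply/seteqP; split=> b ab i /ab; rewrite inE => /eqP.
Qed.

End sequences.

(** * Comparison of finite measures on sequences *)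

Section finite_measure_add.
Context d (T : measurableType d) (R : realType) (m1 m2 : {finite_measure set T -> \bar R}).

Let measure_add_fin : fin_num_fun (measure_add m1 m2).
Proof. by move=> A mA; rewrite measure_addE fin_numD !fin_num_measure. Qed.

HB.instance Definition _ := Measure.on (measure_add m1 m2).

HB.instance Definition _ := Measure_isFinite.Build _ _ _ (measure_add m1 m2) measure_add_fin.

End finite_measure_add.

Section comparison.
Variable R : realType.
Implicit Types (A B : set S4) (m : {finite_measure set S4 -> \bar R}).

Definition sdiff A B := (A `\` B) `|` (B `\` A).

Lemma sdiff_measurable A B : measurable A -> measurable B -> measurable (sdiff A B).
Proof. by move=> mA mB; apply: measurableU; exact: measurableD. Qed.

Definition approximable m A := measurable A /\
  forall e : R, 0 < e -> exists2 B, determined B & (m (sdiff A B) < e%:E)%E.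

Lemma determined_approximable m A : determined A -> approximable m A.
Proof.
move=> dA; split; first exact: determined_measurable.
move=> e e0; exists A => //.
by rewrite /sdiff setDv setU0 measure0 lte_fin.
Qed.

Lemma approximableC m A : approximable m A -> approximable m (~` A).
Proof.
move=> [mA Ae]; split; first exact: measurableC.
move=> e /Ae[B dB Be]; exists (~` B); first exact: determinedC.
by rewrite (_ : sdiff _ _ = sdiff A B) // /sdiff !setDE !setCK setUC setIC [B `&` _]setIC.
Qed.

Lemma approximableU m A B : approximable m A -> approximable m B -> approximable m (A `|` B).
Proof.
move=> [mA Ae] [mB Be]; split; first exact: measurableU.
move=> e e0; have e2 : 0 < e / 2 by rewrite divr_gt0.
have [A' dA' A'e] := Ae _ e2; have [B' dB' B'e] := Be _ e2.
exists (A' `|` B'); first exact: determinedU.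
have mA' := determined_measurable dA'; have mB' := determined_measurable dB'.
have sub : sdiff (A `|` B) (A' `|` B') `<=` sdiff A A' `|` sdiff B B'.
  by move=> x [[[Ax|Bx] /not_orP[nA nB]]|[[Ax|Bx] /not_orP[nA nB]]];
    [left; left|right; left|left; right|right; right].
have mm := measurableU _ _ (sdiff_measurable mA mA') (sdiff_measurable mB mB').
apply: (@le_lt_trans _ _ (m (sdiff A A' `|` sdiff B B'))).
  apply: le_measure; rewrite ?inE //; apply: sdiff_measurable; exact: measurableU.
apply: le_lt_trans (measureU2 m (sdiff_measurable mA mA') (sdiff_measurable mB mB')) _.
by rewrite (splitr e) EFinD; apply: lteD.
Qed.

(** Half of the error replaces the union by a finite one, by continuity from below; the other half
    approximates that finite union. *)
Lemma approximable_bigcup m (F : nat -> set S4) :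
  (forall n, approximable m (F n)) -> approximable m (\bigcup_n F n).
Proof.
move=> Fa; have mF n : measurable (F n) by case: (Fa n).
have mU : measurable (\bigcup_n F n) by exact: bigcupT_measurable.
split=> // e e0; have e2 : 0 < e / 2 by rewrite divr_gt0.
pose E n := \big[setU/set0]_(i < n.+1) F i.
have aE n : approximable m (E n).
  rewrite /E; elim: n => [|n IH]; first by rewrite big_ord1.
  by rewrite big_ord_recr /=; exact: approximableU.
have mE n : measurable (E n) by case: (aE n).
have UE : \bigcup_n E n = \bigcup_n F n by exact: bigcup_bigsetU_bigcup.
have homoE : {homo E : n k / (n <= k)%N >-> (n <= k)%O}.
  by move=> n k nk; apply/subsetPset; exact: subset_bigsetU.
have cvgE : m (E n) @[n --> \oo] --> m (\bigcup_n F n).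
  by rewrite -UE; apply: nondecreasing_cvg_mu => //; rewrite UE.
have [n nE] : exists n, (m (\bigcup_n F n) - (e / 2)%:E < m (E n))%E.
  have lt : (m (\bigcup_n F n) - (e / 2)%:E < m (\bigcup_n F n))%E.
    by rewrite lteBlDr ?fin_num_measure // lteDl ?fin_num_measure // lte_fin.
  have [k _ kP] := cvgE _ (open_nbhs_nbhs (conj (@open_ereal_gt_ereal _ _) lt)).
  by exists k; apply: (kP k) => /=.
have [B dB nB] := (aE n).2 _ e2; exists B => //.
have mB := determined_measurable dB.
have EU : E n `<=` \bigcup_n F n by rewrite -UE; exact: bigcup_sup.
have sub : sdiff (\bigcup_n F n) B `<=` (\bigcup_n F n `\` E n) `|` sdiff (E n) B.
  move=> x [[Ux nBx]|[Bx nUx]].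
    by have [Ex|nEx] := pselect (E n x); [right; left|left].
  by right; right; split => // /EU.
have mm := measurableU _ _ (measurableD mU (mE n)) (sdiff_measurable (mE n) mB).
apply: (@le_lt_trans _ _ (m ((\bigcup_n F n `\` E n) `|` sdiff (E n) B))).
  by apply: le_measure; rewrite ?inE //; exact: sdiff_measurable.
apply: le_lt_trans (measureU2 m (measurableD mU (mE n)) (sdiff_measurable (mE n) mB)) _.
rewrite (splitr e) EFinD; apply: lteD => //.
have UI : (\bigcup_n F n) `&` E n = E n.
  by apply/seteqP; split=> [x []//|x Ex]; split => //; exact: EU.
have key : (m (\bigcup_n F n) - m (E n) < (e / 2)%:E)%E.
  have fU : m (\bigcup_n F n) \is a fin_num by exact: fin_num_measure.
  have fE : m (E n) \is a fin_num by exact: fin_num_measure.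
  move: nE fU fE; case: (m (\bigcup_n F n)) => [u| |] //; case: (m (E n)) => [v| |] //.
  by rewrite -!EFinB !lte_fin !ltrBlDr => h _ _; rewrite addrC.
rewrite measureD //; first by rewrite UI; exact: key.
by rewrite ltey_eq fin_num_measure.
Qed.

(** The approximable sets form a sigma-algebra, and open sets are countable unions of determined
    ones. *)
Lemma measurable_approximable m A : measurable A -> approximable m A.
Proof.
suff sub : <<s @open S4 >> `<=` approximable m by exact: sub.
apply: smallest_sub => [|U oU]; last first.
  have [F dF ->] := open_bigcup_determined oU.
  by apply: approximable_bigcup => n; exact: determined_approximable.
split.
- by apply: determined_approximable; exists 0%N.
- by move=> B mB; rewrite setTD; exact: approximableC.
- by move=> F; exact: approximable_bigcup.
Qed.

(** A determined set is a finite disjoint union of cylinders of one length, so the inequality adds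
    up. *)
Lemma determined_le m1 m2 (K : R) B : 0 <= K ->
  (forall a n, (m1 (cyl a n) <= K%:E * m2 (cyl a n))%E) -> determined B ->
  (m1 B <= K%:E * m2 B)%E.
Proof.
move=> K0 mK [n nB]; pose c (w : n.-tuple 'I_4) : S4 := fun i => nth ord0 w i.
pose D : set (n.-tuple 'I_4) := [set w | B (c w)].
have fD : finite_set D by exact: finite_finset.
have BE : B = \bigcup_(w in D) cyl (c w) n.
  apply/seteqP; split=> [a Ba|a [w Dw aw]]; last exact: nB Dw.
  have cE i : (i < n)%N -> c [tuple a j | j < n] i = a i.
    by move=> i_n; rewrite /c (nth_mktuple _ _ (Ordinal i_n)).
  exists [tuple a j | j < n]; first by rewrite /D /=; apply: nB Ba.
  by move=> i i_n; rewrite cE.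
have tD : trivIset D (fun w => cyl (c w) n).
  move=> v w _ _ [a [av aw]]; apply: eq_from_tnth => i.
  rewrite !(tnth_nth ord0); have := av i (ltn_ord i); rewrite (aw i (ltn_ord i)).
  by [].
have cm w : D w -> measurable (cyl (c w) n) by move=> _; exact: cyl_measurable.
rewrite BE !measure_fin_bigcup // ge0_mule_fsumr; last by move=> w; exact: measure_ge0.
by apply: lee_fsum => // w _; exact: mK.
Qed.

(** With [B] determined and close to [A], [m1 A] is at most [m1 B] plus the error, [m1 B] at most
    [K] times [m2 B], and [m2 B] is itself at most the error. *)
Lemma null_le m1 m2 (K : R) A : 0 <= K ->
  (forall a n, (m1 (cyl a n) <= K%:E * m2 (cyl a n))%E) -> measurable A ->
  m2 A = 0%E -> m1 A = 0%E.
Proof.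
move=> K0 mK mA A0.
(* Approximation for the sum yields one [B] that is close to [A] for both measures. *)
pose m : {finite_measure set S4 -> \bar R} := measure_add m1 m2.
have mE B : m B = (m1 B + m2 B)%E by exact: measure_addE.
have fA : m1 A \is a fin_num by exact: fin_num_measure.
apply/eqP; rewrite eq_le measure_ge0 andbT; apply/lee_addgt0Pr => e e0; rewrite add0e.
(* The two errors contribute with factors 1 and [K], hence the division by [K + 1]. *)
have e' : 0 < e / (K + 1) by rewrite divr_gt0 // ltr_wpDl.
have [B dB] := (measurable_approximable m mA).2 _ e'; rewrite mE => AB.
have mB := determined_measurable dB.
have mS := sdiff_measurable mA mB.
have AB1 : (m1 A <= m1 B + m1 (sdiff A B))%E.
  apply: le_trans (measureU2 m1 mB mS); apply: le_measure; rewrite ?inE //.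
    exact: measurableU.
  by move=> x Ax; have [Bx|nBx] := pselect (B x); [left|right; left].
have BA2 : (m2 B <= m2 A + m2 (sdiff A B))%E.
  apply: le_trans (measureU2 m2 mA mS); apply: le_measure; rewrite ?inE //.
    exact: measurableU.
  by move=> x Bx; have [Ax|nAx] := pselect (A x); [left|right; right].
rewrite A0 add0e in BA2.
have B12 := determined_le K0 mK dB.
have f1 : m1 (sdiff A B) \is a fin_num by exact: fin_num_measure.
have f2 : m2 (sdiff A B) \is a fin_num by exact: fin_num_measure.
have f3 : m1 B \is a fin_num by exact: fin_num_measure.
have f4 : m2 B \is a fin_num by exact: fin_num_measure.
have g1 : (0 <= m1 (sdiff A B))%E by exact: measure_ge0.
have g2 : (0 <= m2 (sdiff A B))%E by exact: measure_ge0.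
move: AB AB1 BA2 B12 g1 g2.
rewrite -(fineK fA) -(fineK f1) -(fineK f2) -(fineK f3) -(fineK f4).
move: (fine (m1 A)) (fine (m1 (sdiff A B))) (fine (m2 (sdiff A B))) (fine (m1 B)) (fine (m2 B)) => x d1 d2 y z.
rewrite -!EFinD -EFinM !lee_fin lte_fin ltr_pdivlMr ?ltr_wpDl // => h1 h2 h3 h4 g1 g2.
have : K * z <= K * d2 by exact: ler_wpM2l.
have : 0 <= K * d1 by exact: mulr_ge0.
by move: h1; rewrite mulrDr mulr1 mulrDl ![_ * K]mulrC; clear -h2 h4 g2; lra.
Qed.

End comparison.

(** * The equivalence relation *)

Section shifts.
Implicit Types (u v w c p : Z2) (n N : nat) (a b : S4) (G H : graph).

Lemma gshift_gshift v w G : gshift w (gshift v G) = gshift (v + w) G.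
Proof.
congr Graph; apply/seteqP; split.
- by move=> _ [_ [u uG <-] <-]; exists u; rewrite // addrA.
- by move=> _ [u uG <-]; exists (u + v); [exists u|rewrite addrA].
- move=> _ [_ [e eG <-] <-]; exists e => //.
  by rewrite image_comp; apply: eq_imagel => u _ /=; rewrite addrA.
- move=> _ [e eG <-]; exists [set u + v | u in e]; first by exists e.
  by rewrite image_comp; apply: eq_imagel => u _ /=; rewrite addrA.
Qed.

Lemma gshift0 G : gshift 0 G = G.
Proof.
case: G => V E; congr Graph; apply/seteqP; split => /=.
- by move=> _ [u uV <-]; rewrite addr0.
- by move=> u uV; exists u; rewrite // addr0.
- move=> _ [e eE <-]; suff -> : [set u + 0 | u in e] = e by [].
  by apply/seteqP; split=> [_ [u ue <-]|u ue]; [rewrite addr0|exists u; rewrite // addr0].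
- move=> e eE; exists e => //.
  by apply/seteqP; split=> [_ [u ue <-]|u ue]; [rewrite addr0|exists u; rewrite // addr0].
Qed.

Lemma gshift_vert v w G : vert (gshift w G) v <-> vert G (v - w).
Proof.
split=> [[u uG <-]|vG]; first by rewrite addrK.
by exists (v - w); rewrite // subrK.
Qed.

Lemma gshift_edge u v w G : edge (gshift w G) [set u; v] <-> edge G [set u - w; v - w].
Proof.
split=> [[e eG eE]|uv]; last first.
  by exists [set u - w; v - w]; rewrite // image_setU !image_set1 !subrK.
suff <- : e = [set u - w; v - w] by [].
transitivity ((fun x => x - w) @` ((fun x => x + w) @` e)); last first.
  by rewrite [X in _ @` X]eE image_setU !image_set1.
rewrite image_comp.
by apply/seteqP; split=> [x xe|_ [x xe <-]] /=; [exists x; rewrite // addrK|rewrite addrK].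
Qed.

Lemma block_shift c v n : block (c + v) n = gshift v (block c n).
Proof. by rewrite block_gshift (block_gshift c) gshift_gshift. Qed.

Lemma blockin_gshift c v n G : blockin c n G -> blockin (c + v) n (gshift v G).
Proof. by rewrite /blockin block_shift => cG _ [e /cG eG <-]; exists e. Qed.

Lemma gbigcup_tail (F : nat -> graph) N :
  (forall n m, (n <= m)%N -> vert (F n) `<=` vert (F m) /\ edge (F n) `<=` edge (F m)) ->
  gbigcup F = gbigcup (fun n => F (N + n)%N).
Proof.
move=> mF; congr Graph; apply/seteqP; split=> x [n _ xn].
- by exists n => //; exact: (mF _ _ (leq_addl N n)).1.
- by exists (N + n)%N.
- by exists n => //; exact: (mF _ _ (leq_addl N n)).2.
- by exists (N + n)%N.
Qed.

(** From [N] on the digits agree, so the centers, and with them the patches, differ by a fixed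
    translation. *)
Lemma Phi_cofinal a b N : (forall m, (N <= m)%N -> a m = b m) ->
  Phi_graph b = gshift (center b N - center a N) (Phi_graph a).
Proof.
move=> ab; set v := _ - _.
have pE n : patch b (N + n) = gshift v (patch a (N + n)).
  rewrite !patch_block -block_shift; congr block; rewrite !centerD /v.
  have -> : (fun i => b (N + i)%N) = (fun i => a (N + i)%N).
    by apply/funext => i; rewrite ab // leq_addr.
  by rewrite [RHS]addrC addrA subrK.
have mono (c : S4) n m : (n <= m)%N -> vert (patch c n) `<=` vert (patch c m) /\
      edge (patch c n) `<=` edge (patch c m).
  by move=> nm; split; [exact: patch_vert_mono|exact: patch_mono].
rewrite /Phi_graph (gbigcup_tail N (mono a)) (gbigcup_tail N (mono b)).
under eq_fun do rewrite pE.
congr Graph; apply/seteqP; split.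
- by move=> _ [n _ [u un <-]]; exists u => //; exists n.
- by move=> _ [u [n _ un] <-]; exists n => //; exists u.
- by move=> _ [n _ [u un <-]]; exists u => //; exists n.
- by move=> _ [u [n _ un] <-]; exists n => //; exists u.
Qed.

Lemma exact_level p c n : (0 < n)%N -> blockin c n (kenyon_at p) -> ~ blockin c n.+1 (kenyon_at p) ->
  exists2 w, oddsum w & p + c = w *+ 2 ^ n.
Proof.
case: n => // n _ h1 h2; have cV := blockin_center h1.
have [w wV wE] := (blockinP _ cV).1 h1.
exists w => //; apply: contra_notT h2 => /(kvert_even wV)[w' w'E w'V].
by apply/(blockinP _ cV); exists w' => //; rewrite wE w'E -mulrnA -expnS.
Qed.

(** For large [m] the moved center [center a m - v] and [center b m] both become odd-sum multiples
    of 2^m in an approximating translate, and both lie within 2^m of the root. Such points coincide,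
    and equal consecutive centers give equal digits. *)
Lemma Phi_shift_coded a b v : vert (Phi_graph a) v ->
  limit_graph (gshift (- v) (Phi_graph a)) ->
  (forall n, coded b n (gshift (- v) (Phi_graph a))) ->
  exists2 N, (forall m, (N <= m)%N -> a m = b m) & center b N - center a N = - v.
Proof.
(* The successor makes [m] positive, as [exact_level] requires. *)
move=> [N0 _ vN0] lT bT; pose N := N0.+1.
suff cE m : (N <= m)%N -> center b m = center a m - v.
  exists N; last by rewrite cE // addrAC subrr add0r.
  move=> m Nm; have := cE m.+1 (leqW Nm); rewrite /= cE // addrAC => /addIr/addrI.
  by move=> /mulrn_inj2/dir_inj.
move=> Nm; have m0 : (0 < m)%N by exact: leq_trans Nm.
have vm : vert (patch a m) v by apply: patch_vert_mono vN0; exact: leq_trans (leqnSn _) Nm.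
have [p pV pT] := lT (2 ^ m.+2)%N.
have [w wo wE] := (codedP _ _ pV).1 (coded_local (leqnn _) pT (bT m)) m (leqnn m).
have [aP anP] := @Phi_coded a m m (leqnn m).
have v0 n : (m <= n)%N -> vert (block (center a m - v) n) 0.
  move: vm; rewrite patch_block /= sub0r opprB => -[vV vmn] mn; split => //.
  by apply: leq_trans vmn _; rewrite leq_exp2l.
have [||w' w'o w'E] := @exact_level p (center a m - v) m m0.
- apply: (blockin_local (v0 m (leqnn m)) _ pT); first by rewrite leq_exp2l.
  exact: blockin_gshift.
- move=> h; apply: anP; have := blockin_local (v0 _ (leqnSn m)) (leqnn _) (esym pT) h.
  by move=> /(@blockin_gshift _ v); rewrite subrK gshift_gshift addNr gshift0.
have [_] := v0 m (leqnn m); rewrite sub0r norm1N.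
have := norm1_center b m; have dE : center b m - (center a m - v) = (w - w') *+ 2 ^ m.
  by rewrite mulrnBl -wE -w'E [in RHS]opprD addrACA subrr add0r.
move=> n1 n2; have := norm1D (center b m) (- (center a m - v)); rewrite dE norm1N norm1Mn => n3.
have n4 : (norm1 (w - w')%R < 2)%N.
  have M0 : (0 < 2 ^ m)%N by rewrite expn_gt0.
  by rewrite -(ltn_pmul2r M0); apply: leq_ltn_trans n3 _; lia.
apply/subr0_eq; rewrite dE; suff -> : w - w' = 0 by rewrite mul0rn.
(* Both quotients have odd sum, so their difference has even norm; being less than 2 it is 0. *)
by apply: norm1_eq0; move: n4 wo w'o; rewrite /norm1 /oddsum /=; lia.
Qed.

(** Every neighbour of a vertex of even sum is a vertex of odd sum. Moving the root by one step thus
    leads from larger valence to valence at most 2. *)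
Lemma limit_even_shift G v : subgraph_Z2 G -> adj 0 v ->
  (forall N, exists p, [/\ kvert p, ~~ oddsum p & gball G N = gball (kenyon_at p) N]) ->
  edge G [set 0; v] /\
  forall N, exists2 p, oddsum p & gball (gshift (- v) G) N = gball (kenyon_at p) N.
Proof.
move=> sG av lG.
have odd_pv p : ~~ oddsum p -> oddsum (p + v).
  by move: av; rewrite adjE subr0 => /eqP/dir_exists[k ->]; case: (dir_cases k) => ->;
     rewrite /oddsum /=; lia.
have v_edge p : kvert p -> ~~ oddsum p -> edge (kenyon_at p) [set 0; v].
  by move=> pV pe; apply/full_edgeE; rewrite /= addr0; split => //; exact/kvert_oddsum/odd_pv.
have e0v : edge G [set 0; v].
  have [p [pV pe pN]] := lG 1%N; apply: (gball_edge (esym pN)); last exact: v_edge.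
  by exists [::].
split=> // N; have [p [pV pe pN]] := lG N.+1.
exists (p + v); first exact: odd_pv.
apply: gball_ext; [exact: sub_gshift|exact: sub_full|move=> u w [q qw qN]].
(* Prefixing the step from 0 to [v] turns walks from the new root into walks from the old one, one
   edge longer. *)
have uN : ballv G N.+1 (u + v).
  have [|W1 W2] := @gwalk_map (fun x => x + v) (gshift (- v) G) G _ _ _ _ qw.
    move=> _ [e eG <-]; suff -> : [set x + v | x in [set u - v | u in e]] = e by [].
    rewrite image_comp; apply/seteqP; split=> [_ [x xe <-]|x xe] /=; first by rewrite subrK.
    by exists x; rewrite //= subrK.
  rewrite add0r in W1 W2; exists (v :: map (fun x => x + v) q); last by rewrite /= size_map.
  by split => //=; rewrite W1 andbT; exact/asboolP.
rewrite gshift_edge !opprK; split=> h.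
- have := gball_edge pN uN h => /full_edgeE[/= h1 h2 h3].
  by rewrite adj_add in h3; apply/full_edgeE; split; rewrite //= addrAC -addrA.
- apply: (gball_edge (esym pN)); last first.
    move: h => /full_edgeE[/= h1 h2 h3]; apply/full_edgeE.
    by split; rewrite ?adj_add //= addrA addrAC.
  have := pN => /(congr1 vert) /= <-; exact: uN.
Qed.

End shifts.

(** * The inverse of the coding map *)

Section decoding.
Variable R : realType.
Implicit Types (T : Tspace R) (a b : S4) (n N : nat).

Lemma limit_coded0_valence T a : Xset R T -> coded a 0 T -> (valence T <= 2)%N.
Proof.
move=> /XsetP lT aT; have [p pV pN] := lT (2 ^ 2)%N.
have := coded_oddsum pV (coded_local (leqnn _) pN aT).
move=> /card_root_edges_odd; rewrite /valence -/(root_edges T).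
by rewrite -(root_edges_local _ pN).
Qed.

(** The decoding map, with the default [point] off [Y2set]. *)
Definition digits T : S4 := xget point [set a | Y2set R T /\ forall n, coded a n T].

Lemma digits_coded T n : Y2set R T -> coded (digits T) n T.
Proof.
move=> TY; have [a aT] := Y2set_coded TY.
have [_ h] : [set a | Y2set R T /\ forall n, coded a n T] (digits T).
  by apply: (@xgetPex _ point _); exists a.
exact: h.
Qed.

Lemma digits_notin T : ~ Y2set R T -> digits T = point.
Proof. by move=> nT; apply: xgetPN => a [/nT]. Qed.

Lemma Y2set_limit T : Y2set R T -> limit_graph T.
Proof. by move=> [[TX _] _]; exact/XsetP. Qed.

Lemma digits_cyl T a n : Y2set R T -> cyl a n (digits T) <-> coded a n T.
Proof.
move=> TY; split=> [aT|aT i i_n].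
  by apply: coded_eq (@digits_coded T n TY) => i i_n; exact: aT.
exact: (limit_coded_unique (Y2set_limit TY) (@digits_coded T n TY) aT i_n i_n).
Qed.

Lemma digits_eq T a : Y2set R T -> (forall n, coded a n T) -> digits T = a.
Proof.
move=> TY aT; apply/funext => i.
by have /(digits_cyl _ _ TY) := aT i.+1; apply.
Qed.

Lemma digits_Phi a : digits (Phi R a) = a.
Proof. by apply: digits_eq; [exact: Phi_in_Y2|move=> n; exact: Phi_coded]. Qed.

Lemma Phi_digits T : Y2set R T -> nonconst (digits T) -> Phi R (digits T) = T.
Proof.
move=> TY Tc; apply: Tspace_eq; apply/esym/limit_coded_Phi => //.
- exact: tgraphP.
- exact: Y2set_limit.
- by move=> n; exact: digits_coded.
Qed.

(** A tree of the class has a code cofinal to [a] with a known difference of centers, and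
    [Phi_cofinal] turns that difference into the very shift defining the tree. *)
Lemma Phi_eqclass a :
  Phi R @` eqclass [set: S4] cofinal a = eqclass (Y2set R) (Trel R) (Phi R a).
Proof.
apply/seteqP; split=> [_ [b [_ [N ab]] <-]|T [TY [v va TE]]].
- split; first exact: Phi_in_Y2.
  have E := Phi_cofinal ab; exists (center a N - center b N); last by rewrite opprB.
  have : vert (Phi_graph b) 0 by exists 0%N.
  by rewrite E gshift_vert sub0r opprB.
- have lT := Y2set_limit TY; rewrite TE in lT.
  have [|N ab cE] := @Phi_shift_coded a (digits T) v va lT.
    by move=> n; rewrite -TE; exact: digits_coded.
  exists (digits T); first by split => //; exists N.
  by apply: Tspace_eq; rewrite TE /= (Phi_cofinal ab) cE.
Qed.

Lemma Trel_refl T : Trel R T T.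
Proof. by exists 0; [case: (tgraphP T)|rewrite oppr0 gshift0]. Qed.

(** If the valence exceeds 2, the approximating roots have even sum and the tree re-rooted at a
    neighbour lies in Y2. *)
Lemma not_orbit_saturation T : Xset R T -> ~ Trel R (T_infty R) T ->
  saturation (Xset R) (Trel R) (Y2set R) T.
Proof.
move=> TX nT; split => //.
have [T2|T2] := boolP (valence T <= 2)%N; first by exists T; [|exact: Trel_refl].
have lT := (XsetP T).1 TX; have [sT T0 cT iT] := tgraphP T.
have [|e0v lv] := @limit_even_shift T (dir ord0) sT isT.
  move=> N; have [p pV pN] := lT N.+1; exists p; split => //; last exact: gball_le pN _.
  apply: contraNN T2 => /card_root_edges_odd.
  by rewrite /valence -/(root_edges T) -(root_edges_local _ pN).
have vT : vert T (dir ord0) by have [] := edge_vert sT e0v.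
pose T' : Tspace R := MkTspace _ (in_Tspace_shift (tgraphP T) vT).
have TE : tgraph T = gshift (dir ord0) T' by rewrite /= gshift_gshift addNr gshift0.
have T'X : Xset R T'.
  by apply/XsetP => N; have [p po pN] := lv N; exists p => //; exact: kvert_oddsum.
exists T'; last first.
  exists (- dir ord0); last by rewrite opprK.
  by apply/gshift_vert; rewrite opprK addNr.
have [a aT'] := limit_coded_exists lv.
suff nT' : ~ Trel R (T_infty R) T' by exact: (@coded_in_Y2 R T' a T'X nT' aT').
move=> /orbitP[p pV pE]; apply: nT; apply/orbitP.
exists (p - dir ord0).
  have : vert T' (- dir ord0) by apply/gshift_vert; rewrite opprK addNr.
  by rewrite pE.
by rewrite TE pE -!gshift_kenyon gshift_gshift; congr gshift; rewrite opprB addrC.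
Qed.

Lemma tree_measurable (T0 : Tspace R) : measurable [set T : Tspace R | tgraph T = T0].
Proof.
rewrite (_ : [set T : Tspace R | _] = \bigcap_N [set T : Tspace R | gball T N = gball T0 N]).
  apply: bigcapT_measurable => N; apply: gball_local_measurable.
  by exists N => T T' NT /= <-.
apply/seteqP; split=> [T /= TE N _ /=|T TN]; first by rewrite TE.
by rewrite /= (@gball_eq _ T T0) // => N; exact: (TN N).
Qed.

Lemma orbit_measurable : measurable [set T | Trel R (T_infty R) T].
Proof.
rewrite (_ : [set T | _] = \bigcup_p [set T : Tspace R | kvert p /\ tgraph T = kenyon_at p]).
  apply: countable_bigcupT_measurable; first exact: countableP.
  move=> p; have [pV|nV] := pselect (kvert p).
    rewrite (_ : [set T : Tspace R | _] = [set T : Tspace R | tgraph T = treeat R p]).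
      exact: tree_measurable.
    by rewrite treeatE //; apply/seteqP; split=> T; [case|].
  by rewrite (_ : [set T : Tspace R | _] = set0) //; apply/seteqP; split=> T // -[].
apply/seteqP; split=> [T /orbitP[p pV TE]|T [p _ [pV TE]]]; first by exists p.
by apply/orbitP; exists p.
Qed.

Lemma Y2set_measurable : measurable (Y2set R).
Proof.
rewrite (_ : Y2set R = (Xset R `\` [set T | Trel R (T_infty R) T]) `&`
  [set T | (valence T <= 2)%N]) //.
apply: measurableI; first by apply: measurableD; [exact: measurable_Xset|exact: orbit_measurable].
apply: gball_local_measurable; exists 1%N => T T' NT /=.
by rewrite /valence -/(root_edges T) -/(root_edges T') (root_edges_local _ NT).
Qed.

(** On [Y2set] the preimage of an open set is relatively open, because a code of finite order is
    read off a ball; elsewhere the map is constant. *)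
Lemma digits_measurable : measurable_fun setT digits.
Proof.
apply: (measurability (@open S4)) => // _ [U oU <-].
have mW : measurable [set T : Tspace R | exists a n, cyl a n `<=` U /\ coded a n T].
  apply: open_measurable_Tspace; rewrite openE => T [a [n [aU aT]]].
  apply: (@filterS _ _ _ [set T' : Tspace R | coded a n T']).
    by move=> T' aT'; exists a, n.
  have /gball_local_open := coded_gball_local R a n; rewrite openE; exact.
rewrite setTI (_ : digits @^-1` U =
  (Y2set R `&` [set T : Tspace R | exists a n, cyl a n `<=` U /\ coded a n T]) `|`
  (~` Y2set R `&` [set _ | U point])); last first.
  apply/seteqP; split=> [T UT|T [[TY [a [n [aU aT]]]]|[nTY Up]]] /=.
  - have [TY|nTY] := pselect (Y2set R T); [left|right].
      have [n nU] := open_cyl oU UT; split=> //; exists (digits T), n.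
      by split => //; exact: digits_coded.
    by split => //; move: UT; rewrite /= digits_notin.
  - by apply: aU; exact/digits_cyl.
  - by rewrite digits_notin.
apply: measurableU; first by apply: measurableI => //; exact: Y2set_measurable.
apply: measurableI; first by apply: measurableC; exact: Y2set_measurable.
have [Up|nUp] := pselect (U point).
  by rewrite (_ : [set _ | _] = setT) //; apply/seteqP; split.
by rewrite (_ : [set _ | _] = set0) //; apply/seteqP; split.
Qed.

Definition generic : set S4 := [set a | nonconst a].

(** The list is the prefix, and the default value of [nth] is the constant tail; the parameters form
    a countable type. *)
Definition tail_const (wk : seq 'I_4 * 'I_4) : S4 := fun i => nth wk.2 wk.1 i.

Lemma genericC : ~` generic = \bigcup_wk [set tail_const wk].
Proof.
apply/seteqP; split=> [a na|_ [[w k] _ ->] /(_ (size w))[j wj]]; last first.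
  by case; rewrite /tail_const /= !nth_default // leqW.
have [n nP] : exists n, forall j, (n <= j)%N -> a j.+1 = a j.
  apply: contrapT => h; apply: na => n; apply: contrapT => h'; apply: h.
  by exists n => j nj; apply: contrapT => aj; apply: h'; exists j.
exists (mkseq a n, a n) => //; apply/funext => i; rewrite /tail_const /=.
have [i_n|n_i] := ltnP i n; first by rewrite nth_mkseq.
rewrite nth_default ?size_mkseq //.
by elim: i n_i => [|i IH]; [rewrite leqn0 => /eqP ->|rewrite leq_eqVlt => /predU1P[->//|ni]; rewrite nP // IH].
Qed.

Lemma measurable_set1_S4 a : measurable [set a].
Proof.
rewrite (_ : [set a] = \bigcap_n cyl a n).
  by apply: bigcapT_measurable => n; exact: cyl_measurable.
apply/seteqP; split=> [_ -> n _|b ab]; first exact: cyl_refl.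
by apply/funext => i; exact: (ab i.+1 I i (ltnSn i)).
Qed.

Lemma generic_measurable : measurable generic.
Proof.
rewrite -[generic]setCK genericC; apply: measurableC; apply: countable_bigcupT_measurable.
  exact: countableP.
by move=> wk; exact: measurable_set1_S4.
Qed.

Lemma generic_saturated : saturated [set: S4] cofinal generic.
Proof.
split=> // b [_ [a ac [N ab]]] n.
have [j nj aj] := ac (maxn n N); exists j.
  exact: leq_trans (leq_maxl _ _) nj.
have Nj : (N <= j)%N by exact: leq_trans (leq_maxr _ _) nj.
by rewrite -!ab // leqW.
Qed.

(** Continuity at each generic sequence makes preimages of open sets relatively open in
    [generic]. *)
Lemma Phi_measurable : measurable_fun generic (Phi R).
Proof.
apply: (measurability (@open (Tspace R))) => // _ [U oU <-].
rewrite (_ : generic `&` _ = generic `&`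
  [set a | exists n, generic `&` cyl a n `<=` Phi R @^-1` U]); last first.
  apply/seteqP; split=> a [ac]; last first.
    by move=> [n na]; split => //; apply: na; split => //; exact: cyl_refl.
  move=> aU; split=> //; have /nbhs_TspaceP[N NU] := open_nbhs_nbhs (conj oU aU).
  have [n nP] := Phi_continuous N ac; exists n => b [_ ab]; apply: NU.
  by apply: nP => i i_n; rewrite ab.
apply: measurableI; first exact: generic_measurable.
apply: open_measurable_S4; rewrite openE => a [n na].
apply: (@filterS _ _ _ (cyl a n)); last first.
  by apply: open_nbhs_nbhs; split; [exact: cyl_open|exact: cyl_refl].
move=> b ab; exists n => c [cc bc]; apply: na; split => // i i_n.
by rewrite bc // ab.
Qed.

Lemma Phi_image C : C `<=` generic -> Phi R @` C = Y2set R `&` digits @^-1` C.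
Proof.
move=> Cg; apply/seteqP; split=> [_ [a Ca <-]|T [TY TC]].
  by split; [exact: Phi_in_Y2|rewrite /= digits_Phi].
by exists (digits T) => //; apply: Phi_digits => //; exact: Cg.
Qed.

Lemma digits_preimage_measurable C : measurable C -> measurable (Y2set R `&` digits @^-1` C).
Proof.
move=> mC; apply: measurableI; first exact: Y2set_measurable.
by rewrite -[X in measurable X]setTI; exact: digits_measurable.
Qed.

End decoding.

(** * Equivalence of the two measures and the orbit equivalence *)

Section theorem.
Variables (R : realType) (mu : probability (Tspace R) R) (s : nat -> nat) (mu4 : probability S4 R).
Hypotheses (s_subseq : {homo s : m n / (m < n)%N})
  (mu_lim : weak_limit (fun k => mu_ball R (s k)) mu)
  (mu4_uniform : uniform_product mu4).
Implicit Types (a b : S4) (n : nat).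

Let mY2 : measurable (Y2set R) := @Y2set_measurable R.

Let mD := @digits_measurable R.

(** This carries [mu] over to sequences, where [null_le] compares it with [mu4] in both
    directions. *)
Let digits_law : set S4 -> \bar R := pushforward (mrestr mu mY2) (@digits R).

Let digits_law0 : digits_law set0 = 0%E.
Proof. by rewrite /digits_law /pushforward preimage_set0 measure0. Qed.

Let digits_law_ge0 A : (0 <= digits_law A)%E.
Proof. by rewrite /digits_law /pushforward; exact: measure_ge0. Qed.

Let digits_law_sigma_additive : semi_sigma_additive digits_law.
Proof. by rewrite /digits_law; exact: measure_semi_sigma_additive. Qed.

HB.instance Definition _ := isMeasure.Build _ _ _ digits_law digits_law0 digits_law_ge0 digits_law_sigma_additive.

Let digits_law_fin : fin_num_fun digits_law.
Proof.
move=> A mA; rewrite /digits_law /pushforward /mrestr fin_num_measure // setIC.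
exact: digits_preimage_measurable.
Qed.

HB.instance Definition _ := Measure_isFinite.Build _ _ _ digits_law digits_law_fin.

Let digits_lawE A : digits_law A = mu (Y2set R `&` @digits R @^-1` A).
Proof. by rewrite /digits_law /pushforward /mrestr setIC. Qed.

Let digits_law_cylE a n : Y2set R `&` @digits R @^-1` cyl a n =
  Y2set R `&` [set T : Tspace R | coded a n T].
Proof.
by apply/seteqP; split=> T [TY aT]; split => //; move: aT => /=; rewrite digits_cyl.
Qed.

Let coded_measurable a n : measurable [set T : Tspace R | coded a n T].
Proof. by apply: gball_local_measurable; exact: coded_gball_local. Qed.

Let digits_law_le a n : (digits_law (cyl a n) <= 64%:E * mu4 (cyl a n))%E.
Proof.
rewrite digits_lawE digits_law_cylE (uniform_cyl _ _ mu4_uniform) -EFinM.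
apply: le_trans (mu_blockin s_subseq mu_lim (center_block a (leqnn n))).
apply: le_measure; rewrite ?inE.
- by apply: measurableI => //; exact: mY2.
- apply: measurableI; last exact: measurable_Xset.
  by apply: gball_local_measurable; apply: blockin_gball_local; exact: center_block.
- by move=> T [[[TX _] _] aT]; split => //; exact: (aT n (leqnn n)).1.
Qed.

Let digits_law_ge a n : (mu4 (cyl a n) <= 16%:E * digits_law (cyl a n))%E.
Proof.
have mO := @orbit_measurable R.
have O0 := measure_negligible mO (orbit_negligible s_subseq mu_lim).
have mYa : measurable (Y2set R `&` [set T : Tspace R | coded a n T]) by exact: measurableI.
rewrite digits_lawE digits_law_cylE (uniform_cyl _ _ mu4_uniform).
(* A tree of X with this code has valence at most 2, so it lies in Y2 unless it belongs to the
   orbit, which is null. *)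
have h : (mu ([set T : Tspace R | coded a n T] `&` Xset R) <=
    mu (Y2set R `&` [set T : Tspace R | coded a n T]))%E.
  rewrite -[leRHS]adde0 -O0; apply: le_trans (measureU2 mu mYa mO).
  apply: le_measure; rewrite ?inE.
  - by apply: measurableI => //; exact: measurable_Xset.
  - exact: measurableU.
  - move=> T [aT TX]; have [TO|nTO] := pselect (Trel R (T_infty R) T); [by right|left].
    split => //; split => //; apply: (limit_coded0_valence TX).
    exact: coded_le (leq0n n) aT.
apply: (@le_trans _ _ (16%:E * (1 / (16 * 4 ^+ n))%:E)%E).
  by rewrite -EFinM lee_fin div1r invfM mulVKf ?pnatr_eq0.
by rewrite lee_pmul2l ?lte_fin //; apply: le_trans h; exact: (mu_coded s_subseq mu_lim).
Qed.

Lemma full_generic : full_measure mu4 [set: S4] generic.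
Proof.
rewrite /full_measure setTD genericC; apply: countable_negligible => wk.
set a := tail_const wk; have ma := measurable_set1_S4 a.
suff : mu4 [set a] = 0%E by move=> h; apply/(negligibleP mu4 ma).
have fa : mu4 [set a] \is a fin_num by exact: fin_num_measure.
rewrite -(fineK fa); congr _%:E; apply: (@geometric_bound0 _ _ 0); first exact: fine_ge0.
move=> m _; rewrite -lee_fin (fineK fa); apply: (@le_trans _ _ (mu4 (cyl a m))).
  apply: le_measure; rewrite ?inE //; first exact: cyl_measurable.
  by move=> _ ->; exact: cyl_refl.
by rewrite (uniform_cyl _ _ mu4_uniform) lee_fin ler_peMl ?invr_ge0 ?exprn_ge0 ?ler1n.
Qed.

(** A tree of Y2 that is missed has an eventually constant code; there are countably many such
    codes, each with a null fibre. *)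
Lemma full_Phi_generic : full_measure mu (Y2set R) (Phi R @` generic).
Proof.
apply: (@negligibleS _ _ _ _ (\bigcup_wk [set T | Xset R T /\ forall n, coded (tail_const wk) n T])).
  move=> T [TY nT]; have : (~` generic) (digits T).
    by move=> Tg; apply: nT; exists (digits T) => //; exact: Phi_digits.
  rewrite genericC => -[wk _ TE]; exists wk => //; split; first by case: TY => -[].
  by move=> n; rewrite -TE; exact: digits_coded.
by apply: countable_negligible => wk; exact: coded_negligible s_subseq mu_lim _.
Qed.

Lemma Phi_orbit_equivalence :
  orbit_equivalence [set: S4] cofinal mu4 (Y2set R) (Trel R) mu (Phi R).
Proof.
have gZ := @generic_measurable.
exists generic, (Phi R @` generic); split.
- by split; [exact: generic_measurable|exact: generic_saturated|exact: full_generic].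
- split; [|split|exact: full_Phi_generic].
  + by rewrite Phi_image //; apply: digits_preimage_measurable; exact: generic_measurable.
  + by move=> _ [a _ <-]; exact: Phi_in_Y2.
  + move=> T [TY [_ [a ag <-] aT]].
    have : eqclass (Y2set R) (Trel R) (Phi R a) T by [].
    rewrite -Phi_eqclass => -[b [_ ab] <-]; exists b => //.
    by apply: generic_saturated.2; split => //; exists a.
- split; last by move=> C mC CZ; rewrite Phi_image //; exact: digits_preimage_measurable.
    split; first by move=> a ag; exists a.
    + by move=> a b _ _ ab; rewrite -(digits_Phi R a) ab digits_Phi.
    + by [].
  exact: Phi_measurable.
- by apply: aeW => a _; exact: Phi_eqclass.
- move=> C mC CZ; set A := generic `&` Phi R @^-1` C.
  have mA : measurable A by exact: Phi_measurable generic_measurable _ mC.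
  (* [digits] and [Phi] are mutually inverse between [generic] and its image, so the law of [A] is
     the measure of [C]. *)
  have CE : digits_law A = mu C.
    rewrite digits_lawE; congr (mu _); apply/seteqP; split=> [T [TY [Tg]]|T TC] /=.
      by rewrite Phi_digits.
    have [a ag aT] := CZ T TC; rewrite -aT in TC *.
    by split; [exact: Phi_in_Y2|rewrite /A /= digits_Phi].
  split=> A0.
  + by apply: (etrans (esym CE)); exact: (null_le _ digits_law_le mA A0).
  + exact: (null_le _ digits_law_ge mA (etrans CE A0)).
Qed.

End theorem.

Unset Implicit Arguments.

Theorem proposition3p2 (R : realType) (mu : probability (Tspace R) R)
    (s : nat -> nat) (mu4 : probability S4 R)
    (mu_X : mu (Xset R) = 1%E)
    (s_subseq : {homo s : m n / (m < n)%N})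
    (mu_lim : weak_limit (fun k => mu_ball R (s k)) mu)
    (mu4_uniform : uniform_product mu4) :
  (forall a : S4, Y2set R (Phi R a)) /\
  stable_orbit_equivalence [set: S4] cofinal mu4 (Xset R) (Trel R) mu
    [set: S4] (Y2set R) (Phi R).
Proof.
split; first exact: Phi_in_Y2.
split; [split => //| |exact: Phi_orbit_equivalence s_subseq mu_lim mu4_uniform].
- rewrite /full_measure (_ : saturation _ _ _ = setT) ?setDv; first exact: negligible_set0.
  by apply/seteqP; split => // a _; split => //; exists a => //; exists 0%N.
- split; [exact: Y2set_measurable|by move=> T [[]]|].
  (* The trees missed by the saturation all lie in the orbit of T_infty. *)
  apply: negligibleS (orbit_negligible s_subseq mu_lim) => T [TX nT].
  by apply: contrapT => nO; apply: nT; exact: not_orbit_saturation.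
Qed.
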